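(* Let $K\subset\mathbb{R}^2$ be a convex disc whose boundary is of class $C^2_+$, let $\kappa_m=\min_{x\in\partial K}\kappa(x)>0$ be the minimum of the curvature of $\partial K$, and let $r_M=1/\kappa_m$. Let $r>r_M$. For $n\in\mathbb{N}$ let $X_n=\{x_1,\dots,x_n\}$ be a sample of $n$ independent random points chosen according to the uniform probability distribution on $K$, and let $K_n^r=\mathrm{conv}_r(X_n)$. Then there exist a constant $\gamma>0$ and an integer $n_0$, depending only on $K$ and $r$, such that for all $n\ge n_0$ $$\mathrm{Var}\big(f_0(K_n^r)\big)\ \ge\ \gamma\, n^{1/3}\qquad\text{and}\qquad \mathrm{Var}\big(A(K_n^r)\big)\ \ge\ \gamma\, n^{-5/3}.$$
   Context: A convex disc is a compact convex subset of $\mathbb{R}^2$ with non-empty interior. Its boundary is of class $C^2_+$ if it is twice continuously differentiable with positive curvature $\kappa(x)>0$ at every $x\in\partial K$. $B$ denotes the origin-centred closed unit disc in $\mathbb{R}^2$, and $A(\cdot)$ denotes area (Lebesgue measure in $\mathbb{R}^2$). For $r\ge r_M$ and $X\subset K$, the closed $r$-hull (or $r$-spindle convex hull) of $X$ is $$\mathrm{conv}_r(X)=\bigcap_{v\in\mathbb{R}^2,\ X\subset rB+v}(rB+v),$$ the intersection of all closed circular discs of radius $r$ that contain $X$; it is contained in $K$. The set $K_n^r$ is a random convex $r$-disc-polygon: its boundary consists of arcs (edges) of circles of radius $r$. Two distinct points $x_i,x_j$ of $X_n$ determine an edge of $K_n^r$, namely the shorter arc between $x_i$ and $x_j$ of the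 boundary of a closed disc of radius $r$ having $x_i$ and $x_j$ on its boundary, if that disc contains all of $X_n$. The vertices of $K_n^r$ are the endpoints of its edges, and $f_0(K_n^r)$ denotes the number of vertices of $K_n^r$. *)

(* Defs.v *)
From HB Require Import structures.
From mathcomp Require Import all_boot all_order all_algebra finmap.
From mathcomp Require Import all_classical all_reals all_analysis.

Set Implicit Arguments.
Unset Strict Implicit.
Unset Printing Implicit Defensive.

Import Order.TTheory GRing.Theory Num.Theory.
Import numFieldNormedType.Exports.

Local Open Scope ring_scope.
Local Open Scope classical_set_scope.

Notation plane R := (R * R)%type (only parsing).

(* The library norm on a product is the max norm; its topology, hence also
   [compact], [interior], [derive1] and [continuous], is the Euclidean one, but
   lengths must be measured with [enorm]. *)
Definition enorm (R : realType) (x : plane R) : R :=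
  Num.sqrt (x.1 ^+ 2 + x.2 ^+ 2).

(* r B + v *)
Definition disc (R : realType) (r : R) (v : plane R) : set (plane R) :=
  [set x | enorm (x - v) <= r].

Definition convex_disc (R : realType) (K : set (plane R)) : Prop :=
  [/\ compact K, convex_set K & interior K !=set0].

Definition bd (R : realType) (K : set (plane R)) : set (plane R) :=
  closure K `\` interior K.

(* [c] traverses [bd K] as a simple closed regular curve of class C^2 with
   period [L]. *)
Definition C2_boundary_param (R : realType) (K : set (plane R)) (L : R)
    (c : R -> plane R) : Prop :=
  [/\ 0 < L /\ (forall s, c (s + L) = c s),
      {in `[0, L[ &, injective c} /\ range c = bd K,
      forall s, derivable c s 1 /\ derivable c^`() s 1,
      continuous c^`(2)
    & forall s, c^`() s != 0].

(* The absolute value is the curvature with respect to the inner normal when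
   [c] bounds a convex set, whichever way [c] is oriented. *)
Definition curve_curvature (R : realType) (c : R -> plane R) (s : R) : R :=
  `|(c^`() s).1 * (c^`(2) s).2 - (c^`() s).2 * (c^`(2) s).1|
    / enorm (c^`() s) ^+ 3.

(* kappa(x) = k, for x on the boundary of K.  The value does not depend on the
   parametrization. *)
Definition curvature_at (R : realType) (K : set (plane R)) (x : plane R)
    (k : R) : Prop :=
  exists L c s, [/\ C2_boundary_param K L c, c s = x & k = curve_curvature c s].

Definition class_C2plus (R : realType) (K : set (plane R)) : Prop :=
  (exists L c, C2_boundary_param K L c) /\
  (forall x k, bd K x -> curvature_at K x k -> 0 < k).

Definition is_min_curvature (R : realType) (K : set (plane R)) (m : R) : Prop :=
  let values := [set k | exists2 x, bd K x & curvature_at K x k] in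
  values m /\ lbound values m.

Definition r_hull (R : realType) (r : R) (X : set (plane R)) : set (plane R) :=
  \bigcap_(v in [set v | X `<=` disc r v]) disc r v.

(* The edge itself is the shorter arc of the circle of radius [r] around [v]
   between [x] and [y]; its endpoints are [x] and [y]. *)
Definition determine_edge (R : realType) (r : R) (X : set (plane R))
    (x y : plane R) : Prop :=
  [/\ X x, X y, x != y
    & exists v, [/\ enorm (x - v) = r, enorm (y - v) = r & X `<=` disc r v]].

Definition vertices (R : realType) (r : R) (X : set (plane R)) :
    set (plane R) :=
  [set x | exists y, determine_edge r X x y].

(* The number of vertices of [r_hull r X], for finite [X]. *)
Definition f0 (R : realType) (r : R) (X : set (plane R)) : nat :=
  #|` fset_set (vertices r X)|%fset.

Definition lebesgue2 (R : realType) : set (plane R) -> \bar R :=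
  (@lebesgue_measure R \x @lebesgue_measure R)%E.

Definition area (R : realType) (A : set (plane R)) : R := fine (lebesgue2 A).

(* [plane R] with its Borel sigma-algebra, the one [lebesgue2] lives on. *)
Notation mplane R := (measurableTypeR R * measurableTypeR R)%type
  (only parsing).

Section Sample.
Context d (T : measurableType d) (R : realType) (P : probability T R) (n : nat).

Definition independent (X : 'I_n -> {RV P >-> mplane R}) : Prop :=
  forall B : 'I_n -> set (mplane R), (forall i, measurable (B i)) ->
    P (\bigcap_i (X i @^-1` B i)) = (\prod_(i < n) P (X i @^-1` B i))%E.

Definition uniform_on (K : set (plane R)) (Y : {RV P >-> mplane R}) : Prop :=
  forall B : set (mplane R), measurable B ->
    distribution P Y B = (area (K `&` B) / area K)%:E.

Definition sample (X : 'I_n -> {RV P >-> mplane R}) (w : T) : set (plane R) :=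
  [set X i w | i in [set: 'I_n]].

End Sample.

(* Main.v *)
Require Import Defs.
From HB Require Import structures.
From mathcomp Require Import all_boot all_order all_algebra finmap.
From mathcomp Require Import all_classical all_reals all_analysis measurable_realfun.
From mathcomp Require Import ring lra.

Set Implicit Arguments.
Unset Strict Implicit.
Unset Printing Implicit Defensive.

Import Order.TTheory GRing.Theory Num.Theory.
Import numFieldNormedType.Exports.

Local Open Scope ring_scope.
Local Open Scope classical_set_scope.

(** Along a piece of the boundary of [K] place about [n^(1/3)] disjoint caps of
    width [h = n^(-1/3)] and height [h^2]. Condition on a cap holding exactly
    three sample points: one in a left box, one in a right box, and a third one
    that lies either in a low box next to the boundary, where it is a vertex, or
    in a high box of the same area, inside the hull of the rest. Given the other
    points, the difference of the two indicators (the toggle) has mean zero, so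
    it is uncorrelated with every functional that does not see the third point,
    and toggles of different caps or triples are orthogonal. Passing from the
    high to the low box adds one vertex and an area of order [h^3]. Hence the sum
    [W] of all toggles has a covariance with the functional of order [n^(1/3)]
    times this gain and a second moment of order [n^(1/3)], and the
    Cauchy-Schwarz inequality bounds the variance from below by
    [E(f W)^2 / E(W^2)].

    The hypothesis [r > 1 / kappa_m] enters through Blaschke's rolling theorem:
    [K] rolls inside discs of some radius [rho < r], so that a disc of radius [r]
    whose circle passes through the two side boxes contains all of [K] outside
    the cap. *)

(** * Variance from uncorrelated toggles *)

(** The high box is what makes the covariance computable. A point there leaves the hull as it would
    be without that point, so subtracting from the functional its value on the sample without the
    third point does not change the covariance with the toggle, and what remains is exactly the gain
    in the low box. No conditional expectation and no knowledge of the functional away from these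
    configurations is needed. A further point in the cap could hide the tip or a shoulder, hence
    exactly three. The exponents come from counting. Each box has probability of order [h^3 = 1/n],
    so a labelled triple is active with probability of order [n^(-3)], the other points avoiding the
    cap with probability bounded below. The roughly [n^3] triples contribute order one per cap,
    hence [1/h] in total, and a gain [g] yields a bound of order [g^2 / h]: this is [n^(1/3)] for
    [g = 1] and [h^5 = n^(-5/3)] for [g] of order [h^3]. The room between [rho] and [r] is needed
    because a disc through the two side boxes may be tilted: its error terms stay bounded in
    rescaled coordinates, while the advantage over the rolled disc grows linearly with height. *)

Section BoundedMeasurable.
Context d (T : measurableType d) (R : realType).
Implicit Types f g : T -> R.

Definition bmfun f := measurable_fun setT f /\ exists M, forall w, `|f w| <= M.

Lemma bmfun_cst c : bmfun (fun=> c).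
Proof. by split; [exact: measurable_cst|exists `|c|]. Qed.

Lemma bmfunD f g : bmfun f -> bmfun g -> bmfun (fun w => f w + g w).
Proof.
move=> [mf [M fM]] [mg [N gN]]; split; first exact: measurable_funD.
by exists (M + N) => w; rewrite (le_trans (ler_normD _ _))// lerD.
Qed.

Lemma bmfunM f g : bmfun f -> bmfun g -> bmfun (fun w => f w * g w).
Proof.
move=> [mf [M fM]] [mg [N gN]]; split; first exact: measurable_funM.
by exists (M * N) => w; rewrite normrM ler_pM.
Qed.

Lemma bmfunX2 f : bmfun f -> bmfun (fun w => f w ^+ 2).
Proof. exact: (fun bf => bmfunM bf bf). Qed.

Lemma bmfunZ c f : bmfun f -> bmfun (fun w => c * f w).
Proof. by move=> bf; apply: bmfunM => //; exact: bmfun_cst. Qed.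

Lemma bmfunB f g : bmfun f -> bmfun g -> bmfun (fun w => f w - g w).
Proof.
move=> bf bg; rewrite (_ : (fun w => _) = (fun w => f w + -1 * g w)).
  exact/bmfunD/bmfunZ.
by apply/funext => w; rewrite mulN1r.
Qed.

Lemma bmfun_sum I (s : seq I) (p : pred I) (F : I -> T -> R) :
  (forall i, p i -> bmfun (F i)) -> bmfun (fun w => \sum_(i <- s | p i) F i w).
Proof.
move=> bF; elim: s => [|i s IH].
  by rewrite (_ : (fun w => _) = fun=> 0); [exact: bmfun_cst|apply/funext => w; rewrite big_nil].
case: (boolP (p i)) => pi; last first.
  by rewrite (_ : (fun w => _) = fun w => \sum_(i <- s | p i) F i w)//; apply/funext => w; rewrite big_cons (negPf pi).
rewrite (_ : (fun w => _) = fun w => F i w + \sum_(i <- s | p i) F i w).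
  by apply: bmfunD => //; exact: bF.
by apply/funext => w; rewrite big_cons pi.
Qed.

Lemma bmfun_indic (A : set T) : measurable A -> bmfun (\1_A : T -> R).
Proof.
move=> mA; split; first exact: measurable_indic.
by exists 1 => w; rewrite indicE; case: (w \in A); rewrite ?normr0 ?normr1.
Qed.

Variable P : probability T R.

Definition mean f : R := \int[P]_w f w.

Lemma bmfun_integrable f : bmfun f -> P.-integrable setT (EFin \o f).
Proof.
move=> [mf [M fM]]; apply: measurable_bounded_integrable => //.
  by rewrite -ge0_fin_numE ?fin_num_measure.
exists M; split; first by rewrite num_real.
by move=> x Mx w _ /=; rewrite (le_trans (fM w))// ltW.
Qed.

Lemma meanD f g : bmfun f -> bmfun g -> mean (fun w => f w + g w) = mean f + mean g.
Proof. by move=> bf bg; apply: RintegralD => //; exact: bmfun_integrable. Qed.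

Lemma meanB f g : bmfun f -> bmfun g -> mean (fun w => f w - g w) = mean f - mean g.
Proof. by move=> bf bg; apply: RintegralB => //; exact: bmfun_integrable. Qed.

Lemma meanZ c f : bmfun f -> mean (fun w => c * f w) = c * mean f.
Proof. by move=> bf; apply: RintegralZl => //; exact: bmfun_integrable. Qed.

Lemma mean_cst c : mean (fun=> c) = c.
Proof. by rewrite /mean Rintegral_cst//= [P _]probability_setT mulr1. Qed.

Lemma mean_ge0 f : (forall w, 0 <= f w) -> 0 <= mean f.
Proof. by move=> f0; apply: Rintegral_ge0. Qed.

Lemma mean_le f g : bmfun f -> bmfun g -> (forall w, f w <= g w) -> mean f <= mean g.
Proof. by move=> bf bg fg; apply: le_Rintegral => //; exact: bmfun_integrable. Qed.

Lemma mean_sum I (s : seq I) (p : pred I) (F : I -> T -> R) :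
  (forall i, p i -> bmfun (F i)) ->
  mean (fun w => \sum_(i <- s | p i) F i w) = \sum_(i <- s | p i) mean (F i).
Proof.
move=> bF; elim: s => [|i s IH].
  by rewrite big_nil (_ : (fun w => _) = fun=> 0) ?mean_cst//; apply/funext => w; rewrite big_nil.
rewrite big_cons; case: (boolP (p i)) => pi; last first.
  by rewrite -IH; congr mean; apply/funext => w; rewrite big_cons (negPf pi).
rewrite (_ : (fun w => _) = fun w => F i w + \sum_(i <- s | p i) F i w).
  by rewrite meanD ?IH//; [exact: bF|exact: bmfun_sum].
by apply/funext => w; rewrite big_cons pi.
Qed.

Lemma mean_indic (A : set T) : measurable A -> mean \1_A = fine (P A).
Proof. by move=> mA; rewrite /mean /Rintegral integral_indic// setIT. Qed.

Lemma expectation_mean f : bmfun f -> ('E_P[f] = (mean f)%:E)%E.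
Proof.
move=> bf; rewrite unlock /mean /Rintegral fineK//.
exact: integrable_fin_num (bmfun_integrable bf).
Qed.

Lemma variance_mean f : bmfun f -> ('V_P[f] = (mean (fun w => (f w - mean f) ^+ 2)%R)%:E)%E.
Proof.
move=> bf; rewrite /variance covariance.unlock (expectation_mean bf)/=.
have b : bmfun (fun w => (f w - mean f) ^+ 2) by exact/bmfunX2/bmfunB/bmfun_cst.
by rewrite -(expectation_mean b).
Qed.

(* The quadratic [t |-> E (f - E f - t W)^2] is nonnegative at [t = a / b]. *)
Lemma variance_ge f W a b : bmfun f -> bmfun W -> mean W = 0 -> 0 <= a -> 0 < b ->
  a <= mean (fun w => f w * W w) -> mean (fun w => W w ^+ 2) <= b ->
  ((a ^+ 2 / b)%:E <= 'V_P[f])%E.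
Proof.
move=> bf bW W0 a0 b0 fW WW; rewrite variance_mean// lee_fin.
set m := mean f; pose t := a / b.
have bfm : bmfun (fun w => f w - m) by apply: bmfunB => //; exact: bmfun_cst.
have bfW : bmfun (fun w => f w * W w) by exact: bmfunM.
have bW2 : bmfun (fun w => W w ^+ 2) by exact: bmfunX2.
have bf2 : bmfun (fun w => (f w - m) ^+ 2) by exact: bmfunX2.
have := @mean_ge0 (fun w => (f w - m - t * W w) ^+ 2) (fun w => sqr_ge0 _).
rewrite (_ : (fun w => _) = (fun w => ((f w - m) ^+ 2 + t ^+ 2 * W w ^+ 2)
   - ((2 * t) * (f w * W w) - (2 * t * m) * W w))); last by apply/funext => w; ring.
have bfW' := bmfunZ (2 * t) bfW; have bW' := bmfunZ (2 * t * m) bW.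
have bW2' := bmfunZ (t ^+ 2) bW2.
rewrite meanB//; last 2 first.
- exact: bmfunD.
- exact: bmfunB.
rewrite meanD// meanB// !meanZ// W0 mulr0 subr0.
have t0 : 0 <= t by rewrite divr_ge0// ltW.
have tb : t * b = a by rewrite /t mulfVK// gt_eqF.
have -> : a ^+ 2 / b = a * t by rewrite /t expr2 mulrA.
have h1 : t ^+ 2 * mean (fun w => W w ^+ 2) <= t ^+ 2 * b by rewrite ler_wpM2l// sqr_ge0.
have h2 : 2 * t * a <= 2 * t * mean (fun w => f w * W w) by rewrite ler_wpM2l// mulr_ge0.
have h3 : t ^+ 2 * b = a * t by rewrite expr2 -mulrA tb mulrC.
have h4 : 2 * t * a = 2 * (a * t) by ring.
by move: h1 h2; rewrite h3 h4; set x := mean _; set y := mean _; set z := mean _; lra.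
Qed.

End BoundedMeasurable.
Arguments bmfun {d T R} f.
Arguments mean {d T R} P f.

(** * Exchanging the position of a single sample point *)

Section Resample.
Context d (T : measurableType d) (R : realType) (P : probability T R) (n : nat).

(** Moving the event from the domain into the measure allows [resample_ge0] to compare two finite
    measures on a common domain. *)
Lemma integral_mrestr (E : set T) (mE : measurable E) (f : T -> \bar R) :
  measurable_fun setT f -> (forall x, 0 <= f x)%E ->
  (\int[P]_(x in E) f x = \int[mrestr P mE]_x f x)%E.
Proof.
move=> mf f0; have mEC : measurable (~` E) by exact: measurableC.
have NE : mrestr P mE (~` E) = 0%E by rewrite /mrestr setICl measure0.
rewrite (ge0_negligible_integral mEC measurableT mf) ?NE//.
rewrite setTD setCK; apply: eq_measure_integral => A mA AE.
by rewrite /= /mrestr; congr (P _); apply/esym/setIidl.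
Qed.

(* Quantifying over the measurable space lets a functional of the sample be
   measured with respect to the sigma-algebra of some of the points only. *)
Definition regular (Psi : ('I_n -> mplane R) -> R) : Prop :=
  exists M, forall d' (T' : measurableType d') (Z : 'I_n -> T' -> mplane R),
    (forall i, measurable_fun setT (Z i)) ->
    measurable_fun setT (fun w => Psi (Z^~ w)) /\ forall w, `|Psi (Z^~ w)| <= M.

Variable X : 'I_n -> {RV P >-> mplane R}.
Hypothesis indX : independent X.

Definition cylinders (Z : 'I_n -> T -> mplane R) : set (set T) :=
  [set A | exists2 B : 'I_n -> set (mplane R), (forall i, measurable (B i)) &
    A = \bigcap_i (Z i @^-1` B i)].

(** A way to delete the point [j] while keeping [n] labels: for [k] different from [j], the set of
    points so obtained is the sample without [X j]. *)
Definition substituted (j k i : 'I_n) : T -> mplane R := X (if i == j then k else i).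

Lemma measurable_RV i B : measurable B -> measurable (X i @^-1` B).
Proof. by move=> mB; rewrite -[X in measurable X]setTI; exact: measurable_funPT. Qed.

Lemma measurable_bigcap_RV (B : 'I_n -> set (mplane R)) :
  (forall i, measurable (B i)) -> measurable (\bigcap_i (X i @^-1` B i)).
Proof.
move=> mB; apply: fin_bigcap_measurable => [|i _]; first exact: finite_finset.
exact: measurable_RV.
Qed.

(** The copy places two constraints on [X k], whence the intersection; [X j] occurs only in its own
    factor. *)
Lemma cylinder_indep j k A (B : 'I_n -> set (mplane R)) : j != k ->
  measurable A -> (forall i, measurable (B i)) ->
  P (\bigcap_i (substituted j k i @^-1` B i) `&` X j @^-1` A) =
  (P (X j @^-1` A) * \prod_(i < n | i != j)
     P (X i @^-1` (if i == k then B k `&` B j else B i)))%E.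
Proof.
move=> jk mA mB.
pose B' i := if i == j then A else if i == k then B k `&` B j else B i.
have -> : \bigcap_i (substituted j k i @^-1` B i) `&` X j @^-1` A
    = \bigcap_i (X i @^-1` B' i).
  apply/seteqP; split => [w [Zw Aw] i _|w Xw].
    rewrite /= /B'; case: eqP => [->//|/eqP ij]; case: eqP => [->|/eqP ik].
      split; have := Zw _ I; rewrite /substituted/=.
        by move=> /(_ k); rewrite eq_sym (negPf jk).
      by move=> /(_ j); rewrite eqxx.
    by have := Zw i I; rewrite /substituted/= (negPf ij).
  split=> [i _|]; last by have := Xw j I; rewrite /= /B' eqxx.
  rewrite /= /substituted; case: eqP => [->|/eqP ij].
    by have := Xw k I; rewrite /= /B' eqxx eq_sym (negPf jk) => -[].
  have := Xw i I; rewrite /= /B' (negPf ij); case: eqP => [->[]//|//].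
rewrite indX; last first.
  by move=> i; rewrite /B'; case: ifP => // _; case: ifP => // _; exact: measurableI.
rewrite (bigD1 j)//= {1}/B' eqxx; congr (_ * _)%E.
by apply: eq_bigr => i ij; rewrite /B' (negPf ij).
Qed.

(** The restrictions of [P] to the events [X j] in [A] and [X j] in [B] agree on the cylinders of
    the substituted sample. These form a pi-system containing the whole space, so the two measures
    agree on the generated sigma-algebra, and [Psi] is measurable for it by regularity. *)
Lemma resample_ge0 j k A B Psi : j != k -> measurable A -> measurable B ->
  P (X j @^-1` A) = P (X j @^-1` B) -> regular Psi -> (forall x, 0 <= Psi x) ->
  mean P (fun w => Psi (substituted j k ^~ w) * \1_A (X j w)) =
  mean P (fun w => Psi (substituted j k ^~ w) * \1_B (X j w)).
Proof.
move=> jk mA mB AB [M rPsi] Psi0.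
pose G := cylinders (substituted j k).
pose TG := g_sigma_algebraType G.
have mG D : <<s G >> D -> measurable D.
  apply: smallest_sub; first exact: sigma_algebra_measurable.
  move=> _ [C mC ->]; apply: fin_bigcap_measurable => [|i _]; first exact: finite_finset.
  exact: measurable_RV.
(* The identity, from [T] to the same set with fewer measurable sets, serves to push the restricted
   measures forward to the coarser sigma-algebra. *)
have mid : measurable_fun setT (id : T -> TG) by move=> _ D mD; rewrite setTI; exact: mG.
have mZ i : measurable_fun setT (substituted j k i : TG -> mplane R).
  move=> _ D mD; rewrite setTI; apply: sub_sigma_algebra.
  exists (fun i' => if i' == i then D else setT); first by move=> i'; case: ifP.
  apply/seteqP; split => [w Dw i' _|w Dw]; first by case: eqP => [->|].
  by have := Dw i I; rewrite /= eqxx.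
have [mPsi PsiM] := rPsi _ TG (substituted j k) mZ.
have key D (mD : measurable D) : mean P (fun w => Psi (substituted j k ^~ w) * \1_D (X j w)) =
    fine (\int[mrestr P (measurable_RV j mD)]_(w in (id : T -> TG) @^-1` setT)
      ((fun w => (Psi (substituted j k ^~ w))%:E) \o (id : T -> TG)) w)%E.
  rewrite preimage_setT -integral_mrestr; last 2 first.
  - exact/measurable_EFinP/(measurableT_comp mPsi).
  - by move=> w; rewrite lee_fin.
  rewrite /mean /Rintegral [in RHS]integral_mkcond; congr fine; apply: eq_integral => w _.
  rewrite /= patchE /= indicE (_ : (w \in X j @^-1` D) = (X j w \in D))//.
  by case: ifP => _; rewrite ?mulr1 ?mulr0.
rewrite !key; congr fine; rewrite -!(ge0_integral_pushforward mid)//; last 4 first.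
- exact/measurable_EFinP.
- by move=> w _; rewrite lee_fin.
- exact/measurable_EFinP.
- by move=> w _; rewrite lee_fin.
apply: (@eq_measure_integral _ TG) => D mD _.
have GT : G setT.
  by exists (fun=> setT) => //; apply/seteqP; split.
apply: (@measure_unique _ R TG G (fun=> setT)) => //.
- move=> _ _ [C mC ->] [C' mC' ->]; exists (fun i => C i `&` C' i).
    by move=> i; exact: measurableI.
  by rewrite -bigcapI.
- by rewrite bigcup_const//; exists 0%N.
- move=> _ [C mC ->]; rewrite /= /pushforward /mrestr /= !preimage_id.
  by rewrite !cylinder_indep// AB.
- by move=> _; rewrite /= /pushforward/= /mrestr preimage_setT setTI ltey_eq fin_num_measure//; exact: measurable_RV.
Qed.

Lemma regular_comp Psi (Z : 'I_n -> T -> mplane R) : regular Psi ->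
  (forall i, measurable_fun setT (Z i)) -> bmfun (fun w => Psi (Z^~ w)).
Proof. by move=> [M rPsi] mZ; have [mP PM] := rPsi _ _ Z mZ; split => //; exists M. Qed.

Lemma measurable_substituted j k i : measurable_fun setT (substituted j k i).
Proof. exact: measurable_funPT. Qed.

Lemma bmfun_indic_RV j A : measurable A -> bmfun (fun w => \1_A (X j w) : R).
Proof. by move=> mA; apply: (@bmfun_indic _ _ _ (X j @^-1` A)); exact: measurable_RV. Qed.

Lemma mean_indic_RV j A : measurable A -> mean P (fun w => \1_A (X j w)) = fine (P (X j @^-1` A)).
Proof. by move=> mA; apply: (@mean_indic _ _ _ P (X j @^-1` A)); exact: measurable_RV. Qed.

Lemma resample j k A B Psi : j != k -> measurable A -> measurable B ->
  P (X j @^-1` A) = P (X j @^-1` B) -> regular Psi ->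
  mean P (fun w => Psi (substituted j k ^~ w) * \1_A (X j w)) =
  mean P (fun w => Psi (substituted j k ^~ w) * \1_B (X j w)).
Proof.
move=> jk mA mB AB rPsi; have [M PM] := rPsi.
(* Adding the bound makes the functional nonnegative on samples; the truncation makes it so at every
   argument, and changes nothing on samples. *)
pose Psi' x := Num.max (Psi x + M) 0.
have rPsi' : regular Psi'.
  exists (M + M) => d' T' Z mZ; have [mPsi PsiM] := PM _ T' Z mZ; split.
    by apply: measurable_maxr => //; exact: measurable_funD.
  move=> w; rewrite /Psi' ger0_norm ?le_max ?lexx ?orbT// ge_max.
  have M0 := le_trans (normr_ge0 _) (PsiM w).
  by rewrite addr_ge0// andbT lerD2r (le_trans (ler_norm _)).
have Psi'E w : Psi' (substituted j k ^~ w) = Psi (substituted j k ^~ w) + M.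
  have [_ /(_ w)] := PM _ T (substituted j k) (measurable_substituted j k).
  by rewrite ler_norml -subr_ge0 opprK => /andP[? _]; apply/max_idPl.
have bP := regular_comp rPsi (measurable_substituted j k).
have h D : measurable D -> mean P (fun w => Psi (substituted j k ^~ w) * \1_D (X j w)) =
    mean P (fun w => Psi' (substituted j k ^~ w) * \1_D (X j w)) - M * fine (P (X j @^-1` D)).
  move=> mD; rewrite -mean_indic_RV// -meanZ; last exact: bmfun_indic_RV.
  have bD := bmfun_indic_RV j mD.
  rewrite -meanB; last exact: bmfunZ.
    by congr mean; apply/funext => w; rewrite Psi'E; ring.
  by apply: bmfunM => //; apply: (regular_comp rPsi'); exact: measurable_substituted.
rewrite (h A)// (h B)// AB (resample_ge0 jk mA mB AB rPsi')// => x.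
by rewrite le_max lexx orbT.
Qed.

End Resample.

(** * Toggles, their orthogonality and their correlation with a functional *)

Section Toggles.
Context d (T : measurableType d) (R : realType) (P : probability T R) (n : nat).
Variable X : 'I_n -> {RV P >-> mplane R}.
Hypothesis indX : independent X.
Variable nu : set (mplane R) -> R.
Hypothesis lawX : forall m B, measurable B -> P (X m @^-1` B) = (nu B)%:E.

Lemma regularM (F G : ('I_n -> mplane R) -> R) :
  regular F -> regular G -> regular (fun x => F x * G x).
Proof.
move=> [M rF] [N rG]; exists (M * N) => d' T' Z mZ.
have [mF FM] := rF _ T' Z mZ; have [mG GN] := rG _ T' Z mZ.
by split=> [|w]; [exact: measurable_funM|rewrite normrM ler_pM].
Qed.

Lemma regularB (F G : ('I_n -> mplane R) -> R) :
  regular F -> regular G -> regular (fun x => F x - G x).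
Proof.
move=> [M rF] [N rG]; exists (M + N) => d' T' Z mZ.
have [mF FM] := rF _ T' Z mZ; have [mG GN] := rG _ T' Z mZ.
by split=> [|w]; [exact: measurable_funB|rewrite (le_trans (ler_normB _ _))// lerD].
Qed.

Lemma regular_indic m (A : set (mplane R)) : measurable A ->
  regular (fun x : 'I_n -> mplane R => \1_A (x m)).
Proof.
move=> mA; exists 1 => d' T' Z mZ; split => [|w].
  apply: (@measurable_indic _ _ _ setT (Z m @^-1` A)).
  by rewrite -[X in measurable X]setTI; exact: mZ.
by rewrite indicE; case: (_ \in _); rewrite ?normr0 ?normr1.
Qed.

Lemma regular_prod (s : seq 'I_n) (p : pred 'I_n) (F : 'I_n -> ('I_n -> mplane R) -> R) :
  (forall i, p i -> regular (F i)) -> regular (fun x => \prod_(i <- s | p i) F i x).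
Proof.
move=> rF; elim: s => [|i s IH].
  exists 1 => d' T' Z mZ; split=> [|w]; last by rewrite big_nil normr1.
  by rewrite (_ : (fun w => _) = cst 1)//; apply/funext => w; rewrite big_nil.
case: (boolP (p i)) => pi; last first.
  rewrite (_ : (fun x => _) = fun x => \prod_(i <- s | p i) F i x)//.
  by apply/funext => w; rewrite big_cons (negPf pi).
rewrite (_ : (fun x => _) = fun x => F i x * \prod_(i <- s | p i) F i x).
  by apply: regularM => //; exact: rF.
by apply/funext => w; rewrite big_cons pi.
Qed.

Lemma regular_RV F : regular F -> bmfun (fun w => F (fun m => X m w)).
Proof. by move=> rF; apply: (regular_comp rF) => m; exact: measurable_funPT. Qed.

(** The single source of cancellation: [F] does not see the point [j], so it is unchanged when [j]
    is overwritten by [k], and resampling exchanges [A] and [B]. *)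
Lemma pull_out j k A B F : j != k -> measurable A -> measurable B -> nu A = nu B ->
  regular F ->
  (forall x x' : 'I_n -> mplane R, (forall m, m != j -> x m = x' m) -> F x = F x') ->
  mean P (fun w => F (fun m => X m w) * (\1_A (X j w) - \1_B (X j w))) = 0.
Proof.
move=> jk mA mB AB rF Fj.
have FE w : F (fun m => X m w) = F (substituted X j k ^~ w).
  by apply: Fj => m mj; rewrite /substituted (negPf mj).
have bF := regular_RV rF.
rewrite (_ : (fun w => _) = fun w => F (substituted X j k ^~ w) * \1_A (X j w) -
    F (substituted X j k ^~ w) * \1_B (X j w)); last first.
  by apply/funext => w; rewrite FE mulrBr.
have b D : measurable D -> bmfun (fun w => F (substituted X j k ^~ w) * \1_D (X j w)).
  move=> mD; apply: bmfunM; last exact: bmfun_indic_RV.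
  by apply: (regular_comp rF); exact: measurable_substituted.
have AB' : P (X j @^-1` A) = P (X j @^-1` B) by rewrite !lawX// AB.
rewrite meanB; [|exact: b|exact: b].
by rewrite (resample indX jk mA mB AB' rF) subrr.
Qed.

Lemma mean_prod_indic (S : 'I_n -> set (mplane R)) : (forall m, measurable (S m)) ->
  mean P (fun w => \prod_(m < n) \1_(S m) (X m w)) = \prod_(m < n) nu (S m).
Proof.
move=> mS; have mC := measurable_bigcap_RV X mS.
rewrite (_ : (fun w => _) = \1_(\bigcap_m (X m @^-1` S m))).
  rewrite mean_indic// indX//.
  under eq_bigr do rewrite lawX//.
  by rewrite prodEFin.
apply/funext => w; rewrite indicE; case: (boolP (w \in _)) => [|/negP] wS.
  rewrite big1// => m _; rewrite indicE mem_set//.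
  by move: wS; rewrite inE => /(_ m I).
have [m mS'] : exists m, ~ S m (X m w).
  apply/existsNP => h; apply: wS; rewrite inE => m _; exact: h.
by rewrite (bigD1 m)//= indicE memNset// mul0r.
Qed.

Lemma nu_ge0 (m : 'I_n) B : measurable B -> 0 <= nu B.
Proof. by move=> mB; rewrite -lee_fin -(lawX m mB) measure_ge0. Qed.

Lemma nu_le1 (m : 'I_n) B : measurable B -> nu B <= 1.
Proof. by move=> mB; rewrite -lee_fin -(lawX m mB) probability_le1//; exact: measurable_RV. Qed.

Variables (I : finType) (K : set (mplane R)) (C Rp Rm Ra Rb : I -> set (mplane R)).
Hypothesis (mK : measurable K) (mC : forall i, measurable (C i))
  (mRp : forall i, measurable (Rp i)) (mRm : forall i, measurable (Rm i))
  (mRa : forall i, measurable (Ra i)) (mRb : forall i, measurable (Rb i)).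
Hypothesis C_disj : forall i i' q, C i q -> C i' q -> i = i'.
Hypothesis (subp : forall i q, Rp i q -> K q /\ C i q)
  (subm : forall i q, Rm i q -> K q /\ C i q)
  (suba : forall i q, Ra i q -> C i q) (subb : forall i q, Rb i q -> C i q).
Hypothesis disj_ab : forall i q, Ra i q -> Rb i q -> False.
Hypothesis disj_pa : forall i q, Rp i q -> Ra i q -> False.
Hypothesis disj_pb : forall i q, Rp i q -> Rb i q -> False.
Hypothesis disj_ma : forall i q, Rm i q -> Ra i q -> False.
Hypothesis disj_mb : forall i q, Rm i q -> Rb i q -> False.
Hypothesis disj_pm : forall i q, Rp i q -> Rm i q -> False.
Hypothesis nu_pm : forall i, nu (Rp i) = nu (Rm i).

(** The labels of the toggled point, of the point in the left box and of the point in the right box,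
    in this order. *)
Definition triple : Type := ('I_n * 'I_n * 'I_n)%type.

Definition valid (t : triple) := [&& t.1.1 != t.1.2, t.1.1 != t.2 & t.1.2 != t.2].

Definition region i (t : triple) m : set (mplane R) :=
  if m == t.1.2 then Ra i else if m == t.2 then Rb i else K `\` C i.

Definition context_ind i (t : triple) (x : 'I_n -> mplane R) : R :=
  \prod_(m < n | m != t.1.1) \1_(region i t m) (x m).

Definition toggle i (t : triple) (x : 'I_n -> mplane R) : R :=
  context_ind i t x * (\1_(Rp i) (x t.1.1) - \1_(Rm i) (x t.1.1)).

Lemma measurable_region i t m : measurable (region i t m).
Proof. by rewrite /region; case: ifP => // _; case: ifP => // _; exact: measurableD. Qed.

Lemma regular_context i t : regular (context_ind i t).
Proof. by apply: regular_prod => m _; apply: regular_indic; exact: measurable_region. Qed.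

Lemma regular_toggle i t : regular (toggle i t).
Proof.
by apply: regularM; [exact: regular_context|apply: regularB; exact: regular_indic].
Qed.

Lemma toggle_neq0 i t x : toggle i t x != 0 ->
  (Rp i (x t.1.1) \/ Rm i (x t.1.1)) /\ forall m, m != t.1.1 -> region i t m (x m).
Proof.
rewrite mulf_eq0 negb_or => /andP[c0 s0]; split; last first.
  move=> m mj; apply: contrapT => h; move/eqP: c0; apply.
  by rewrite /context_ind (bigD1 m)//= indicE memNset ?mul0r.
apply: contrapT => /not_orP[h1 h2]; move/eqP: s0; apply.
by rewrite !indicE !memNset ?subrr.
Qed.

Lemma toggle_mem i t x m : toggle i t x != 0 -> C i (x m) ->
  [|| m == t.1.1, m == t.1.2 | m == t.2].
Proof.
move=> /toggle_neq0[_ h] Cm; apply/negPn/negP; rewrite !negb_or => /and3P[m1 m2 m3].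
by have := h m m1; rewrite /region (negPf m2) (negPf m3) => -[].
Qed.

Lemma toggle_vertex i t x : valid t -> toggle i t x != 0 ->
  [/\ C i (x t.1.1), Ra i (x t.1.2) & Rb i (x t.2)].
Proof.
move=> /and3P[jk jl kl] /toggle_neq0[h1 h]; split.
- by case: h1 => [/subp[]|/subm[]].
- by have := h t.1.2; rewrite eq_sym jk /region eqxx; apply.
- by have := h t.2; rewrite eq_sym jl /region eqxx eq_sym (negPf kl); apply.
Qed.

(** The points in the cap are told apart by the disjoint boxes that hold them, so a sample activates
    at most one labelled triple per cap. *)
Lemma toggle_same_cap i t t' x : valid t -> valid t' -> t != t' ->
  toggle i t x * toggle i t' x = 0.
Proof.
case: t t' => [[j k] l] [[j' k'] l'] vt vt' tt'; apply/eqP; rewrite mulf_eq0.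
apply: contraNT tt'; rewrite negb_or => /andP[n1 n2].
have [c1 a1 b1] := toggle_vertex vt n1; have [c2 a2 b2] := toggle_vertex vt' n2.
have [p1 _] := toggle_neq0 n1; have [p2 _] := toggle_neq0 n2.
have pa m : (Rp i (x m) \/ Rm i (x m)) -> Ra i (x m) -> False.
  by case=> [/disj_pa h /h|/disj_ma h /h].
have pb m : (Rp i (x m) \/ Rm i (x m)) -> Rb i (x m) -> False.
  by case=> [/disj_pb h /h|/disj_mb h /h].
move: c1 a1 b1 c2 a2 b2 p1 p2 => /= c1 a1 b1 c2 a2 b2 p1 p2.
have jj : j == j'.
  have /or3P[|/eqP h|/eqP h] := toggle_mem n2 c1 => //=.
  - by exfalso; apply: (pa j) => //; rewrite /= in h; rewrite h.
  - by exfalso; apply: (pb j) => //; rewrite /= in h; rewrite h.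
have kk : k == k'.
  have /or3P[/eqP h||/eqP h] := toggle_mem n2 (suba a1) => //=.
  - by exfalso; apply: (pa k) => //; rewrite /= in h; rewrite h.
  - by exfalso; apply: (@disj_ab i (x k)) => //; rewrite /= in h; rewrite h.
have ll : l == l'.
  have /or3P[/eqP h|/eqP h|] := toggle_mem n2 (subb b1) => //=.
  - by exfalso; apply: (pb l) => //; rewrite /= in h; rewrite h.
  - by exfalso; apply: (@disj_ab i (x l)) => //; rewrite /= in h; rewrite h.
by rewrite (eqP jj) (eqP kk) (eqP ll).
Qed.

(** For two caps, let [j] be the toggled point of the first. If the second triple uses [j], this
    point would lie in two disjoint caps and the product vanishes. Otherwise the second toggle sees
    [j] only through the indicator of [K] minus its cap, which is 1 wherever the first toggle is
    nonzero. [F] drops this factor and no longer depends on [j], so [pull_out] applies. *)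
Lemma toggle_orth i i' t t' : valid t -> valid t' -> (i, t) != (i', t') ->
  mean P (fun w => toggle i t (fun m => X m w) * toggle i' t' (fun m => X m w)) = 0.
Proof.
move=> vt vt' neq; have [ii'|ii'] := eqVneq i i'.
  have tt' : t != t' by apply: contra neq => /eqP->; rewrite ii'.
  rewrite (_ : (fun w => _) = fun=> 0) ?mean_cst//; apply/funext => w.
  by rewrite -ii' toggle_same_cap.
have [j_in|] := boolP [|| t.1.1 == t'.1.1, t.1.1 == t'.1.2 | t.1.1 == t'.2].
  rewrite (_ : (fun w => _) = fun=> 0) ?mean_cst//; apply/funext => w.
  apply/eqP; rewrite mulf_eq0.
  apply: contraNT ii'; rewrite negb_or => /andP[n1 n2].
  have [c1 _ _] := toggle_vertex vt n1; have [c2 a2 b2] := toggle_vertex vt' n2.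
  apply/eqP; case/or3P: j_in => /eqP h; rewrite h in c1; first exact: (C_disj c1).
    exact: (C_disj c1 (suba a2)).
  exact: (C_disj c1 (subb b2)).
rewrite !negb_or => /and3P[jj jk jl].
pose F x := context_ind i t x * ((\prod_(m < n | (m != t'.1.1) && (m != t.1.1))
  \1_(region i' t' m) (x m)) * (\1_(Rp i') (x t'.1.1) - \1_(Rm i') (x t'.1.1))).
have jk' : t.1.1 != t.1.2 by case/and3P: vt.
have := pull_out jk' (mRp i) (mRm i) (nu_pm i) (F := F); move=> h.
rewrite -{}[RHS]h.
- congr mean; apply/funext => w; rewrite /F /toggle [context_ind i' _ _]/context_ind.
  have regE : region i' t' t.1.1 = K `\` C i' by rewrite /region (negPf jk) (negPf jl).
  rewrite [X in _ * (X * _) = _](bigD1 t.1.1)//= regE.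
  set c := context_ind _ _ _; set p := \prod_(_ | _ ) _; set s' := \1_(Rp i') _ - _.
  have [s0|s0] := eqVneq (\1_(Rp i) (X t.1.1 w) - \1_(Rm i) (X t.1.1 w) : R) 0.
    by rewrite s0 !(mulr0, mul0r).
  suff -> : \1_(K `\` C i') (X t.1.1 w) = 1 :> R by ring.
  rewrite indicE mem_set//.
  have [[Kx Cx]|h] := pselect (K (X t.1.1 w) /\ C i (X t.1.1 w)).
    by split => // /(C_disj Cx) /eqP; rewrite (negPf ii').
  move/eqP: s0; case; rewrite !indicE !memNset ?subrr//.
    by move/subm.
  by move/subp.
- apply: regularM; first exact: regular_context.
  apply: regularM; last by apply: regularB; exact: regular_indic.
  by apply: regular_prod => m _; apply: regular_indic; exact: measurable_region.
- move=> x x' xx'; rewrite /F /context_ind; congr (_ * (_ * _)).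
  + by apply: eq_bigr => m /xx' ->.
  + by apply: eq_bigr => m /andP[_ /xx' ->].
  + by rewrite xx'// eq_sym.
Qed.

Lemma context_stable i t x x' : (forall m, m != t.1.1 -> x m = x' m) ->
  context_ind i t x = context_ind i t x'.
Proof. by move=> xx'; apply: eq_bigr => m /xx' ->. Qed.

Lemma mean_toggle i t : valid t -> mean P (fun w => toggle i t (fun m => X m w)) = 0.
Proof.
move=> /and3P[jk _ _]; apply: (pull_out jk) => //; first exact: regular_context.
exact: context_stable.
Qed.

Lemma mean_context i t D : valid t -> measurable D ->
  mean P (fun w => context_ind i t (fun m => X m w) * \1_D (X t.1.1 w)) =
  nu D * (nu (Ra i) * (nu (Rb i) *
    \prod_(m < n | [&& m != t.1.1, m != t.1.2 & m != t.2]) nu (K `\` C i))).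
Proof.
move=> /and3P[jk jl kl] mD.
pose S m := if m == t.1.1 then D else region i t m.
have mS m : measurable (S m) by rewrite /S; case: ifP => // _; exact: measurable_region.
transitivity (\prod_(m < n) nu (S m)).
  rewrite -mean_prod_indic//; congr mean; apply/funext => w.
  rewrite [RHS](bigD1 t.1.1)//= mulrC {1}/S eqxx; congr (_ * _).
  by apply: eq_bigr => m mj; rewrite /S (negPf mj).
rewrite (bigD1 t.1.1)//= {1}/S eqxx; congr (_ * _).
rewrite (bigD1 t.1.2)/=; last by rewrite eq_sym.
rewrite {1}/S eq_sym (negPf jk) /region eqxx; congr (_ * _).
rewrite (bigD1 t.2)/=; last by rewrite ![t.2 == _]eq_sym jl kl.
rewrite {1}/S /region (eq_sym t.2 t.1.1) (eq_sym t.2 t.1.2) (negPf jl) (negPf kl) eqxx; congr (_ * _).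
apply: eq_big => [m|m /andP[/andP[mj mk] ml]]; first by rewrite andbA.
by rewrite /S (negPf mj) /region (negPf mk) (negPf ml).
Qed.

Lemma mean_context_le i t D : valid t -> measurable D ->
  mean P (fun w => context_ind i t (fun m => X m w) * \1_D (X t.1.1 w)) <=
  nu D * nu (Ra i) * nu (Rb i).
Proof.
move=> vt mD; rewrite mean_context// -!mulrA.
have mKC : measurable (K `\` C i) by exact: measurableD.
have j := t.1.1; have := (nu_ge0 j mD, nu_ge0 j (mRa i), nu_ge0 j (mRb i)) => -[[h1 h2] h3].
rewrite ler_wpM2l// ler_wpM2l// ler_piMr// prodr_ile1// => m _.
by rewrite (nu_ge0 j)// (nu_le1 j).
Qed.

Lemma mean_context_ge i t D q : valid t -> measurable D -> 0 <= q <= nu (K `\` C i) ->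
  nu D * nu (Ra i) * nu (Rb i) * q ^+ n <=
  mean P (fun w => context_ind i t (fun m => X m w) * \1_D (X t.1.1 w)).
Proof.
move=> vt mD /andP[q0 qC]; rewrite mean_context// -!mulrA.
have mKC : measurable (K `\` C i) by exact: measurableD.
have j := t.1.1; have := (nu_ge0 j mD, nu_ge0 j (mRa i), nu_ge0 j (mRb i)) => -[[h1 h2] h3].
do 3 rewrite ler_wpM2l//.
rewrite [leRHS]big_mkcond -[X in q ^+ X]card_ord -prodr_const.
apply: ler_prod => m _; rewrite q0/=.
by case: ifP => // _; rewrite (le_trans qC)// (nu_le1 j).
Qed.

Lemma context_sqr i t x : context_ind i t x ^+ 2 = context_ind i t x.
Proof.
rewrite /context_ind expr2 -big_split; apply: eq_bigr => m _ /=.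
by rewrite indicE; case: (_ \in _); rewrite ?mulr1 ?mulr0.
Qed.

Lemma toggle_sqr i t x : toggle i t x ^+ 2 =
  context_ind i t x * \1_(Rp i) (x t.1.1) + context_ind i t x * \1_(Rm i) (x t.1.1).
Proof.
rewrite /toggle exprMn context_sqr -mulrDr !indicE; congr (_ * _).
case: (boolP (_ \in Rp i)) => [/set_mem h|_]; last first.
  by case: (_ \in _); rewrite ?subr0 ?sub0r ?sqrrN ?expr1n ?expr0n add0r.
by rewrite memNset ?subr0 ?expr1n ?addr0// => /(disj_pm h).
Qed.

Lemma mean_toggle_sqr i t : valid t ->
  mean P (fun w => toggle i t (fun m => X m w) ^+ 2) <=
  2 * (nu (Rp i) * nu (Ra i) * nu (Rb i)).
Proof.
move=> vt; have bc := regular_RV (regular_context i t).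
rewrite (_ : (fun w => _) = fun w => context_ind i t (fun m => X m w) * \1_(Rp i) (X t.1.1 w)
  + context_ind i t (fun m => X m w) * \1_(Rm i) (X t.1.1 w)); last first.
  by apply/funext => w; rewrite toggle_sqr.
rewrite meanD; [|by apply: bmfunM => //; exact: bmfun_indic_RV..].
rewrite mulr_natl mulr2n; apply: lerD; first exact: mean_context_le.
by rewrite nu_pm; exact: mean_context_le.
Qed.

Variables (Phi : set (mplane R) -> R) (delta : R).
Hypothesis rPhi : regular (fun x => Phi [set x m | m in [set: 'I_n]]).
Hypothesis delta0 : 0 <= delta.

(** Here [o] stands for the sample without its toggled point. *)
Definition cap_config i (o : set (mplane R)) : Prop :=
  finite_set o /\ exists a b, [/\ Ra i a, Rb i b, o a, o b &
    forall q, o q -> [\/ q = a, q = b | K q /\ ~ C i q]].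

Hypothesis Phi_minus : forall i o y, cap_config i o -> Rm i y -> Phi (y |` o) = Phi o.
Hypothesis Phi_plus : forall i o y, cap_config i o -> Rp i y ->
  Phi o + delta <= Phi (y |` o).

(** The value of [Phi] without the toggled point is orthogonal to the toggle by [pull_out]. Once it
    is subtracted, the integrand vanishes when the point is in [Rm i] and is at least [delta] when
    it is in [Rp i]. *)
Lemma toggle_gain i t q : valid t -> 0 <= q <= nu (K `\` C i) ->
  delta * (nu (Rp i) * nu (Ra i) * nu (Rb i) * q ^+ n) <=
  mean P (fun w => Phi (sample X w) * toggle i t (fun m => X m w)).
Proof.
move=> vt qC; have /and3P[jk jl kl] := vt.
(* The toggled point is deleted by overwriting it with a copy of the left one. *)
pose sub (x : 'I_n -> mplane R) m := x (if m == t.1.1 then t.1.2 else m).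
pose F x := Phi [set sub x m | m in [set: 'I_n]] * context_ind i t x.
have rsub : regular (fun x => Phi [set sub x m | m in [set: 'I_n]]).
  have [M rM] := rPhi; exists M => d' T' Z mZ.
  by apply: (rM _ _ (fun m => Z (if m == t.1.1 then t.1.2 else m))).
have rF : regular F by apply: regularM => //; exact: regular_context.
have F0 : mean P (fun w => F (fun m => X m w) *
    (\1_(Rp i) (X t.1.1 w) - \1_(Rm i) (X t.1.1 w))) = 0.
  apply: (pull_out jk) => // x x' xx'; rewrite /F (context_stable _ xx').
  congr (Phi _ * _); congr image; apply/funext => m; rewrite /sub.
  by case: ifP => [_|/negbT]; apply: xx'; rewrite // eq_sym.
have bP := regular_RV rPhi; have bF := regular_RV rF.
have bc := regular_RV (regular_context i t).
have bI D : measurable D -> bmfun (fun w => \1_D (X t.1.1 w) : R) by exact: bmfun_indic_RV.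
have bcI : bmfun (fun w => context_ind i t (fun m => X m w) * \1_(Rp i) (X t.1.1 w)).
  by apply: bmfunM => //; exact: bI.
apply: (@le_trans _ _ (mean P (fun w => F (fun m => X m w) *
    (\1_(Rp i) (X t.1.1 w) - \1_(Rm i) (X t.1.1 w)) +
    delta * (context_ind i t (fun m => X m w) * \1_(Rp i) (X t.1.1 w))))).
  rewrite meanD; last 2 first.
  - by apply: bmfunM => //; apply: bmfunB; exact: bI.
  - exact: bmfunZ.
  by rewrite F0 add0r meanZ// ler_wpM2l// mean_context_ge.
apply: mean_le => [||w].
- apply: bmfunD; last exact: bmfunZ.
  by apply: bmfunM => //; apply: bmfunB; exact: bI.
- by apply: bmfunM => //; exact: regular_RV (regular_toggle i t).
rewrite /F /toggle; set x := fun m => X m w; rewrite -/(x t.1.1).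
have [->|c0] := eqVneq (context_ind i t x) 0; first by rewrite !(mulr0, mul0r) addr0.
have c1 : context_ind i t x = 1.
  by apply: (mulfI c0); rewrite mulr1 -expr2 context_sqr.
have reg m : m != t.1.1 -> region i t m (x m).
  move=> mj; apply: contrapT => h; move/eqP: c0; apply.
  by rewrite /context_ind (bigD1 m)//= indicE memNset ?mul0r.
have xa : Ra i (x t.1.2) by have := reg t.1.2; rewrite eq_sym jk /region eqxx; apply.
have xb : Rb i (x t.2).
  by have := reg t.2; rewrite eq_sym jl /region eqxx eq_sym (negPf kl); apply.
pose o := [set sub x m | m in [set: 'I_n]].
have xo m : m != t.1.1 -> o (x m) by move=> mj; exists m => //; rewrite /sub (negPf mj).
have cfg : cap_config i o.
  split; first exact/finite_image/finite_finset.
  exists (x t.1.2), (x t.2); split => //; [by apply: xo; rewrite eq_sym|by apply: xo; rewrite eq_sym|].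
  have aux m : m != t.1.1 -> [\/ x m = x t.1.2, x m = x t.2 | K (x m) /\ ~ C i (x m)].
    move=> mj; have := reg m mj; rewrite /region.
    have [->|mk] := eqVneq m t.1.2; first by constructor 1.
    have [->|ml] := eqVneq m t.2; first by constructor 2.
    by move=> [Kx Cx]; constructor 3.
  by move=> _ [m _ <-]; rewrite /sub; case: ifP => [_|/negbT mj]; apply: aux; rewrite // eq_sym.
have sE : sample X w = x t.1.1 |` o.
  apply/seteqP; split => [_ [m _ <-]|z].
    by have [->|mj] := eqVneq m t.1.1; [left|right; exact: xo].
  by move=> [->|[m _ <-]]; [exists t.1.1|rewrite /sub; case: ifP => _; eexists].
rewrite sE c1 !mulr1 !mul1r -/o !indicE.
case: (boolP (_ \in Rp i)) => [/set_mem yp|_]; case: (boolP (_ \in Rm i)) => [/set_mem ym|_].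
- by case: (disj_pm yp ym).
- by rewrite subr0 !mulr1 (Phi_plus cfg).
- by rewrite (Phi_minus cfg)// mulr0 addr0.
- by rewrite subrr !mulr0 addr0.
Qed.

Lemma card_valid : (2 < n)%N -> #|[pred t | valid t]|%:R = n%:R * (n.-1%:R * n.-2%:R) :> R.
Proof.
move=> n2; rewrite -!natrM; congr (_%:R).
rewrite -sum1_card (eq_bigl (fun t : triple => valid t))//.
rewrite -(pair_big_dep xpredT (fun jk l => valid (jk, l)) (fun _ _ => 1%N))/=.
rewrite -(pair_big_dep xpredT (fun _ _ => true)
  (fun j k => \sum_(l | valid (j, k, l)) 1)%N)/=.
rewrite -[X in _ = (X * _)%N](card_ord n) -sum_nat_const; apply: eq_bigr => j _.
rewrite (bigID (fun k => j != k))/= [X in (_ + X)%N]big1 ?addn0 => [|k /negPn/eqP jk].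
  rewrite (eq_bigr (fun=> n.-2)) => [|k jk].
    rewrite sum_nat_const; congr (_ * _)%N.
    by have := cardC1 j; rewrite card_ord => <-; apply: eq_card => k; rewrite !inE eq_sym.
  rewrite sum1_card; have h := cardC (pred2 j k); rewrite card2 jk card_ord add2n in h.
  transitivity #|predC (pred2 j k)|; last by rewrite -[in RHS]h.
  by apply: eq_card => l; rewrite !inE /valid /= jk negb_or ![l == _]eq_sym.
by rewrite big_pred0// => l; rewrite /valid /= jk eqxx.
Qed.

(** Covariances with [Phi] add up over all toggles; by orthogonality so do the second moments, and
    [variance_ge] is applied to the two sums. *)
Lemma toggles_variance lo hi q : 0 <= lo -> 0 < hi -> 0 <= q ->
  (forall i, lo <= nu (Rp i) <= hi) -> (forall i, lo <= nu (Ra i) <= hi) ->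
  (forall i, lo <= nu (Rb i) <= hi) -> (forall i, q <= nu (K `\` C i)) ->
  ((#|I|%:R * #|[pred t | valid t]|%:R * (delta * (lo ^+ 3 * q ^+ n)) ^+ 2
    / (2 * hi ^+ 3))%:E <= 'V_P[fun w => Phi (sample X w)])%E.
Proof.
move=> lo0 hi0 q0 hp ha hb hq.
set N : R := #|I|%:R; set n3 : R := #|[pred t | valid t]|%:R.
(* Without caps or without valid triples the claimed bound is zero. *)
have [N0|N0] := eqVneq (N * n3) 0; first by rewrite N0 !mul0r variance_ge0.
have N1 : 0 < N * n3 by rewrite lt_neqAle eq_sym N0 mulr_ge0.
pose V (p : I * triple) := valid p.2.
pose W w := \sum_(p | V p) toggle p.1 p.2 (fun m => X m w).
pose Tg p w := toggle p.1 p.2 (fun m => X m w) : R.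
have cV : #|V|%:R = N * n3 :> R.
  rewrite -natrM -cardX; congr (_%:R); exact: eq_card.
have bTg p : bmfun (Tg p) by exact: regular_RV (regular_toggle p.1 p.2).
have bW : bmfun W by exact: (@bmfun_sum _ _ _ _ _ V Tg).
have bP : bmfun (fun w => Phi (sample X w)) by exact: regular_RV rPhi.
have -> : N * n3 * (delta * (lo ^+ 3 * q ^+ n)) ^+ 2 / (2 * hi ^+ 3) =
    (N * n3 * (delta * (lo ^+ 3 * q ^+ n))) ^+ 2 / (N * n3 * (2 * hi ^+ 3)).
  move: (N0); rewrite mulf_eq0 negb_or => /andP[N0' n0'].
  by field; rewrite N0' n0' gt_eqF.
apply: (@variance_ge _ _ _ P _ W) => //.
- rewrite (_ : W = fun w => \sum_(p | V p) Tg p w)// mean_sum//.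
  by rewrite big1// => p vp; exact: mean_toggle.
- by rewrite mulr_ge0 ?(ltW N1)// mulr_ge0// mulr_ge0// exprn_ge0.
- by rewrite mulr_gt0// mulr_gt0// exprn_gt0.
- rewrite (_ : (fun w => _) = fun w => \sum_(p | V p) Phi (sample X w) * Tg p w); last first.
    by apply/funext => w; rewrite mulr_sumr.
  rewrite mean_sum => [|p _]; last exact: bmfunM.
  rewrite -cV mulr_natl -sumr_const; apply: ler_sum => p vp.
  apply: le_trans (toggle_gain vp (q := q) _); last by rewrite q0 hq.
  have /andP[hp1 _] := hp p.1; have /andP[ha1 _] := ha p.1; have /andP[hb1 _] := hb p.1.
  rewrite ler_wpM2l// ler_wpM2r ?exprn_ge0// !exprS expr0 mulr1 mulrA.
  by rewrite ler_pM// ?mulr_ge0// ler_pM.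
- rewrite (_ : (fun w => _) = fun w => \sum_(p | V p) \sum_(p' | V p') Tg p w * Tg p' w); last first.
    by apply/funext => w; rewrite expr2 /W mulr_suml; apply: eq_bigr => p _; rewrite mulr_sumr.
  rewrite mean_sum => [|p _]; last by apply: bmfun_sum => p' _; exact: bmfunM.
  rewrite -cV mulr_natl -sumr_const; apply: ler_sum => p vp.
  rewrite mean_sum => [|p' _]; last exact: bmfunM.
  rewrite (bigD1 p)//= big1 ?addr0 => [|p' /andP[vp' pp']]; last first.
    apply: toggle_orth => //; rewrite eq_sym.
    by case: p p' pp' {vp vp'} => [? ?] [? ?].
  rewrite (_ : mean P _ = mean P (fun w => toggle p.1 p.2 (fun m => X m w) ^+ 2)); last first.
    by congr mean; apply/funext => w; rewrite expr2.
  apply: (le_trans (mean_toggle_sqr p.1 vp)).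
  have /andP[hp0 hp1] := hp p.1; have /andP[ha0 ha1] := ha p.1; have /andP[hb0 hb1] := hb p.1.
  have [p0 a0 b0] := And3 (le_trans lo0 hp0) (le_trans lo0 ha0) (le_trans lo0 hb0).
  by rewrite ler_wpM2l// !exprS expr0 mulr1 mulrA ler_pM ?mulr_ge0// ler_pM.
Qed.

End Toggles.

(** * Measurability of functionals of the sample *)

Definition dist2 (R : realType) (x y : plane R) : R :=
  (x.1 - y.1) ^+ 2 + (x.2 - y.2) ^+ 2.

Lemma enorm_dist2 (R : realType) (x v : plane R) : enorm (x - v) = Num.sqrt (dist2 x v).
Proof. by []. Qed.

Lemma dist2_ge0 (R : realType) (x y : plane R) : 0 <= dist2 x y.
Proof. by rewrite addr_ge0// sqr_ge0. Qed.

Lemma dist2_gt0 (R : realType) (a b : plane R) : (0 < dist2 a b) = (a != b).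
Proof.
rewrite lt_neqAle dist2_ge0 andbT eq_sym; congr negb; apply/eqP/eqP => [|->]; last first.
  by rewrite /dist2 !subrr expr0n addr0.
move/eqP; rewrite /dist2 paddr_eq0 ?sqr_ge0// !sqrf_eq0 !subr_eq0 => /andP[/eqP h1 /eqP h2].
by case: a b h1 h2 => [? ?] [? ?] /= -> ->.
Qed.

Lemma enorm_le (R : realType) (r : R) (v x : plane R) : 0 <= r ->
  (enorm (x - v) <= r) = (dist2 x v <= r ^+ 2).
Proof.
by move=> r0; rewrite enorm_dist2 -[in LHS](ger0_norm r0) -sqrtr_sqr ler_sqrt// sqr_ge0.
Qed.

Lemma enorm_eq (R : realType) (r : R) (v x : plane R) : 0 <= r ->
  (enorm (x - v) == r) = (dist2 x v == r ^+ 2).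
Proof.
move=> r0; rewrite enorm_dist2 -[in LHS](ger0_norm r0) -sqrtr_sqr eqr_sqrt//.
  exact: dist2_ge0.
exact: sqr_ge0.
Qed.

Section PlaneMeasurability.
Context (R : realType) d (T : measurableType d).

Lemma measurable_ltset (f g : T -> R) : measurable_fun setT f -> measurable_fun setT g ->
  measurable [set w | f w < g w].
Proof.
move=> mf mg; have := measurable_fun_ltr mf mg.
by move=> /(_ measurableT [set true]); rewrite setTI; apply.
Qed.

Lemma measurable_dist2 (y z : T -> mplane R) : measurable_fun setT y ->
  measurable_fun setT z -> measurable_fun setT (fun w => dist2 (y w) (z w)).
Proof.
move=> my mz.
have m1 (u : T -> mplane R) : measurable_fun setT u -> measurable_fun setT (fun w => (u w).1).
  by move=> mu; exact: (measurableT_comp measurable_fst mu).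
have m2 (u : T -> mplane R) : measurable_fun setT u -> measurable_fun setT (fun w => (u w).2).
  by move=> mu; exact: (measurableT_comp measurable_snd mu).
by apply: measurable_funD; apply: measurable_funX; apply: measurable_funB; (exact: m1 || exact: m2).
Qed.

Lemma continuous_dist2 (x : plane R) : continuous (dist2 x).
Proof.
move=> v; rewrite /dist2; apply: cvgD; rewrite expr2; apply: cvgM.
all: apply: cvgB; try exact: cvg_cst.
- exact: cvg_fst.
- exact: cvg_fst.
- exact: cvg_snd.
- exact: cvg_snd.
Qed.

Lemma rational_point (U : set (plane R)) : open U -> U !=set0 ->
  exists q : rat * rat, U (ratr q.1, ratr q.2).
Proof.
move=> oU [v Uv]; have := open_nbhs_nbhs (conj oU Uv) => -[[A B] /= [nA nB] AB].
have rat_in (C : set R) (a : R) : nbhs a C -> exists q : rat, C (ratr q).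
  move=> nC; have [x [Cx [q _ qE]]] := dense_rat (O := C^°) (ex_intro _ a nC) (@open_interior _ C).
  by exists q; rewrite qE; exact: interior_subset Cx.
have [p Ap] := rat_in _ _ nA; have [q Bq] := rat_in _ _ nB.
by exists (p, q); exact: (AB (_, _)).
Qed.

(* A closed condition on a bounded auxiliary point [v] holds for some [v] iff
   each of its relaxations holds for some rational [v]. *)
Lemma measurable_exists_point (L : finType) (s rho : L -> R) (y : L -> T -> mplane R) l0 :
  s l0 = 1 -> (forall l, measurable_fun setT (y l)) ->
  measurable [set w | exists v : plane R, forall l, s l * (dist2 (y l w) v - rho l) <= 0].
Proof.
move=> s1 my; pose c l w v : R := s l * (dist2 (y l w) v - rho l).
have cc l w : continuous (c l w).
  move=> v; apply: cvgM; first exact: cvg_cst.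
  by apply: cvgB; [exact: continuous_dist2|exact: cvg_cst].
pose S (k : nat) (q : rat * rat) := [set w | forall l, c l w (ratr q.1, ratr q.2) < k.+1%:R^-1].
have -> : [set w | exists v : plane R, forall l, s l * (dist2 (y l w) v - rho l) <= 0] =
    \bigcap_k \bigcup_q S k q.
  apply/seteqP; split => [w [v hv] k _|w hw].
    pose U := \bigcap_(l in [set: L]) (c l w @^-1` [set x | x < k.+1%:R^-1]).
    have oU : open U.
      rewrite /U bigcap_fset_set ?set_fsetT//; last exact: finite_finset.
      apply: big_ind => [|A B oA oB|l _]; [exact: openT|exact: openI|].
      by apply: open_comp => [v' _|]; [exact: cc|exact: open_lt].
    have [q Uq] : exists q : rat * rat, U (ratr q.1, ratr q.2).
      by apply: rational_point => //; exists v => l _; rewrite /= (le_lt_trans (hv l)).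
    by exists q => // l; exact: Uq.
  have /choice[v hv] : forall k, exists v : plane R, forall l, c l w v < k.+1%:R^-1.
    by move=> k; have [q _ hq] := hw k I; exists (ratr q.1, ratr q.2).
  (* Since [s l0 = 1], the condition [l0] bounds the distance of the relaxed solutions [v k] from
     [y l0 w]. They stay in a compact box, and a cluster point satisfies the unrelaxed conditions.
     The size [M] uses that a number is at most its square plus 1/4. *)
  pose M := 1 + (rho l0 + 1).
  pose a := y l0 w.
  pose box : set (plane R) := `[a.1 - M, a.1 + M] `*` `[a.2 - M, a.2 + M].
  have cbox : compact box by apply: compact_setX; exact: segment_compact.
  have vbox k : box (v k).
    have := hv k l0; rewrite /c s1 mul1r /dist2 -/a => h.
    have h1 : k.+1%:R^-1 <= 1 :> R by rewrite invf_le1// ler1n.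
    have sq (u u' e : R) : u ^+ 2 + u' ^+ 2 - rho l0 < e -> e <= 1 -> -M <= u <= M.
      have := sqr_ge0 (u - 1 / 2); have := sqr_ge0 (u + 1 / 2); have := sqr_ge0 u'.
      by rewrite !expr2 /M => ? ? ? ? ?; apply/andP; split; lra.
    have /andP[? ?] := sq _ _ _ h h1; rewrite [X in X - _]addrC in h.
    have /andP[? ?] := sq _ _ _ h h1.
    have itv (b e : R) : - M <= b - e <= M -> b - M <= e <= b + M.
      by move=> /andP[? ?]; apply/andP; split; lra.
    by split; rewrite /= in_itv /=; apply: itv; apply/andP; split.
  have vb : (v @ \oo) box by exists 0%N => // k _; exact: vbox.
  have [p [_ clp]] := cbox (v @ \oo) _ vb.
  exists p => l; rewrite leNgt; apply/negP => c0.
  have nU : nbhs p (c l w @^-1` [set x | c l w p / 2 < x]).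
    apply: cc; apply: open_nbhs_nbhs; split; first exact: open_gt.
    by rewrite /= /c; lra.
  have vU : (v @ \oo) [set u | c l w u < c l w p / 2].
    have c2 : 0 < c l w p / 2 by rewrite divr_gt0.
    have : \forall k \near \oo, (v k) \in [set u | c l w u < c l w p / 2].
      apply: filterS (near_infty_natSinv_lt (PosNum c2)) => k hk.
      by rewrite inE /=; exact: lt_trans (hv k l) hk.
    by apply: filterS => k; rewrite inE.
  by have [u [/= u1 u2]] := clp _ _ vU nU; lra.
apply: bigcapT_measurable => k; apply: countable_bigcupT_measurable => [|q]; first exact: countableP.
have -> : S k q = \bigcap_(l in [set: L]) [set w | c l w (ratr q.1, ratr q.2) < k.+1%:R^-1].
  by apply/seteqP; split => [w h l _|w h l]; exact: h.
apply: fin_bigcap_measurable => [|l _]; first exact: finite_finset.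
apply: measurable_ltset => //; apply: measurable_funM => //; apply: measurable_funB => //.
exact: measurable_dist2.
Qed.

End PlaneMeasurability.

Section PlaneLebesgue.
Context (R : realType).

(* Only sub-probability products have a canonical sigma-finite structure. *)
Definition mlebesgue2 : set (mplane R) -> \bar R :=
  (@lebesgue_measure R \x @lebesgue_measure R)%E.

HB.instance Definition _ := Measure.on mlebesgue2.

Lemma mlebesgue2_sigma_finite : sigma_finite setT mlebesgue2.
Proof.
have /sigma_finiteP[F [TF ndF Foo]] := sigma_finiteT (@lebesgue_measure R).
exists (fun n => F n `*` F n).
  rewrite -setXTT TF predeqE => -[x y]; split.
    move=> [/= [n _ Fnx] [k _ Gky]]; exists (maxn n k) => //; split.
    - by move: x Fnx; exact/subsetPset/ndF/leq_maxl.
    - by move: y Gky; exact/subsetPset/ndF/leq_maxr.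
  by move=> [n _ []/= ? ?]; split; exists n.
move=> k; have [? ?] := Foo k.
split; first exact: measurableX.
by rewrite /mlebesgue2 product_measure1E// lte_mul_pinfty// ge0_fin_numE.
Qed.

HB.instance Definition _ :=
  Measure_isSigmaFinite.Build _ _ _ mlebesgue2 mlebesgue2_sigma_finite.

Lemma lebesgue2_rect (A B : set R) : measurable A -> measurable B ->
  lebesgue2 (A `*` B) = (lebesgue_measure A * lebesgue_measure B)%E.
Proof. by move=> mA mB; rewrite /lebesgue2 product_measure1E. Qed.

End PlaneLebesgue.

Section SampleFunctionals.
Context (R : realType) (r : R) (n : nat).
Hypotheses (r0 : 0 < r) (n0 : (0 < n)%N).

Local Notation pts x := [set x m | m in [set: 'I_n]].

(** Sample points may coincide. Charging each vertex to its least label turns the cardinality [f0]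
    into a sum of indicators. *)
Definition first_vertex (x : 'I_n -> plane R) (i : 'I_n) : Prop :=
  vertices r (pts x) (x i) /\ forall i' : 'I_n, (i' < i)%N -> x i' != x i.

Lemma f0_sum (x : 'I_n -> plane R) :
  (f0 r (pts x))%:R = \sum_(i < n) `[< first_vertex x i >]%:R :> R.
Proof.
set V := vertices r (pts x); pose p i := `[< first_vertex x i >].
pose s := [seq x i | i <- enum 'I_n & p i].
have us : uniq s.
  rewrite map_inj_in_uniq; first by rewrite filter_uniq// enum_uniq.
  move=> i j; rewrite !mem_filter => /andP[/asboolP[_ pi] _] /andP[/asboolP[_ pj] _] xij.
  apply/val_inj/eqP; rewrite eqn_leq; apply/andP; split; rewrite leqNgt; apply/negP.
    by move=> /pi; rewrite xij eqxx.
  by move=> /pj; rewrite xij eqxx.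
have Vs : V = [set` s].
  apply/seteqP; split => [q Vq|q /= /mapP[i]]; last first.
    by rewrite mem_filter => /andP[/asboolP[Vi _] _] ->.
  have [y [[m _ xm] _ _ _]] := Vq.
  case: (@arg_minnP _ m (fun i => x i == q) val); first by rewrite xm.
  move=> i /eqP xi imin /=; apply/mapP; exists i => //.
  rewrite mem_filter mem_enum andbT; apply/asboolP; split; first by rewrite xi.
  by move=> i' ii'; apply/negP; rewrite xi => /imin; rewrite leqNgt ii'.
have -> : f0 r (pts x) = size s.
  rewrite /f0 -/V Vs; have -> : [set` s] = [set` [fset q in s]%fset].
    by apply/seteqP; split => q /=; rewrite inE.
  by rewrite set_fsetK card_fseq undup_id.
rewrite size_map size_filter -sum1_count big_enum_cond natr_sum [LHS]big_mkcond.
by apply: eq_bigr => i _; rewrite -/(p i); case: (p i).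
Qed.

Lemma measurable_determine_edge d (T : measurableType d) (Z : 'I_n -> T -> mplane R) i j :
  (forall m, measurable_fun setT (Z m)) ->
  measurable [set w | determine_edge r (pts (Z^~ w)) (Z i w) (Z j w)].
Proof.
move=> mZ.
(* Positive signs say that the disc contains the sample. The two negative ones say that the
   endpoints are not in its interior; together they place both endpoints on the circle. *)
pose s (l : option (option 'I_n)) : R := if l is Some (Some _) then 1 else - 1.
pose y l := match l with Some (Some m) => Z m | Some None => Z i | None => Z j end.
have my l : measurable_fun setT (y l) by case: l => [[m|]|]; exact: mZ.
have := measurable_exists_point (fun=> r ^+ 2) (erefl : s (Some (Some i)) = 1) my.
set E := [set w | _] => mE.
have mij : measurable [set w | 0 < dist2 (Z i w) (Z j w)].
  by apply: measurable_ltset => //; exact: measurable_dist2.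
have := measurableI _ _ mij mE; congr measurable; apply/seteqP; split => [w [/= ij [v hv]]|w /=].
  have vle m : dist2 (Z m w) v <= r ^+ 2.
    by have := hv (Some (Some m)); rewrite /= mul1r subr_le0.
  have vi : dist2 (Z i w) v = r ^+ 2.
    by apply/eqP; rewrite eq_le vle -subr_le0 -opprB -mulN1r; exact: (hv (Some None)).
  have vj : dist2 (Z j w) v = r ^+ 2.
    by apply/eqP; rewrite eq_le vle -subr_le0 -opprB -mulN1r; exact: (hv None).
  split; [by exists i|by exists j| |exists v; split].
  - by rewrite -dist2_gt0.
  - by apply/eqP; rewrite enorm_eq ?ltW// vi.
  - by apply/eqP; rewrite enorm_eq ?ltW// vj.
  - by move=> _ [m _ <-]; rewrite /disc /= enorm_le ?vle// ltW.
move=> [_ _ ij [v [vi vj vle]]]; split.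
  by rewrite dist2_gt0.
exists v => -[[m|]|].
- by rewrite /= mul1r subr_le0 -enorm_le ?(ltW r0)//; apply: vle; exists m.
- by rewrite /= mulN1r opprB subr_le0 le_eqVlt eq_sym -enorm_eq ?(ltW r0)// vi eqxx.
- by rewrite /= mulN1r opprB subr_le0 le_eqVlt eq_sym -enorm_eq ?(ltW r0)// vj eqxx.
Qed.

Lemma regular_f0 : regular (fun x : 'I_n -> mplane R => (f0 r (pts x))%:R : R).
Proof.
exists n%:R => d T Z mZ; split; last first.
  move=> w; rewrite ger0_norm// f0_sum -[X in _ <= X%:R]card_ord -sum1_card natr_sum.
  by apply: ler_sum => i _; rewrite ler_nat leq_b1.
rewrite (_ : (fun w => _) = fun w => \sum_(i < n) \1_[set w | first_vertex (Z^~ w) i] w); last first.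
  by apply/funext => w; rewrite f0_sum; apply: eq_bigr => i _; rewrite indicE.
apply: measurable_sum => i; apply: measurable_indic.
have -> : [set w | first_vertex (Z^~ w) i] =
    (\bigcup_(j in [set: 'I_n]) [set w | determine_edge r (pts (Z^~ w)) (Z i w) (Z j w)]) `&`
    \bigcap_(i' in [set i' : 'I_n | (i' < i)%N]) [set w | 0 < dist2 (Z i' w) (Z i w)].
  apply/seteqP; split => [w [[y ye] h]|w [[j _ ye] h]]; split.
  - by have [_ [j _ yj] _ _] := ye; exists j => //; rewrite /= yj.
  - by move=> i' ii'; rewrite /= dist2_gt0; exact: h.
  - by exists (Z j w).
  - by move=> i' ii'; rewrite -dist2_gt0; exact: h.
apply: measurableI.
  by apply: fin_bigcup_measurable => [|j _]; [exact: finite_finset|exact: measurable_determine_edge].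
apply: fin_bigcap_measurable => [|j _]; first exact: finite_finset.
by apply: measurable_ltset => //; exact: measurable_dist2.
Qed.

Lemma disc_sub_box (v : plane R) :
  disc r v `<=` `[v.1 - r, v.1 + r] `*` `[v.2 - r, v.2 + r].
Proof.
move=> q; rewrite /disc /= enorm_le ?(ltW r0)// /dist2 => h.
have sq (u u' : R) : u ^+ 2 + u' ^+ 2 <= r ^+ 2 -> -r <= u <= r.
  by rewrite -ler_norml => h'; rewrite -(@ler_pXn2r _ 2)// ?nnegrE ?(ltW r0)//
    real_normK ?num_real// (le_trans _ h')// lerDl sqr_ge0.
have /andP[? ?] := sq _ _ h; rewrite addrC in h.
have /andP[? ?] := sq _ _ h.
by split; rewrite /= in_itv /=; apply/andP; split; lra.
Qed.

(** Jointly in the sample and the point, so that the area is a measurable function of the sample. A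
    point is outside the hull when some disc holds the sample and misses the point; this strict
    condition is the union over [k] of closed ones with margin [1 / (k + 1)]. *)
Lemma measurable_r_hull d (T : measurableType d) (Z : 'I_n -> T -> mplane R) :
  (forall m, measurable_fun setT (Z m)) ->
  measurable [set p : T * mplane R | r_hull r (pts (Z^~ p.1)) p.2].
Proof.
move=> mZ.
pose s (l : option 'I_n) : R := if l is Some _ then 1 else - 1.
pose y l (p : T * mplane R) := if l is Some m then Z m p.1 else p.2.
have my l : measurable_fun setT (y l).
  case: l => [m|]; last exact: measurable_snd.
  exact: (measurableT_comp (mZ m) measurable_fst).
pose rho k (l : option 'I_n) : R := if l is Some _ then r ^+ 2 else r ^+ 2 + k.+1%:R^-1.
pose E k := [set p | exists v : plane R, forall l, s l * (dist2 (y l p) v - rho k l) <= 0].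
have mE k : measurable (E k).
  by apply: (@measurable_exists_point _ _ _ _ _ _ _ (Some (Ordinal n0))).
have -> : [set p : T * mplane R | r_hull r (pts (Z^~ p.1)) p.2] = ~` \bigcup_k E k.
  rewrite setC_bigcup; apply/seteqP; split => [p hp k _ [v hv]|p hp v hv].
    have : disc r v p.2.
      apply: hp => _ [m _ <-]; rewrite /disc /= enorm_le ?(ltW r0)//.
      by have := hv (Some m); rewrite /= mul1r subr_le0.
    rewrite /disc /= enorm_le ?(ltW r0)// leNgt => /negP; apply.
    have := hv None; rewrite /= mulN1r opprB subr_le0; apply: lt_le_trans.
    by rewrite ltrDl invr_gt0.
  apply: contrapT => /negP; rewrite enorm_le ?(ltW r0)// -ltNge => h.
  have e0 : 0 < dist2 p.2 v - r ^+ 2 by rewrite subr_gt0.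
  have [k _ hk] := near_infty_natSinv_lt (PosNum e0).
  apply: (hp k I); exists v => -[m|] /=.
    rewrite mul1r subr_le0 -enorm_le ?(ltW r0)//.
    by apply: hv; exists m.
  have := hk k (leqnn k); rewrite /= mulN1r opprB subr_le0 => h2.
  by rewrite -lerBrDl ltW.
by apply: measurableC; exact: bigcupT_measurable.
Qed.

Lemma measurable_hull_pts (x : 'I_n -> mplane R) : measurable (r_hull r (pts x)).
Proof.
have mx m : measurable_fun setT (fun _ : unit => x m) by exact: measurable_cst.
have := measurable_xsection tt (measurable_r_hull mx).
by rewrite xsectionE.
Qed.

Lemma regular_area : regular (fun x : 'I_n -> mplane R => area (r_hull r (pts x))).
Proof.
(* When no disc of radius [r] contains the sample, the hull is an empty intersection, that is the
   whole plane; the first term of the maximum covers this case. *)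
exists (Num.max `|area [set: plane R]| ((r + r) * (r + r))) => d T Z mZ; split; last first.
  move=> w; rewrite le_max; have [[v hv]|h] := pselect (exists v, pts (Z^~ w) `<=` disc r v).
    have bE : lebesgue2 (`[v.1 - r, v.1 + r] `*` `[v.2 - r, v.2 + r]) = ((r + r) * (r + r))%:E.
      rewrite lebesgue2_rect// !lebesgue_measure_itv/= !lte_fin.
      by rewrite !ltrD2l !gtrN// -!EFinD -EFinM; congr (_%:E); ring.
    have le_bE : (lebesgue2 (r_hull r (pts (Z^~ w))) <= ((r + r) * (r + r))%:E)%E.
      rewrite -bE; apply: le_measure; rewrite ?inE.
      - exact: measurable_hull_pts.
      - exact: measurableX.
      - by move=> q hq; apply: disc_sub_box; exact: hq.
    have fin : lebesgue2 (r_hull r (pts (Z^~ w))) \is a fin_num.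
      by rewrite ge0_fin_numE ?measure_ge0// (le_lt_trans le_bE)// ltry.
    apply/orP; right; rewrite ger0_norm ?fine_ge0 ?measure_ge0//.
    by rewrite -lee_fin fineK.
  apply/orP; left; rewrite (_ : r_hull _ _ = setT)//.
  by apply/seteqP; split => // q _ v hv; exfalso; apply: h; exists v.
pose A := [set p : T * mplane R | r_hull r (pts (Z^~ p.1)) p.2].
have mA : measurable A by exact: measurable_r_hull.
have mx : measurable_fun setT (@mlebesgue2 R \o xsection A).
  exact: measurable_fun_xsection.
rewrite (_ : (fun w => _) = fine \o (@mlebesgue2 R \o xsection A)).
  by apply: measurableT_comp => //; exact: fine_measurable.
by apply/funext => w /=; rewrite /area xsectionE.
Qed.

End SampleFunctionals.

(** * Toggling the tip of a cap *)

Section HullToggle.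
Context (R : realType) (r : R).
Hypothesis r0 : 0 < r.
Implicit Types (o : set (plane R)) (a b y v q : plane R).

Lemma disc_dist2 v q : disc r v q = (dist2 q v <= r ^+ 2) :> Prop.
Proof. by rewrite /disc /= enorm_le ?(ltW r0). Qed.

Lemma determine_edge_dist2 o a b : determine_edge r o a b <->
  [/\ o a, o b, a != b & exists v, [/\ dist2 a v = r ^+ 2, dist2 b v = r ^+ 2 &
    forall q, o q -> dist2 q v <= r ^+ 2]].
Proof.
have eqE v q : enorm (q - v) = r <-> dist2 q v = r ^+ 2.
  by split => [/eqP|/eqP]; [rewrite enorm_eq ?(ltW r0)// => /eqP|rewrite -enorm_eq ?(ltW r0)// => /eqP].
split=> -[oa ob ab [v [va vb vo]]]; split => //; exists v; split.
- exact/eqE.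
- exact/eqE.
- by move=> q /vo; rewrite disc_dist2.
- exact/eqE.
- exact/eqE.
- by move=> q /vo; rewrite disc_dist2.
Qed.

Lemma vertices_sub o : vertices r o `<=` o.
Proof. by move=> q [y []]. Qed.

Lemma determine_edge_sym o a b : determine_edge r o a b -> determine_edge r o b a.
Proof. by move=> [oa ob ab [v [va vb vo]]]; split; rewrite 1?eq_sym//; exists v. Qed.

(** Such a [y] is strictly inside every disc that competes for an edge or for the hull, so it is on
    no edge circle and excludes no disc. *)
Lemma inner_point o a b y : o a -> o b ->
  (forall v, dist2 a v <= r ^+ 2 -> dist2 b v <= r ^+ 2 -> dist2 y v < r ^+ 2) ->
  vertices r (y |` o) = vertices r o /\ r_hull r (y |` o) = r_hull r o.
Proof.
move=> oa ob inner.
have yo v : (forall q, o q -> dist2 q v <= r ^+ 2) -> dist2 y v < r ^+ 2.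
  by move=> h; apply: inner; exact: h.
split; apply/seteqP; split.
- move=> p [q /determine_edge_dist2[op oq pq [v [vp vq vo]]]].
  have yv := yo v (fun q' h => vo q' (or_intror h)).
  have ne q' : (y |` o) q' -> dist2 q' v = r ^+ 2 -> o q'.
    by move=> [->|//] e; rewrite e ltxx in yv.
  exists q; apply/determine_edge_dist2; split; [exact: ne|exact: ne|by []|].
  by exists v; split => // q' h; apply: vo; right.
- move=> p [q /determine_edge_dist2[op oq pq [v [vp vq vo]]]].
  exists q; apply/determine_edge_dist2; split; [by right|by right|by []|].
  by exists v; split => // q' [->|/vo//]; exact: ltW (yo v vo).
- move=> q hq v vo; apply: hq => q' [->|/vo//]; rewrite disc_dist2; apply/ltW/yo => q'' /vo.
  by rewrite disc_dist2.
- by move=> q hq v vo; apply: hq => q' oq'; apply: vo; right.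
Qed.

Section Tip.
Variables (o : set (plane R)) (a b y : plane R).
Hypotheses (oa : o a) (ob : o b).
Hypothesis cover : forall v, dist2 a v <= r ^+ 2 -> dist2 b v <= r ^+ 2 ->
  r ^+ 2 <= dist2 y v -> forall q, o q -> [\/ q = a, q = b | dist2 q v < r ^+ 2].
Hypothesis circle_ab : exists v, [/\ dist2 a v = r ^+ 2, dist2 b v = r ^+ 2 & r ^+ 2 < dist2 y v].
Hypothesis circle_ay : exists v, [/\ dist2 a v = r ^+ 2, dist2 y v = r ^+ 2 & dist2 b v <= r ^+ 2].
Hypothesis circle_by : exists v, [/\ dist2 b v = r ^+ 2, dist2 y v = r ^+ 2 & dist2 a v <= r ^+ 2].
Hypothesis neq_ab : a != b.

Let eqW (x z : R) : x = z -> x <= z.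
Proof. by move=> ->. Qed.

Lemma cover_le v : dist2 a v <= r ^+ 2 -> dist2 b v <= r ^+ 2 ->
  r ^+ 2 <= dist2 y v -> forall q, o q -> dist2 q v <= r ^+ 2.
Proof. by move=> ha hb hy q oq; have [->|->|/ltW] := cover ha hb hy oq. Qed.

Lemma tip_notin : ~ o y.
Proof.
move=> oy; have [v [va vb vy]] := circle_ab.
have [e|e|] := cover (eqW va) (eqW vb) (ltW vy) oy.
- by rewrite e va ltxx in vy.
- by rewrite e vb ltxx in vy.
- by rewrite ltNge (ltW vy).
Qed.

Lemma vertex_ab : vertices r o a /\ vertices r o b.
Proof.
have e : determine_edge r o a b.
  apply/determine_edge_dist2; split => //; have [v [va vb vy]] := circle_ab.
  by exists v; split => //; apply: cover_le; rewrite ?va ?vb// ltW.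
by split; [exists b|exists a; exact: determine_edge_sym].
Qed.

Lemma tip_edges : determine_edge r (y |` o) a y /\ determine_edge r (y |` o) b y.
Proof.
have ya : a != y by apply: contra_notN tip_notin => /eqP <-.
have yb : b != y by apply: contra_notN tip_notin => /eqP <-.
split; apply/determine_edge_dist2; split; [by right|by left|by []| |by right|by left|by []|].
- have [v [va vy vb]] := circle_ay; exists v; split => // q [->|]; first by rewrite vy.
  by apply: cover_le; rewrite ?va ?vy.
- have [v [vb vy va]] := circle_by; exists v; split => // q [->|]; first by rewrite vy.
  by apply: cover_le; rewrite ?vb ?vy.
Qed.

(** An old edge at a vertex other than [a] and [b] survives: if its disc missed [y], then [cover]
    would put that vertex strictly inside. The points [a] and [b] remain vertices through their
    edges to [y], and by [cover] again no edge joins [y] to any other point. *)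
Lemma tip_vertices : vertices r (y |` o) = y |` vertices r o.
Proof.
have [va vb] := vertex_ab; have [ea eb] := tip_edges.
apply/seteqP; split => p; last first.
  move=> [->|]; first by exists a; exact: determine_edge_sym.
  have [->|pa] := eqVneq p a; first by exists y.
  have [->|pb] := eqVneq p b; first by exists y.
  move=> [q /determine_edge_dist2[op oq pq [v [vp vq vo]]]].
  exists q; apply/determine_edge_dist2; split; [by right|by right|by []|].
  exists v; split => // q' [->|/vo//]; rewrite leNgt; apply/negP => vy.
  have [e|e|] := cover (vo _ oa) (vo _ ob) (ltW vy) op.
  - by rewrite e eqxx in pa.
  - by rewrite e eqxx in pb.
  - by rewrite vp ltxx.
move=> [q /determine_edge_dist2[[->|op] oq pq [v [vp vq vo]]]]; first by left.
right; have [->|pa] := eqVneq p a; first by [].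
have [->|pb] := eqVneq p b; first by [].
case: oq vq pq => [->|oq] vq pq.
  have [e|e|] := cover (vo _ (or_intror oa)) (vo _ (or_intror ob)) (eqW (esym vq)) op.
  - by rewrite e eqxx in pa.
  - by rewrite e eqxx in pb.
  - by rewrite vp ltxx.
exists q; apply/determine_edge_dist2; split => //.
by exists v; split => // q' oq'; apply: vo; right.
Qed.

Lemma f0_tip : finite_set o -> f0 r (y |` o) = (f0 r o).+1.
Proof.
move=> fo; have fV : finite_set (vertices r o) by exact: sub_finite_set (@vertices_sub o) fo.
rewrite /f0 tip_vertices fset_setU1// cardfsU1 in_fset_set// memNset//.
by move=> /vertices_sub; exact: tip_notin.
Qed.

End Tip.

Lemma finite_pts o : finite_set o -> o !=set0 ->
  exists n (x : 'I_n.+1 -> plane R), o = [set x m | m in [set: 'I_n.+1]].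
Proof.
move=> /finite_seqP[s ->] [q /= qs]; case: s qs => // q0 s _.
exists (size s), (fun m => nth q0 (q0 :: s) m); apply/seteqP; split => z.
  move=> /= zs; have zi : (index z (q0 :: s) < (size s).+1)%N by rewrite index_mem.
  by exists (Ordinal zi) => //=; rewrite nth_index.
by move=> [m _ <-]; rewrite /= mem_nth.
Qed.

Lemma measurable_finite_hull o : finite_set o -> o !=set0 ->
  measurable (r_hull r o : set (mplane R)).
Proof. by move=> fo /(finite_pts fo)[n [x ->]]; exact: measurable_hull_pts. Qed.

Lemma lebesgue2_box_le (A : set (mplane R)) v : measurable A -> A `<=` disc r v ->
  lebesgue2 A \is a fin_num.
Proof.
move=> mA Av; rewrite ge0_fin_numE ?measure_ge0//.
apply: (@le_lt_trans _ _ (lebesgue2 (`[v.1 - r, v.1 + r] `*` `[v.2 - r, v.2 + r]))).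
  apply: (@le_measure _ _ _ (@mlebesgue2 R)); rewrite ?inE//.
    exact: measurableX.
  by apply: subset_trans Av _; exact: disc_sub_box.
rewrite lebesgue2_rect// !lebesgue_measure_itv/= !lte_fin !ltrD2l !gtrN//.
by rewrite -!EFinD -EFinM ltry.
Qed.

(** The common disc around [v] keeps all areas finite, so that [fine] is additive and monotone
    here. *)
Lemma area_hull_gain o y v (Q : set (mplane R)) : finite_set o -> o !=set0 ->
  measurable Q -> (forall q, o q -> dist2 q v <= r ^+ 2) -> dist2 y v <= r ^+ 2 ->
  Q `<=` r_hull r (y |` o) -> (forall q, Q q -> ~ r_hull r o q) ->
  area (r_hull r o) + area Q <= area (r_hull r (y |` o)).
Proof.
move=> fo o0 mQ vo vy Qh Qo.
have hsub (o' : set (plane R)) : (forall q, o' q -> dist2 q v <= r ^+ 2) -> r_hull r o' `<=` disc r v.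
  by move=> h q; apply; move=> q' /h; rewrite disc_dist2.
have mh : measurable (r_hull r o : set (mplane R)) by exact: measurable_finite_hull.
have fo' : finite_set (y |` o) by rewrite finite_setU; split.
have mh' : measurable (r_hull r (y |` o) : set (mplane R)).
  by apply: measurable_finite_hull => //; exists y; left.
have h' : r_hull r (y |` o) `<=` disc r v by apply: hsub => q [->//|/vo].
have f1 := lebesgue2_box_le mh (hsub _ vo); have f2 := lebesgue2_box_le mh' h'.
have f3 := lebesgue2_box_le mQ (subset_trans Qh h').
have f12 : (lebesgue2 (r_hull r o) + lebesgue2 Q)%E \is a fin_num by rewrite fin_numD f1 f3.
rewrite /area -fineD//; apply: fine_le => //.
have -> : (lebesgue2 (r_hull r o) + lebesgue2 Q = @mlebesgue2 R (r_hull r o `|` Q))%E.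
  by rewrite measureU//; apply/seteqP; split => // q [h /Qo].
apply: (@le_measure _ _ _ (@mlebesgue2 R)); rewrite ?inE//; first exact: measurableU.
move=> q [hq|/Qh//] u uo; apply: hq => q' oq'; apply: uo; by right.
Qed.

End HullToggle.

(** * Discs of radius [r] seen in rescaled cap coordinates *)

Section ScaledPower.
Context (R : realType).

(** With [e = h^2], this is minus the power of the point [(x, z)] with respect to a circle, divided
    by [e] (see [power_loc]). [A] is the rescaled tangential and [N] the unscaled normal coordinate
    of the centre, and [G] is the value at the base point. It is nonnegative exactly on the disc. *)
Definition pw (e A N G x z : R) : R := 2 * N * z - x ^+ 2 + 2 * A * x - e * z ^+ 2 + G.

(** A disc holding both shoulders but not the tip has its centre on the inner side: interpolating
    the shoulders at the abscissa of the tip loses the chord term [(xb - x) * (x - xa)], which only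
    a positive [N] can make up for. *)
Lemma pw_normal_lb (e A N G l zt xa za xb zb x z : R) : 0 <= e -> 0 < l ->
  xa <= - l -> l <= xb -> z < za <= zt -> z < zb <= zt -> `|x| <= l / 2 -> 0 <= z ->
  0 <= pw e A N G xa za -> 0 <= pw e A N G xb zb -> pw e A N G x z <= 0 ->
  l ^+ 2 <= 8 * N * zt.
Proof.
move=> e0 l0 hxa hxb /andP[hza hza'] /andP[hzb hzb']; rewrite ler_norml => /andP[hx1 hx2] z0 fa fb fy.
have u0 : l / 2 <= xb - x by lra.
have w0 : l / 2 <= x - xa by lra.
(* the weights (xb - x) and (x - xa) average a and b above y *)
have key : 0 <= (xb - x) * (pw e A N G xa za - pw e A N G x z) + (x - xa) * (pw e A N G xb zb - pw e A N G x z).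
  by apply: addr_ge0; apply: mulr_ge0; lra.
set m := (xb - x) * (za - z) + (x - xa) * (zb - z).
have keyE : (xb - x) * (pw e A N G xa za - pw e A N G x z) + (x - xa) * (pw e A N G xb zb - pw e A N G x z)
  = 2 * N * m - (xb - xa) * ((xb - x) * (x - xa))
    - e * ((xb - x) * (za ^+ 2 - z ^+ 2) + (x - xa) * (zb ^+ 2 - z ^+ 2)) by rewrite /pw /m; ring.
have q0 : 0 <= e * ((xb - x) * (za ^+ 2 - z ^+ 2) + (x - xa) * (zb ^+ 2 - z ^+ 2)).
  apply: mulr_ge0 => //; apply: addr_ge0; apply: mulr_ge0; try lra; rewrite subr_ge0 lerXn2r// ?nnegrE; lra.
have pr : (l / 2) * (l / 2) <= (xb - x) * (x - xa) by apply: ler_pM; lra.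
have ba : 0 < xb - xa by lra.
have h1 : (xb - xa) * (l ^+ 2 / 4) <= 2 * N * m.
  have : (xb - xa) * (l ^+ 2 / 4) <= (xb - xa) * ((xb - x) * (x - xa)).
    by rewrite ler_pM2l//; apply: le_trans pr; rewrite expr2; lra.
  by move: key; rewrite keyE; lra.
have m0 : 0 < m by apply: addr_gt0; apply: mulr_gt0; lra.
have N0 : 0 < N.
  rewrite -(pmulr_lgt0 _ m0); apply: lt_le_trans (_ : (xb - xa) * (l ^+ 2 / 4) / 2 <= _); last lra.
  by rewrite divr_gt0// mulr_gt0// divr_gt0// exprn_gt0.
have mle : m <= (xb - xa) * zt.
  have a1 : (xb - x) * (za - z) <= (xb - x) * zt by rewrite ler_wpM2l//; lra.
  have a2 : (x - xa) * (zb - z) <= (x - xa) * zt by rewrite ler_wpM2l//; lra.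
  by rewrite /m; lra.
have h2 : 2 * N * m <= 2 * N * ((xb - xa) * zt) by rewrite ler_wpM2l// mulr_ge0// ltW.
have h3 : (xb - xa) * (l ^+ 2 / 4) <= (xb - xa) * (2 * N * zt) by lra.
by move: h3; rewrite ler_pM2l//; lra.
Qed.

(** A centre far to the right would favour the tip over the left shoulder. The bound on the other
    side is the mirror image, by [pw_mirror]. *)
Lemma pw_tangential_ub (e A N G l zt xa za x z : R) : 0 <= e -> e * zt ^+ 2 <= l ^+ 2 / 4 ->
  0 < l -> 0 <= N -> xa <= - l -> 0 <= z <= za -> za <= zt -> `|x| <= l / 2 ->
  0 <= pw e A N G xa za -> pw e A N G x z <= 0 -> A * l <= 2 * N * zt + l ^+ 2.
Proof.
move=> e0 ez l0 N0 hxa /andP[z0 zza] hza hx fa fy.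
have hx2 : x ^+ 2 <= l ^+ 2 / 4.
  have := hx; rewrite -(@ler_pXn2r _ 2)// ?nnegrE//; last lra.
  by rewrite real_normK ?num_real// expr_div_n -natrX.
move: hx; rewrite ler_norml => /andP[hx1 hx2'].
have [A0|A0] := leP A 0.
  have : A * l <= 0 by rewrite mulr_le0_ge0// ltW.
  have := sqr_ge0 l; have : 0 <= N * zt by rewrite mulr_ge0//; lra.
  lra.
have h1 : 2 * A * (x - xa) <= 2 * N * (za - z) + x ^+ 2 - xa ^+ 2 - e * (za ^+ 2 - z ^+ 2).
  by have : 0 <= pw e A N G xa za - pw e A N G x z by [lra]; rewrite /pw; lra.
have h2 : 0 <= e * (za ^+ 2 - z ^+ 2).
  by apply: mulr_ge0 => //; rewrite subr_ge0 lerXn2r// ?nnegrE; lra.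
have h3 : N * (za - z) <= N * zt by rewrite ler_wpM2l//; lra.
have h4 : A * (l / 2) <= A * (x - xa) by rewrite ler_pM2l//; lra.
have := sqr_ge0 xa; have := sqr_ge0 l; lra.
Qed.

Lemma pw_mirror (e A N G x z : R) : pw e (- A) N G (- x) z = pw e A N G x z.
Proof. by rewrite /pw; ring. Qed.

Lemma pw_complete_square (r e A N G x z : R) : e * G = r ^+ 2 - N ^+ 2 - e * A ^+ 2 ->
  e * pw e A N G x z = r ^+ 2 - (N - e * z) ^+ 2 - e * (A - x) ^+ 2.
Proof.
move=> eG; transitivity (e * (2 * N * z - x ^+ 2 + 2 * A * x - e * z ^+ 2) + e * G).
  by rewrite /pw; ring.
by rewrite eG; ring.
Qed.

Lemma pw_normal_ub (r e A N G zt x z : R) : 0 <= r -> 0 <= e -> e * zt <= 1 ->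
  e * G = r ^+ 2 - N ^+ 2 - e * A ^+ 2 -> 0 <= z <= zt -> 0 <= pw e A N G x z ->
  `|N| <= r + 1.
Proof.
move=> r0 e0 ez eG /andP[z0 zzt] f0.
have h : (N - e * z) ^+ 2 <= r ^+ 2.
  have : 0 <= e * pw e A N G x z by exact: mulr_ge0.
  rewrite (pw_complete_square _ _ eG) => h.
  have h2 : 0 <= e * (A - x) ^+ 2 by rewrite mulr_ge0// sqr_ge0.
  by clear - h h2; lra.
have : `|N - e * z| <= r.
  by rewrite -(@ler_pXn2r _ 2)// ?nnegrE// real_normK ?num_real.
have ezz : e * z <= e * zt by rewrite ler_wpM2l.
have ezz0 : 0 <= e * z by rewrite mulr_ge0.
clear - ez ezz ezz0; rewrite !ler_norml => /andP[h1 h2].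
by apply/andP; split; lra.
Qed.

(** In the rolled disc of radius [r'] the terms in [N] and the squares leave at least
    [(r - r') * z]. The factor [k] is chosen so that the tangential term consumes at most half of
    this growth, and the other half overcomes the constants once [z] is large. *)
Lemma pw_far (r r' CA CG A N e G x z : R) : 0 < r' -> r' < r -> 0 < CA ->
  (r + r') / 2 <= N -> `|A| <= CA -> - CG <= G ->
  x ^+ 2 + e * z ^+ 2 <= 2 * r' * z -> 0 <= e ->
  (CG + 4 * r' * CA ^+ 2 / (r - r')) * 2 / (r - r') < z -> 0 < pw e A N G x z.
Proof.
move=> r'0 rr CA0 hN hA hG hK e0 hz.
have D0 : 0 < r - r' by rewrite subr_gt0.
set D := r - r' in D0 hz *.
have ez0 : 0 <= e * z ^+ 2 by rewrite mulr_ge0// sqr_ge0.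
have z0 : 0 <= z.
  have : 0 <= 2 * r' * z by have := sqr_ge0 x; clear - hK ez0; lra.
  by rewrite pmulr_rge0// mulr_gt0.
pose k := D / (4 * r').
have k0 : 0 < k by rewrite divr_gt0// mulr_gt0.
have kr : k * r' = D / 4 by rewrite /k; field; rewrite gt_eqF.
have kk : CA ^+ 2 / k = 4 * r' * CA ^+ 2 / D by rewrite /k; field; rewrite !gt_eqF.
(* AM-GM *)
have amgm : - (k * x ^+ 2 + CA ^+ 2 / k) <= 2 * A * x.
  have h1 : 0 <= k * (x + A / k) ^+ 2 by rewrite mulr_ge0 ?sqr_ge0// ltW.
  have h2 : k * (x + A / k) ^+ 2 = k * x ^+ 2 + 2 * A * x + A ^+ 2 / k by field; rewrite gt_eqF.
  have h3 : A ^+ 2 / k <= CA ^+ 2 / k.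
    rewrite ler_pM2r ?invr_gt0// -(real_normK (num_real A)) lerXn2r ?nnegrE//.
    exact: ltW.
  by clear - h1 h2 h3; lra.
have kx : k * x ^+ 2 <= D / 2 * z.
  have : k * x ^+ 2 <= k * (2 * r' * z).
    by rewrite ler_pM2l//; clear - hK ez0; lra.
  have -> : k * (2 * r' * z) = 2 * (k * r') * z by ring.
  by rewrite kr; clear; lra.
have Nz : 2 * N * z - x ^+ 2 - e * z ^+ 2 >= D * z.
  have : (r + r') / 2 * z <= N * z by rewrite ler_wpM2r.
  by rewrite /D; clear - hK; lra.
have hz' : (CG + CA ^+ 2 / k) < D / 2 * z.
  by move: hz; rewrite kk ltr_pdivrMr//; clear; lra.
rewrite /pw; clear - amgm kx Nz hz' hG; lra.
Qed.

End ScaledPower.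

Section CoverFar.
Context (R : realType).

(* A disc of radius [r] holding the shoulders [a] and [b] but not the tip [y]
   has its centre within [O(h)] of the normal at distance [r - O(h^2)], hence
   contains everything of the slightly smaller rolled disc that is not low. *)
Lemma cover_far (r r' l L zt : R) : 0 < r' -> r' < r -> 0 < l -> l <= L -> 0 < zt ->
  exists Z e0, [/\ zt <= Z, 0 < e0 & forall e, 0 < e -> e < e0 ->
  forall A N G, e * G = r ^+ 2 - N ^+ 2 - e * A ^+ 2 ->
  forall xa za xb zb x z, - L <= xa <= - l -> l <= xb <= L -> z < za <= zt -> z < zb <= zt ->
    `|x| <= l / 2 -> 0 <= z ->
    0 <= pw e A N G xa za -> 0 <= pw e A N G xb zb -> pw e A N G x z <= 0 ->
  forall x' z', x' ^+ 2 + e * z' ^+ 2 <= 2 * r' * z' -> Z < z' -> 0 < pw e A N G x' z'].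
Proof.
move=> r'0 rr l0 lL zt0; have r0 : 0 < r by exact: lt_trans rr.
(* [CN] and [CA] will bound [N] and [|A|], while [- CG] and [CG'] enclose [G]; none of them depends
   on [e]. *)
pose CN := r + 1.
pose CA := (2 * CN * zt + l ^+ 2) / l.
pose CG := 2 * CN * zt + 2 * CA * L.
pose CG' := l ^+ 2 + CA * l.
have CN0 : 0 < CN by rewrite addr_gt0.
have CA0 : 0 < CA by rewrite divr_gt0// addr_gt0 ?exprn_gt0// !mulr_gt0.
have L0 : 0 < L by exact: lt_le_trans lL.
have CG0 : 0 < CG by apply: addr_gt0; apply: mulr_gt0 => //; exact: mulr_gt0.
have CG'0 : 0 < CG' by apply: addr_gt0; [exact: exprn_gt0|exact: mulr_gt0].
pose Z0 := (CG + 4 * r' * CA ^+ 2 / (r - r')) * 2 / (r - r').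
(* [e1] and [e2] make the terms in [e * z] harmless up to height [zt]. [e3] forces
   [N^2 = r^2 - e * (G + A^2)] to be at least [((r + r') / 2)^2]. *)
pose e1 := l ^+ 2 / 4 / zt ^+ 2.
pose e2 := zt^-1.
pose e3 := (r ^+ 2 - ((r + r') / 2) ^+ 2) / (CG' + CA ^+ 2).
have rr2 : 0 < r ^+ 2 - ((r + r') / 2) ^+ 2.
  by rewrite subr_gt0 ltrXn2r// ?nnegrE; clear - r'0 rr r0; lra.
exists (Num.max zt Z0), (Num.min e1 (Num.min e2 e3)); split.
- by rewrite le_max lexx.
- rewrite !lt_min /e1 /e2 /e3 invr_gt0 zt0 !divr_gt0 ?exprn_gt0//.
  by rewrite addr_gt0 ?exprn_gt0.
move=> e e_gt0; rewrite !lt_min => /and3P[he1 he2 he3] A N G eG xa za xb zb x z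
  /andP[xa1 xa2] /andP[xb1 xb2] hza hzb hx z0 fa fb fy x' z' hK hz.
have e0 := ltW e_gt0.
have ez2 : e * zt ^+ 2 <= l ^+ 2 / 4.
  by rewrite -ler_pdivlMr ?exprn_gt0// ltW.
have ez1 : e * zt <= 1 by rewrite -ler_pdivlMr// mul1r ltW.
have N0 : 0 < N.
  have := pw_normal_lb e0 l0 xa2 xb1 hza hzb hx z0 fa fb fy.
  move=> h; have l2 : 0 < 8 * N * zt by apply: lt_le_trans h; exact: exprn_gt0.
  by move: l2; rewrite pmulr_lgt0// pmulr_rgt0.
have /andP[hza1 hza2] := hza; have /andP[hzb1 hzb2] := hzb.
have NCN : N <= CN.
  have zac : 0 <= za <= zt by rewrite hza2 (le_trans z0 (ltW hza1)).
  exact: le_trans (ler_norm _) (pw_normal_ub (ltW r0) e0 ez1 eG zac fa).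
have Ab (B xc zc w : R) : xc <= - l -> z < zc -> zc <= zt -> `|w| <= l / 2 ->
    0 <= pw e B N G xc zc -> pw e B N G w z <= 0 -> B <= CA.
  move=> h1 h2 h3 h4 h5 h6; rewrite ler_pdivlMr//.
  have z0c : 0 <= z <= zc by rewrite z0 ltW.
  apply: le_trans (pw_tangential_ub e0 ez2 l0 (ltW N0) h1 z0c h3 h4 h5 h6) _.
  by rewrite lerD2r ler_pM2r// ler_pM2l.
have hA : `|A| <= CA.
  rewrite ler_norml lerNl; apply/andP; split; last exact: (Ab A xa za x).
  by apply: (Ab (- A) (- xb) zb (- x)); rewrite ?pw_mirror ?normrN ?lerN2.
have hG : - CG <= G.
  have h1 : 2 * N * za <= 2 * CN * zt.
    by apply: ler_pM => //; rewrite ?mulr_ge0 ?(ltW N0) ?(le_trans z0 (ltW hza1))// ler_pM2l.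
  have h2 : A * xa <= CA * L.
    apply: le_trans (ler_norm _) _; rewrite normrM ler_pM// ler_norml xa1.
    by rewrite (le_trans xa2)//; clear - L0 l0; lra.
  have h3 : 0 <= e * za ^+ 2 by rewrite mulr_ge0 ?sqr_ge0.
  move: fa; have := sqr_ge0 xa; rewrite /pw /CG; clear - h1 h2 h3; lra.
have hG' : G <= CG'.
  have h1 : 0 <= N * z by rewrite mulr_ge0// ltW.
  have h2 : - (A * x) <= CA * (l / 2).
    by apply: le_trans (ler_norm _) _; rewrite normrN normrM ler_pM.
  have h3 : e * z ^+ 2 <= l ^+ 2 / 4.
    by apply: le_trans ez2; rewrite ler_wpM2l// lerXn2r ?nnegrE// ?ltW//; clear - hza1 hza2 z0; lra.
  have h4 : x ^+ 2 <= l ^+ 2 / 4.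
    have -> : l ^+ 2 / 4 = (l / 2) ^+ 2 by field.
    by rewrite -(real_normK (num_real x)) lerXn2r ?nnegrE//; clear - l0; lra.
  move: fy; have := sqr_ge0 l; rewrite /pw /CG'; clear - h1 h2 h3 h4; lra.
have hN : (r + r') / 2 <= N.
  rewrite -(@ler_pXn2r _ 2)// ?nnegrE ?(ltW N0)//; last by clear - r0 r'0; lra.
  have h1 : e * (CG' + CA ^+ 2) <= r ^+ 2 - ((r + r') / 2) ^+ 2.
    by rewrite -ler_pdivlMr ?ltW// addr_gt0 ?exprn_gt0.
  have h2 : e * (G + A ^+ 2) <= e * (CG' + CA ^+ 2).
    rewrite ler_pM2l// lerD// -(real_normK (num_real A)) lerXn2r ?nnegrE//.
    exact: ltW.
  by clear - eG h1 h2; lra.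
apply: (@pw_far R r r' CA CG) => //.
by apply: le_lt_trans hz; rewrite le_max lexx orbT.
Qed.

End CoverFar.

Section ShoulderTip.
Context (R : realType).

(** Convexity of a disc in barycentric form: the [S] are doubled signed areas, and the value at the
    point is the weighted mean of the values at the vertices plus weighted squared distances to
    them. *)
Lemma pw_triangle (e A N G x1 z1 x2 z2 x3 z3 x z : R) : 0 <= e ->
  let S a1 b1 a2 b2 a3 b3 := (a2 - a1) * (b3 - b1) - (b2 - b1) * (a3 - a1) in
  0 <= S x z x2 z2 x3 z3 -> 0 <= S x1 z1 x z x3 z3 -> 0 <= S x1 z1 x2 z2 x z ->
  0 < S x1 z1 x2 z2 x3 z3 ->
  0 <= pw e A N G x1 z1 -> 0 <= pw e A N G x2 z2 -> 0 <= pw e A N G x3 z3 ->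
  0 <= pw e A N G x z.
Proof.
move=> e0 S h1 h2 h3 hS f1 f2 f3; rewrite -(pmulr_rge0 _ hS).
have -> : S x1 z1 x2 z2 x3 z3 * pw e A N G x z =
    S x z x2 z2 x3 z3 * (pw e A N G x1 z1 + (x1 - x) ^+ 2 + e * (z1 - z) ^+ 2)
  + S x1 z1 x z x3 z3 * (pw e A N G x2 z2 + (x2 - x) ^+ 2 + e * (z2 - z) ^+ 2)
  + S x1 z1 x2 z2 x z * (pw e A N G x3 z3 + (x3 - x) ^+ 2 + e * (z3 - z) ^+ 2).
  by rewrite /S /pw; ring.
have p (u w y : R) : 0 <= u -> 0 <= u + w ^+ 2 + e * y ^+ 2.
  by move=> u0; apply: addr_ge0; [apply: addr_ge0|apply: mulr_ge0]; rewrite ?sqr_ge0.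
by apply: addr_ge0; [apply: addr_ge0|]; apply: mulr_ge0 => //; exact: p.
Qed.

(** The counterpart for the high box: between the shoulders the chord term is at least [l^2 / 4],
    whereas heights within [s] of each other change the power by at most [2 * (r + 2) * s]. *)
Lemma pw_inner (r e A N G l zt s xa za xb zb x z : R) : 0 <= r -> 0 <= e -> e * zt <= 1 ->
  0 < l -> xa <= - l -> l <= xb -> `|x| <= l / 2 -> 0 < s -> s <= zt ->
  16 * (r + 2) * s <= l ^+ 2 -> e * zt <= 1 ->
  zt - s <= za <= zt -> zt - s <= zb <= zt -> zt - s <= z <= zt ->
  `|N| <= r + 1 -> 0 <= pw e A N G xa za -> 0 <= pw e A N G xb zb -> 0 < pw e A N G x z.
Proof.
move=> r0 e0 ez l0 hxa hxb; rewrite ler_norml => /andP[hx1 hx2] s0 szt rs ezt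
  /andP[a1 a2] /andP[b1 b2] /andP[z1 z2] hN fa fb.
have u0 : l / 2 <= xb - x by clear - hxb hx2; lra.
have w0 : l / 2 <= x - xa by clear - hxa hx1; lra.
have l2 : 0 < l / 2 by rewrite divr_gt0.
have ba : 0 < xb - xa by clear - hxa hxb l0; lra.
rewrite -(pmulr_rgt0 _ ba).
set m := (xb - x) * (za - z) + (x - xa) * (zb - z).
set m2 := (xb - x) * (za ^+ 2 - z ^+ 2) + (x - xa) * (zb ^+ 2 - z ^+ 2).
have -> : (xb - xa) * pw e A N G x z = (xb - x) * pw e A N G xa za + (x - xa) * pw e A N G xb zb
   - 2 * N * m + (xb - xa) * ((xb - x) * (x - xa)) + e * m2.
  by rewrite /pw /m /m2; ring.
have h1 : 0 <= (xb - x) * pw e A N G xa za by rewrite mulr_ge0// (le_trans (ltW l2)).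
have h2 : 0 <= (x - xa) * pw e A N G xb zb by rewrite mulr_ge0// (le_trans (ltW l2)).
have avg (c ya yb : R) : `|ya| <= c -> `|yb| <= c ->
    `|(xb - x) * ya + (x - xa) * yb| <= (xb - xa) * c.
  move=> ha hb; apply: le_trans (ler_normD _ _) _; rewrite !normrM.
  have -> : (xb - xa) * c = (xb - x) * c + (x - xa) * c by ring.
  rewrite (ger0_norm (le_trans (ltW l2) u0)) (ger0_norm (le_trans (ltW l2) w0)).
  by rewrite lerD// ler_wpM2l// (le_trans (ltW l2)).
have hm : `|m| <= (xb - xa) * s.
  by apply: avg; rewrite ler_norml; apply/andP; split; clear - a1 a2 b1 b2 z1 z2; lra.
have hm2 : `|m2| <= (xb - xa) * (2 * zt * s).
  have sq (y : R) : zt - s <= y -> y <= zt -> `|y ^+ 2 - z ^+ 2| <= 2 * zt * s.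
    move=> y1 y2; rewrite subr_sqr normrM mulrC; apply: ler_pM => //.
      by rewrite ler_norml; clear - y1 y2 z1 z2 szt s0; apply/andP; split; lra.
    by rewrite ler_norml; clear - y1 y2 z1 z2 szt s0; apply/andP; split; lra.
  by apply: avg; apply: sq.
have hNm : `|N * m| <= (r + 1) * ((xb - xa) * s) by rewrite normrM ler_pM.
have hem : `|e * m2| <= (xb - xa) * (2 * s).
  rewrite normrM (ger0_norm e0); apply: le_trans (ler_wpM2l e0 hm2) _.
  have -> : e * ((xb - xa) * (2 * zt * s)) = (xb - xa) * (2 * s) * (e * zt) by ring.
  by rewrite ler_piMr// !mulr_ge0// ltW.
have pr : (xb - xa) * (l / 2 * (l / 2)) <= (xb - xa) * ((xb - x) * (x - xa)).
  by rewrite ler_pM2l//; apply: ler_pM => //; exact: ltW.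
have key : (xb - xa) * (2 * (r + 2) * s) < (xb - xa) * (l / 2 * (l / 2)).
  rewrite ltr_pM2l//; have : 0 < (r + 2) * s by rewrite mulr_gt0// ltr_wpDl.
  by move: rs; rewrite expr2; clear; lra.
move: hNm hem; rewrite !ler_norml => /andP[_ n2] /andP[e1 _].
clear - h1 h2 pr key n2 e1; lra.
Qed.

End ShoulderTip.

(** * Rescaled frames and circles through points of a cap *)

Section Frame.
Context (R : realType) (p n : plane R) (h : R).
Hypotheses (n1 : n.1 ^+ 2 + n.2 ^+ 2 = 1) (h0 : 0 < h).

Local Notation e := (h ^+ 2).

(* The tangent is [(n.2, - n.1)]; both coordinates are rescaled so that a cap of
   width [h] and height [h^2] becomes one of unit size. *)
Definition loc (x z : R) : plane R :=
  (p.1 + h * x * n.2 + e * z * n.1, p.2 - h * x * n.1 + e * z * n.2).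

Definition tcoord (q : plane R) : R := ((q.1 - p.1) * n.2 - (q.2 - p.2) * n.1) / h.

Definition ncoord (q : plane R) : R := ((q.1 - p.1) * n.1 + (q.2 - p.2) * n.2) / e.

Lemma locK q : loc (tcoord q) (ncoord q) = q.
Proof.
have hN : h != 0 by rewrite gt_eqF.
have eN : e != 0 by rewrite expf_neq0.
case: q => q1 q2; rewrite /loc /tcoord /ncoord /=; congr (_, _).
  rewrite mulrCA divff// mulr1 mulrCA divff// mulr1.
  transitivity (p.1 + (q1 - p.1) * (n.1 ^+ 2 + n.2 ^+ 2)); first by ring.
  by rewrite n1; ring.
rewrite mulrCA divff// mulr1 mulrCA divff// mulr1.
transitivity (p.2 + (q2 - p.2) * (n.1 ^+ 2 + n.2 ^+ 2)); first by ring.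
by rewrite n1; ring.
Qed.

Lemma dist2_loc x z x' z' :
  dist2 (loc x z) (loc x' z') = e * ((x - x') ^+ 2 + e * (z - z') ^+ 2).
Proof.
rewrite /dist2 /loc /=.
transitivity ((n.1 ^+ 2 + n.2 ^+ 2) * (e * ((x - x') ^+ 2 + e * (z - z') ^+ 2))); first by ring.
by rewrite n1 mul1r.
Qed.

Definition pwA (v : plane R) : R := tcoord v.
Definition pwN (v : plane R) : R := e * ncoord v.
Definition pwG (r : R) (v : plane R) : R := (r ^+ 2 - pwN v ^+ 2) / e - pwA v ^+ 2.

Lemma pwG_eq r v : e * pwG r v = r ^+ 2 - pwN v ^+ 2 - e * pwA v ^+ 2.
Proof. by rewrite /pwG mulrBr mulrCA divff ?mulr1// expf_neq0// gt_eqF. Qed.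

Lemma power_loc r v x z :
  r ^+ 2 - dist2 (loc x z) v = e * pw e (pwA v) (pwN v) (pwG r v) x z.
Proof.
rewrite (pw_complete_square _ _ (pwG_eq r v)) -[in LHS](locK v) dist2_loc /pwN /pwA.
by ring.
Qed.

Lemma in_disc_loc r v x z :
  (dist2 (loc x z) v <= r ^+ 2) = (0 <= pw e (pwA v) (pwN v) (pwG r v) x z).
Proof. by rewrite -subr_ge0 power_loc pmulr_rge0// exprn_gt0. Qed.

Lemma in_odisc_loc r v x z :
  (dist2 (loc x z) v < r ^+ 2) = (0 < pw e (pwA v) (pwN v) (pwG r v) x z).
Proof. by rewrite -subr_gt0 power_loc pmulr_rgt0// exprn_gt0. Qed.

(** The centre lies on the perpendicular bisector, on the inner side, at the distance given by
    Pythagoras. In the pencil of circles through two points, the power is that of the circle having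
    the chord as diameter minus [2 * k] times the linear form of the chord. The bound [3 * r ^+ 2]
    is what makes [k] at least half of [r / W]. *)
Lemma circle_loc r x1 z1 x2 z2 W : 0 < r -> 0 < W -> x1 < x2 ->
  (x2 - x1) ^+ 2 + e * (z2 - z1) ^+ 2 <= W ^+ 2 -> e * W ^+ 2 <= 3 * r ^+ 2 ->
  exists v k, [/\ r / (2 * W) <= k, dist2 (loc x1 z1) v = r ^+ 2,
    dist2 (loc x2 z2) v = r ^+ 2 & forall x z, dist2 (loc x z) v - r ^+ 2 =
      e * ((x - x1) * (x - x2) + e * (z - z1) * (z - z2)
        - 2 * k * ((x2 - x1) * (z - z1) - (z2 - z1) * (x - x1)))].
Proof.
move=> r0 W0 x12 DW eW.
set D := (x2 - x1) ^+ 2 + e * (z2 - z1) ^+ 2 in DW.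
have e0 : 0 < e by rewrite exprn_gt0.
have eN : e != 0 by rewrite gt_eqF.
have D0 : 0 < D.
  by apply: ltr_pwDl; rewrite ?exprn_gt0 ?subr_gt0// mulr_ge0 ?sqr_ge0// ltW.
have W2 : 0 < W ^+ 2 by rewrite exprn_gt0.
have kge : (r / (2 * W)) ^+ 2 <= r ^+ 2 / D - e / 4.
  have h1 : r ^+ 2 / W ^+ 2 <= r ^+ 2 / D.
    by rewrite ler_pM2l ?exprn_gt0// lef_pV2 ?posrE.
  have h2 : e <= 3 * (r ^+ 2 / W ^+ 2) by rewrite mulrA ler_pdivlMr.
  have -> : (r / (2 * W)) ^+ 2 = (r ^+ 2 / W ^+ 2) / 4 by field; rewrite gt_eqF.
  by clear - h1 h2; lra.
pose k := Num.sqrt (r ^+ 2 / D - e / 4).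
have kk : k ^+ 2 * D = r ^+ 2 - e * D / 4.
  rewrite sqr_sqrtr ?(le_trans (sqr_ge0 _) kge)//; field.
  by rewrite gt_eqF.
pose v := loc ((x1 + x2) / 2 - k * (z2 - z1)) ((z1 + z2) / 2 + k * (x2 - x1) / e).
have key x z : dist2 (loc x z) v - r ^+ 2 =
      e * ((x - x1) * (x - x2) + e * (z - z1) * (z - z2)
        - 2 * k * ((x2 - x1) * (z - z1) - (z2 - z1) * (x - x1))).
  rewrite dist2_loc (_ : r ^+ 2 = k ^+ 2 * D + e * D / 4); last by rewrite kk; ring.
  by rewrite /D; field; rewrite gt_eqF.
exists v, k; split => //.
- rewrite -(@ler_pXn2r _ 2)// ?nnegrE ?sqrtr_ge0//; last first.
    by rewrite divr_ge0 ?mulr_ge0// ltW.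
  by rewrite /k sqr_sqrtr// (le_trans (sqr_ge0 _) kge).
- by apply/eqP; rewrite -subr_eq0 key; apply/eqP; ring.
- by apply/eqP; rewrite -subr_eq0 key; apply/eqP; ring.
Qed.

End Frame.

Section Config.
Context (R : realType) (p n : plane R) (h r l L zt : R).
Hypotheses (n1 : n.1 ^+ 2 + n.2 ^+ 2 = 1) (h0 : 0 < h) (r0 : 0 < r) (l0 : 0 < l)
  (lL : l <= L) (zt0 : 0 < zt).
Local Notation e := (h ^+ 2).
Hypotheses (rz : 64 * L ^+ 2 <= r * zt) (ez : e * zt ^+ 2 <= 4 * L * l)
  (eL : e * (4 * L) ^+ 2 <= 3 * r ^+ 2).
Variables (xa za xb zb : R).
Hypotheses (hxa : - L <= xa <= - l) (hxb : l <= xb <= L)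
  (hza : zt / 2 <= za <= zt) (hzb : zt / 2 <= zb <= zt).
Local Notation loc := (loc p n h).

Let L0 : 0 < L. Proof. exact: lt_le_trans lL. Qed.
Let ge0 : 0 <= e. Proof. exact: sqr_ge0. Qed.
Let e0 : 0 < e. Proof. exact: exprn_gt0. Qed.

Let width : 2 * l <= xb - xa <= 2 * L.
Proof.
have l_gt0 := l0; move: hxa hxb => /andP[? ?] /andP[? ?].
by apply/andP; split; lra.
Qed.

Lemma span_le (x1 z1 x2 z2 : R) : - L <= x1 -> x1 <= x2 -> x2 <= L -> 0 <= z1 <= zt ->
  0 <= z2 <= zt -> (x2 - x1) ^+ 2 + e * (z2 - z1) ^+ 2 <= (4 * L) ^+ 2.
Proof.
have l_gt0 := l0; have l_leL := lL; have zt_gt0 := zt0; have L_gt0 := L0.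
move=> x1L x12 x2L /andP[z1a z1b] /andP[z2a z2b].
have hx : (x2 - x1) ^+ 2 <= (2 * L) ^+ 2.
  by rewrite lerXn2r ?nnegrE//; lra.
have hz : (z2 - z1) ^+ 2 <= zt ^+ 2.
  rewrite -(real_normK (num_real (z2 - z1))) lerXn2r ?nnegrE ?(ltW zt0)// ler_norml.
  by apply/andP; split; lra.
have hez : e * (z2 - z1) ^+ 2 <= 4 * L * l by apply: le_trans ez; rewrite ler_wpM2l.
have hll : 4 * L * l <= 4 * L * L by rewrite ler_pM2l// mulr_gt0.
have := sqr_ge0 L; move: hx; rewrite !exprMn expr2; lra.
Qed.

(** The origin of the constant 64: [2 * (r / (8 * L)) * (zt / 4) = r * zt / (16 * L)] has to reach
    [4 * L], twice the bound [2 * L] met for each product of coordinate differences. *)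
Lemma curvature_gain (k m : R) : r / (2 * (4 * L)) <= k -> (xb - xa) * (zt / 4) <= m ->
  (xb - xa) * (4 * L) <= 2 * k * m.
Proof.
have l_gt0 := l0; have l_leL := lL; have zt_gt0 := zt0; have L_gt0 := L0.
move=> hk hm; have /andP[w1 w2] := width.
have ba : 0 < xb - xa by apply: lt_le_trans w1; rewrite mulr_gt0.
have zm : 0 <= (xb - xa) * (zt / 4) by rewrite mulr_ge0// ?ltW// divr_gt0.
have h1 : r / (2 * (4 * L)) * ((xb - xa) * (zt / 4)) <= k * m.
  by apply: ler_pM => //; rewrite divr_ge0 ?mulr_ge0// ltW.
have h2 : (xb - xa) * (4 * L) <= 2 * (r / (2 * (4 * L)) * ((xb - xa) * (zt / 4))).
  have -> : 2 * (r / (2 * (4 * L)) * ((xb - xa) * (zt / 4))) = (xb - xa) * (r * zt / (16 * L)).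
    by field; rewrite gt_eqF.
  rewrite ler_pM2l// ler_pdivlMr ?mulr_gt0//; apply: le_trans rz.
  by rewrite expr2; lra.
by rewrite -mulrA; lra.
Qed.

Lemma depth_ge (x z : R) : - l <= x <= l -> z <= zt / 4 ->
  (xb - xa) * (zt / 4) <= (xb - x) * (za - z) + (x - xa) * (zb - z).
Proof.
have l_gt0 := l0; have l_leL := lL; have zt_gt0 := zt0; have L_gt0 := L0.
move=> /andP[x1 x2] hz.
move: hxa hxb hza hzb => /andP[? ?] /andP[? ?] /andP[? ?] /andP[? ?].
have -> : (xb - xa) * (zt / 4) = (xb - x) * (zt / 4) + (x - xa) * (zt / 4) by ring.
by apply: lerD; apply: ler_wpM2l; lra.
Qed.

Lemma circle_shoulders : exists v, [/\ dist2 (loc xa za) v = r ^+ 2,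
  dist2 (loc xb zb) v = r ^+ 2 &
  forall x z, - l <= x <= l -> z <= zt / 4 -> r ^+ 2 < dist2 (loc x z) v].
Proof.
have l_gt0 := l0; have l_leL := lL; have zt_gt0 := zt0; have L_gt0 := L0.
have /andP[w1 w2] := width.
have ba : 0 < xb - xa by apply: lt_le_trans w1; rewrite mulr_gt0.
have /andP[a1 a2] := hza; have /andP[b1 b2] := hzb.
have /andP[xa1 xa2] := hxa; have /andP[xb1 xb2] := hxb.
have sp : (xb - xa) ^+ 2 + e * (zb - za) ^+ 2 <= (4 * L) ^+ 2.
  by apply: span_le => //; try (apply/andP; split); lra.
have x12 : xa < xb by rewrite -subr_gt0.
have W0 : 0 < 4 * L by rewrite mulr_gt0.
have [v [k [hk va vb key]]] := circle_loc p n1 h0 r0 W0 x12 sp eL.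
exists v; split => // x z hx hz; rewrite -subr_gt0 key pmulr_rgt0//.
have hm := depth_ge hx hz; have := curvature_gain hk hm.
set m := (xb - x) * _ + _ in hm *.
have -> : (xb - xa) * (z - za) - (zb - za) * (x - xa) = - m by rewrite /m; ring.
have hz2 : 0 <= e * ((z - za) * (z - zb)).
  by rewrite mulr_ge0// mulr_le0//; lra.
have hx2 : (x - xa) * (xb - x) <= (xb - xa) * (2 * L).
  move/andP: hx => [x1 x2]; apply: ler_pM; lra.
have := mulr_gt0 ba L0; lra.
Qed.

(** The linear form is again the doubled area [m] of the triangle of the shoulders and the tip, now
    with the sign that puts the opposite shoulder inside the disc. *)
Lemma circle_left (x z : R) : - l / 2 <= x <= l / 2 -> 0 <= z <= zt / 4 ->
  exists v, [/\ dist2 (loc xa za) v = r ^+ 2, dist2 (loc x z) v = r ^+ 2 &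
    dist2 (loc xb zb) v <= r ^+ 2].
Proof.
have l_gt0 := l0; have l_leL := lL; have zt_gt0 := zt0; have L_gt0 := L0.
move=> hx hz.
have /andP[w1 w2] := width; have /andP[x1 x2] := hx; have /andP[z1 z2] := hz.
have ba : 0 < xb - xa by apply: lt_le_trans w1; rewrite mulr_gt0.
have /andP[a1 a2] := hza; have /andP[b1 b2] := hzb.
have /andP[xa1 xa2] := hxa; have /andP[xb1 xb2] := hxb.
have x12 : xa < x by lra.
have sp : (x - xa) ^+ 2 + e * (z - za) ^+ 2 <= (4 * L) ^+ 2.
  by apply: span_le => //; try (apply/andP; split); lra.
have W0 : 0 < 4 * L by rewrite mulr_gt0.
have [v [k [hk va vb key]]] := circle_loc p n1 h0 r0 W0 x12 sp eL.
exists v; split => //; rewrite -subr_le0 key pmulr_rle0//.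
have hx' : - l <= x <= l by apply/andP; split; lra.
have hm := depth_ge hx' z2; have := curvature_gain hk hm.
set m := (xb - x) * _ + _ in hm *.
have -> : (x - xa) * (zb - za) - (z - za) * (xb - xa) = m by rewrite /m; ring.
have hz2 : e * ((zb - za) * (zb - z)) <= (xb - xa) * (2 * L).
  apply: (@le_trans _ _ (e * zt ^+ 2)).
    rewrite ler_wpM2l// expr2; apply: le_trans (ler_norm _) _; rewrite normrM.
    by apply: ler_pM => //; rewrite ler_norml; apply/andP; split; lra.
  apply: (le_trans ez); have -> : 4 * L * l = (2 * l) * (2 * L) by ring.
  by rewrite ler_pM2r// mulr_gt0.
have hx2 : (xb - xa) * (xb - x) <= (xb - xa) * (2 * L).
  by rewrite ler_pM2l//; lra.
by lra.
Qed.

Lemma circle_right (x z : R) : - l / 2 <= x <= l / 2 -> 0 <= z <= zt / 4 ->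
  exists v, [/\ dist2 (loc xb zb) v = r ^+ 2, dist2 (loc x z) v = r ^+ 2 &
    dist2 (loc xa za) v <= r ^+ 2].
Proof.
have l_gt0 := l0; have l_leL := lL; have zt_gt0 := zt0; have L_gt0 := L0.
move=> hx hz.
have /andP[w1 w2] := width; have /andP[x1 x2] := hx; have /andP[z1 z2] := hz.
have ba : 0 < xb - xa by apply: lt_le_trans w1; rewrite mulr_gt0.
have /andP[a1 a2] := hza; have /andP[b1 b2] := hzb.
have /andP[xa1 xa2] := hxa; have /andP[xb1 xb2] := hxb.
have x12 : x < xb by lra.
have sp : (xb - x) ^+ 2 + e * (zb - z) ^+ 2 <= (4 * L) ^+ 2.
  by apply: span_le => //; try (apply/andP; split); lra.
have W0 : 0 < 4 * L by rewrite mulr_gt0.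
have [v [k [hk va vb key]]] := circle_loc p n1 h0 r0 W0 x12 sp eL.
exists v; split => //; rewrite -subr_le0 key pmulr_rle0//.
have hx' : - l <= x <= l by apply/andP; split; lra.
have hm := depth_ge hx' z2; have := curvature_gain hk hm.
set m := (xb - x) * _ + _ in hm *.
have -> : (xb - x) * (za - z) - (zb - z) * (xa - x) = m by rewrite /m; ring.
have hz2 : e * ((za - z) * (za - zb)) <= (xb - xa) * (2 * L).
  apply: (@le_trans _ _ (e * zt ^+ 2)).
    rewrite ler_wpM2l// expr2; apply: le_trans (ler_norm _) _; rewrite normrM.
    by apply: ler_pM => //; rewrite ler_norml; apply/andP; split; lra.
  apply: (le_trans ez); have -> : 4 * L * l = (2 * l) * (2 * L) by ring.
  by rewrite ler_pM2r// mulr_gt0.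
have hx2 : (xa - x) * (xa - xb) <= (xb - xa) * (2 * L).
  have -> : (xa - x) * (xa - xb) = (xb - xa) * (x - xa) by ring.
  by rewrite ler_pM2l//; lra.
by lra.
Qed.

End Config.

Section CapToggle.
Context (R : realType).

Definition shoulder (l L zt s x z : R) := l <= x <= L /\ zt - s <= z <= zt.

Lemma loc00 (p n : plane R) (h : R) : loc p n h 0 0 = p.
Proof. by case: p => p1 p2; rewrite /loc /= !(mulr0, mul0r, addr0, subr0). Qed.

Lemma rolled_loc (p n : plane R) (h r' : R) (q : plane R) : n.1 ^+ 2 + n.2 ^+ 2 = 1 -> 0 < h ->
  dist2 q p <= 2 * r' * ((q.1 - p.1) * n.1 + (q.2 - p.2) * n.2) ->
  tcoord p n h q ^+ 2 + h ^+ 2 * ncoord p n h q ^+ 2 <= 2 * r' * ncoord p n h q.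
Proof.
move=> n1 h0 hq; have e0 : 0 < h ^+ 2 by rewrite exprn_gt0.
have := dist2_loc p h n1 (tcoord p n h q) (ncoord p n h q) 0 0.
rewrite locK// loc00 !subr0 => dE.
have nE : (q.1 - p.1) * n.1 + (q.2 - p.2) * n.2 = h ^+ 2 * ncoord p n h q.
  by rewrite /ncoord mulrCA divff ?mulr1// gt_eqF.
rewrite -(ler_pM2l e0) -dE; apply: (le_trans hq); rewrite nE.
by rewrite mulrCA.
Qed.

(** A narrow strip above the tip lies in the triangle of the tip and the shoulders, hence in the new
    hull. Each area term is at least [s * (l / 2)], and [8 * ep * zt <= l * s] keeps the error
    [zt * (2 * ep)] below it. *)
Lemma tip_triangle (l L zt s ep xa za xb zb x z x' z' e A N G : R) : 0 < l -> l <= L -> 0 < s -> 16 * s <= zt ->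
  0 < ep -> 2 * ep <= l -> 8 * ep * zt <= l * s -> 0 <= e ->
  shoulder l L zt s (- xa) za -> shoulder l L zt s xb zb ->
  - ep <= x <= ep -> s <= z <= 2 * s -> - ep <= x' <= ep -> 3 * s <= z' <= 4 * s ->
  0 <= pw e A N G xa za -> 0 <= pw e A N G xb zb -> 0 <= pw e A N G x z ->
  0 <= pw e A N G x' z'.
Proof.
move=> l0 lL s0 szt ep0 epl eps e0 [/andP[xa1 xa2] /andP[za1 za2]] [/andP[xb1 xb2] /andP[zb1 zb2]].
move=> /andP[x1 x2] /andP[z1 z2] /andP[x1' x2'] /andP[z1' z2'] fa fb fy.
have sl : s * (l / 2) <= (z' - z) * (x' - xa).
  by apply: ler_pM; clear - s0 l0 z1' z2 x1' xa1 epl ep0; lra.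
have sl' : s * (l / 2) <= (z' - z) * (xb - x').
  by apply: ler_pM; clear - s0 l0 z1' z2 x2' xb1 epl ep0; lra.
have ls0 : 0 <= l * s by rewrite mulr_ge0 ?ltW.
have small (c w : R) : 0 <= c <= zt -> `|w| <= 2 * ep -> `|c * w| <= zt * (2 * ep).
  by move=> /andP[c0 c1] hw; rewrite normrM ger0_norm// ler_pM.
have hw : `|x - x'| <= 2 * ep by rewrite ler_norml; apply/andP; split; clear - x1 x2 x1' x2'; lra.
apply: (pw_triangle (x1 := xb) (z1 := zb) (x2 := xa) (z2 := za) (x3 := x) (z3 := z)) => //.
- have : `|(za - z') * (x - x')| <= zt * (2 * ep).
    by apply: small => //; apply/andP; split; clear - za1 za2 z1' z2' szt s0; lra.
  rewrite ler_norml => /andP[_ h]; clear - h sl eps ls0; lra.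
- have : `|(zb - z') * (x - x')| <= zt * (2 * ep).
    by apply: small => //; apply/andP; split; clear - zb1 zb2 z1' z2' szt s0; lra.
  rewrite ler_norml => /andP[h _]; clear - h sl' eps ls0; lra.
- have -> : (xa - xb) * (z' - zb) - (za - zb) * (x' - xb) = (xb - x') * (za - z') + (x' - xa) * (zb - z') by ring.
  by apply: addr_ge0; apply: mulr_ge0; clear - x1' x2' z1' z2' xa1 xb1 za1 zb1 szt s0 epl l0; lra.
- have -> : (xa - xb) * (z - zb) - (za - zb) * (x - xb) = (xb - x) * (za - z) + (x - xa) * (zb - z) by ring.
  by apply: addr_gt0; apply: mulr_gt0; clear - x1 x2 z1 z2 xa1 xb1 za1 zb1 szt s0 epl l0; lra.
Qed.

Theorem cap_toggle (r r' l L zt s ep : R) : 0 < r' -> r' < r -> 0 < l -> l <= L ->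
  64 * L ^+ 2 <= r * zt -> 0 < s -> 16 * s <= zt -> 16 * (r + 2) * s <= l ^+ 2 ->
  0 < ep -> 2 * ep <= l -> 8 * ep * zt <= l * s ->
  exists Z e1 : R, [/\ zt <= Z, 0 < e1 &
  forall h : R, 0 < h -> h ^+ 2 < e1 -> forall p n : plane R, n.1 ^+ 2 + n.2 ^+ 2 = 1 ->
  forall K : set (plane R),
  (forall q, K q -> dist2 q p <= 2 * r' * ((q.1 - p.1) * n.1 + (q.2 - p.2) * n.2)) ->
  forall (o : set (plane R)) a b, o a -> o b -> finite_set o ->
    (forall q, o q -> [\/ q = a, q = b | K q /\ Z < ncoord p n h q]) ->
    shoulder l L zt s (- tcoord p n h a) (ncoord p n h a) ->
    shoulder l L zt s (tcoord p n h b) (ncoord p n h b) ->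
  (forall y, - l / 2 <= tcoord p n h y <= l / 2 -> zt - s <= ncoord p n h y <= zt ->
    f0 r (y |` o) = f0 r o /\ r_hull r (y |` o) = r_hull r o) /\
  (forall y, - ep <= tcoord p n h y <= ep -> s <= ncoord p n h y <= 2 * s ->
    f0 r (y |` o) = (f0 r o).+1 /\
    forall Q : set (mplane R), measurable Q -> (forall q, Q q ->
      - ep <= tcoord p n h q <= ep /\ 3 * s <= ncoord p n h q <= 4 * s) ->
    area (r_hull r o) + area Q <= area (r_hull r (y |` o)))].
Proof.
move=> r'0 rr l0 lL rz s0 szt rs ep0 epl eps.
have r0 : 0 < r by exact: lt_trans rr.
have zt0 : 0 < zt by clear - szt s0; lra.
have L0 : 0 < L by exact: lt_le_trans lL.
have [Z [e0 [hZ e0_gt0 cover]]] := cover_far r'0 rr l0 lL zt0.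
exists Z, (Num.min e0 (Num.min (4 * L * l / zt ^+ 2) (Num.min (3 * r ^+ 2 / (4 * L) ^+ 2) zt^-1))).
split => //.
  by rewrite !lt_min e0_gt0 invr_gt0 zt0 !divr_gt0 ?exprn_gt0 ?mulr_gt0 ?exprn_gt0.
move=> h h0; rewrite !lt_min => /and4P[he0 he1 he2 he3] p n n1 K roll o a b oa ob fo oK sa sb.
have e_gt0 : 0 < h ^+ 2 by rewrite exprn_gt0.
have ez : h ^+ 2 * zt ^+ 2 <= 4 * L * l by rewrite -ler_pdivlMr ?exprn_gt0// ltW.
have eL : h ^+ 2 * (4 * L) ^+ 2 <= 3 * r ^+ 2.
  by rewrite -ler_pdivlMr ?exprn_gt0 ?mulr_gt0// ltW.
have ez1 : h ^+ 2 * zt <= 1 by rewrite -ler_pdivlMr// mul1r ltW.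
set xa := tcoord p n h a in sa; set za := ncoord p n h a in sa.
set xb := tcoord p n h b in sb; set zb := ncoord p n h b in sb.
have aE : a = loc p n h xa za by rewrite locK.
have bE : b = loc p n h xb zb by rewrite locK.
have [/andP[xa1 xa2] /andP[za1 za2]] := sa; have [/andP[xb1 xb2] /andP[zb1 zb2]] := sb.
have hxa : - L <= xa <= - l by apply/andP; split; clear - xa1 xa2; lra.
have hxb : l <= xb <= L by rewrite xb1.
have hza : zt / 2 <= za <= zt by rewrite za2 andbT; clear - za1 szt s0; lra.
have hzb : zt / 2 <= zb <= zt by rewrite zb2 andbT; clear - zb1 szt s0; lra.
split => y; set x := tcoord p n h y; set z := ncoord p n h y;
  have yE : y = loc p n h x z by rewrite locK.
  move=> hx hz.
  have inner v : dist2 a v <= r ^+ 2 -> dist2 b v <= r ^+ 2 -> dist2 y v < r ^+ 2.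
    rewrite aE bE yE !in_disc_loc// in_odisc_loc// => fa fb.
    have za0 : 0 <= za <= zt by rewrite za2 andbT; clear - za1 szt s0; lra.
    have := pw_normal_ub (ltW r0) (ltW e_gt0) ez1 (pwG_eq p n h0 r v) za0 fa.
    move=> hN; apply: (pw_inner (ltW r0) (ltW e_gt0) ez1 l0 _ _ _ s0 _ rs ez1 _ _ hz hN fa fb).
    + by case/andP: hxa.
    + by [].
    + by rewrite ler_norml -mulNr.
    + by clear - szt s0; lra.
    + by apply/andP.
    + by apply/andP.
  by have [vE hE] := inner_point r0 oa ob inner; rewrite /f0 vE.
move=> hx hz; have /andP[x1 x2] := hx; have /andP[z1 z2] := hz.
have hx' : - l / 2 <= x <= l / 2 by apply/andP; split; clear - x1 x2 epl; lra.
have hz' : 0 <= z <= zt / 4 by apply/andP; split; clear - z1 z2 szt s0; lra.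
have cov v : dist2 a v <= r ^+ 2 -> dist2 b v <= r ^+ 2 -> r ^+ 2 <= dist2 y v ->
    forall q, o q -> [\/ q = a, q = b | dist2 q v < r ^+ 2].
  rewrite {1}aE {1}bE !in_disc_loc// => fa fb; rewrite yE leNgt in_odisc_loc// -leNgt => fy q oq.
  have [->|->|[Kq hq]] := oK q oq; rewrite -?aE -?bE; [by constructor 1|by constructor 2|].
  constructor 3; rewrite -(locK p n1 h0 q) in_odisc_loc//.
  apply: (cover _ e_gt0 he0 _ _ _ (pwG_eq p n h0 r v) xa za xb zb x z) => //.
  + by apply/andP; split => //; clear - za1 z2 szt s0; lra.
  + by apply/andP; split => //; clear - zb1 z2 szt s0; lra.
  + by rewrite ler_norml -mulNr.
  + by case/andP: hz'.
  + exact: rolled_loc (roll q Kq).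
(* This disc is used twice: it contains [o] but not the tip, and it also misses all of [Q], which is
   therefore disjoint from the old hull. *)
have [v0 [v0a v0b v0out]] := circle_shoulders p n1 h0 r0 l0 lL zt0 rz ez eL hxa hxb hza hzb.
have v0lo q : - ep <= tcoord p n h q <= ep -> ncoord p n h q <= 4 * s -> r ^+ 2 < dist2 q v0.
  move=> /andP[q1 q2] q3; rewrite -(locK p n1 h0 q); apply: v0out; last by clear - q3 szt; lra.
  by apply/andP; split; clear - q1 q2 epl ep0; lra.
have circ_ab : exists v, [/\ dist2 a v = r ^+ 2, dist2 b v = r ^+ 2 & r ^+ 2 < dist2 y v].
  by exists v0; rewrite {1}aE {1}bE; split => //; apply: v0lo => //; clear - z2 s0; rewrite -/z; lra.
have circ_ay := circle_left p n1 h0 r0 l0 lL zt0 rz ez eL hxa hxb hza hzb hx' hz'.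
have circ_by := circle_right p n1 h0 r0 l0 lL zt0 rz ez eL hxa hxb hza hzb hx' hz'.
rewrite -aE -bE -yE in circ_ay circ_by.
have ab : a != b.
  apply/eqP => e; have xx : xa = xb by rewrite /xa /xb e.
  by clear - xx xa1 xb1 l0; lra.
split; first exact: (f0_tip r0 oa ob cov circ_ab circ_ay circ_by ab fo).
move=> Q mQ hQ; have [v [va vy vb]] := circ_ay.
have eqle (u w : R) : u = w -> u <= w by move=> ->.
have hv := cover_le cov (eqle _ _ va) vb (eqle _ _ (esym vy)).
apply: (area_hull_gain r0 fo (v := v)) => //.
- by exists a.
- by rewrite vy.
- move=> q /hQ[q1 q2] u uo; rewrite disc_dist2// -(locK p n1 h0 q) in_disc_loc//.
  have ua := uo _ (or_intror oa); have ub := uo _ (or_intror ob); have uy := uo _ (or_introl erefl).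
  move: ua ub uy; rewrite !disc_dist2// {1}aE {1}bE {1}yE !in_disc_loc// => ua ub uy.
  exact: (tip_triangle l0 lL s0 szt ep0 epl eps (ltW e_gt0) sa sb hx hz q1 q2 ua ub uy).
- move=> q /hQ[q1 /andP[_ q2]] hq.
  have : disc r v0 q.
    apply: hq => q' oq'; rewrite disc_dist2//.
    apply: (cover_le cov _ _ _ oq'); rewrite ?aE ?bE ?v0a ?v0b//.
    by apply/ltW; rewrite -/y; apply: v0lo => //; clear - z2 s0; rewrite -/z; lra.
  by rewrite disc_dist2// leNgt v0lo.
Qed.

End CapToggle.

(** * Normal frames along the boundary *)

Section ConvexPlane.
Context (R : realType) (K : set (plane R)).
Hypothesis cK : convex_set K.

Lemma convex_comb2 (a b : plane R) (t : R) : K a -> K b -> 0 <= t <= 1 ->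
  K (t * a.1 + (1 - t) * b.1, t * a.2 + (1 - t) * b.2).
Proof.
move=> Ka Kb /andP[t0 t1].
have := @cK a b (Itv01 t0 t1) (mem_set Ka) (mem_set Kb).
by rewrite inE.
Qed.

Lemma convex_comb3 (p1 p2 p3 q : plane R) (w1 w2 w3 : R) : K p1 -> K p2 -> K p3 ->
  0 <= w1 -> 0 <= w2 -> 0 <= w3 -> 0 < w1 + w2 + w3 ->
  (w1 + w2 + w3) * q.1 = w1 * p1.1 + w2 * p2.1 + w3 * p3.1 ->
  (w1 + w2 + w3) * q.2 = w1 * p1.2 + w2 * p2.2 + w3 * p3.2 -> K q.
Proof.
move=> K1 K2 K3 w1p w2p w3p W q1 q2.
have [w0|w0] := eqVneq (w1 + w2) 0.
  have w10 : w1 = 0 by lra.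
  have w20 : w2 = 0 by lra.
  have w3N : w3 != 0 by move: W; rewrite w0 add0r => /gt_eqF ->.
  move: q1 q2; rewrite w10 w20 !(mul0r, add0r) => /(mulfI w3N) e1 /(mulfI w3N) e2.
  by case: q p3 e1 e2 K3 {W w3p w3N} => [? ?] [? ?] /= -> ->.
have s0 : 0 < w1 + w2 by rewrite lt_neqAle eq_sym w0 addr_ge0.
have W0 : w1 + w2 + w3 != 0 by rewrite gt_eqF.
have t1 : 0 <= w1 / (w1 + w2) <= 1.
  by rewrite divr_ge0 ?(ltW s0)//= ler_pdivrMr// mul1r lerDl.
have t2 : 0 <= (w1 + w2) / (w1 + w2 + w3) <= 1.
  by rewrite divr_ge0 ?(ltW W) ?(ltW s0)//= ler_pdivrMr// mul1r lerDl.
have := convex_comb2 (convex_comb2 K1 K2 t1) K3 t2; congr K.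
rewrite [RHS]surjective_pairing /=; congr (_, _); apply: (mulfI W0).
  by rewrite q1; field; rewrite w0 W0.
by rewrite q2; field; rewrite w0 W0.
Qed.

Definition crossp (a b : plane R) : R := a.1 * b.2 - a.2 * b.1.

Lemma continuous_cross (a b : plane R) : continuous (fun q : plane R => crossp (a - q) (b - q)).
Proof.
have c1 (u : plane R) : continuous (fun q : plane R => (u - q).1).
  by move=> q; apply: cvgB; [exact: cvg_cst|exact: cvg_fst].
have c2 (u : plane R) : continuous (fun q : plane R => (u - q).2).
  by move=> q; apply: cvgB; [exact: cvg_cst|exact: cvg_snd].
by move=> q; apply: cvgB; apply: cvgM; (exact: c1 || exact: c2).
Qed.

Lemma triangle_sub (p1 p2 p3 q : plane R) : K p1 -> K p2 -> K p3 ->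
  0 < crossp (p1 - q) (p2 - q) -> 0 < crossp (p2 - q) (p3 - q) ->
  0 < crossp (p3 - q) (p1 - q) -> K q.
Proof.
move=> K1 K2 K3 h12 h23 h31; apply: (convex_comb3 K1 K2 K3 (ltW h23) (ltW h31) (ltW h12)).
- by apply: addr_gt0 => //; exact: addr_gt0.
- by rewrite /crossp /=; ring.
- by rewrite /crossp /=; ring.
Qed.

Lemma triangle_interior (p1 p2 p3 q : plane R) : K p1 -> K p2 -> K p3 ->
  0 < crossp (p1 - q) (p2 - q) -> 0 < crossp (p2 - q) (p3 - q) ->
  0 < crossp (p3 - q) (p1 - q) -> interior K q.
Proof.
move=> K1 K2 K3 h12 h23 h31; rewrite /interior /=.
have near_pos (a b : plane R) : 0 < crossp (a - q) (b - q) ->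
    nbhs q [set z | 0 < crossp (a - z) (b - z)].
  move=> h; apply: (@continuous_cross a b q [set x | 0 < x]).
  by apply: open_nbhs_nbhs; split; [exact: open_gt|].
apply: filterS (filterI (near_pos _ _ h12) (filterI (near_pos _ _ h23) (near_pos _ _ h31))).
by move=> z [/= g12 [g23 g31]]; exact: (triangle_sub K1 K2 K3 g12 g23 g31).
Qed.

End ConvexPlane.

(** * Supporting lines and rolling for curves of positive curvature *)

Section RealDerivatives.
Context (R : realType).
Implicit Types f df : R -> R.

Lemma derivable_pair (c : R -> plane R) s : derivable c s 1 ->
  is_derive s 1 (fun t => (c t).1) (c^`() s).1 /\ is_derive s 1 (fun t => (c t).2) (c^`() s).2.
Proof.
move=> dc.
have fstc : continuous (fun p : plane R => p.1) by move=> p; exact: cvg_fst.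
have sndc : continuous (fun p : plane R => p.2) by move=> p; exact: cvg_snd.
have cvg1 : (fun h : R => h^-1 *: (((fun t => (c t).1) \o shift s) (h *: 1) - (c s).1)) @ 0^'
    --> (c^`() s).1.
  by rewrite derive1E; exact: (@cvg_comp _ _ _ _ _ _ _ _ dc (fstc _)).
have cvg2 : (fun h : R => h^-1 *: (((fun t => (c t).2) \o shift s) (h *: 1) - (c s).2)) @ 0^'
    --> (c^`() s).2.
  by rewrite derive1E; exact: (@cvg_comp _ _ _ _ _ _ _ _ dc (sndc _)).
split; apply: DeriveDef.
- exact: cvgP cvg1.
- exact/cvg_lim.
- exact: cvgP cvg2.
- exact/cvg_lim.
Qed.

(* One-sided strict monotonicity at a single point of positive derivative. *)
Lemma derive_pos_near f (s a : R) : is_derive s 1 f a -> 0 < a ->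
  exists2 e, 0 < e & forall t, 0 < t < e -> f s < f (s + t) /\ f (s - t) < f s.
Proof.
move=> [df dfa] a0; rewrite -dfa in a0.
have df' : (fun h : R => h^-1 *: ((f \o shift s) (h *: 1) - f s)) @ 0^' --> 'D_1 f s by exact: df.
have [e /= e0 he] := @cvgr_gt _ _ _ _ _ _ df' 0 a0.
exists e => // t /andP[t0 te].
have ht : `|0 - t| < e by rewrite sub0r normrN gtr0_norm.
have hNt : `|0 - (- t)| < e by rewrite sub0r opprK gtr0_norm.
split.
- have := he t ht (lt0r_neq0 t0); rewrite /= scaler1.
  by rewrite /GRing.scale /= pmulr_rgt0 ?invr_gt0// subr_gt0 addrC.
- have tN : - t != 0 by rewrite oppr_eq0 gt_eqF.
  have := he (- t) hNt tN; rewrite /= scaler1.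
  by rewrite /GRing.scale /= invrN mulNr oppr_gt0 pmulr_rlt0 ?invr_gt0// subr_lt0 addrC.
Qed.

Lemma derive_continuous f df : (forall s : R, is_derive s 1 f (df s)) -> continuous f.
Proof.
by move=> h s; apply: differentiable_continuous; apply/derivable1_diffP; case: (h s).
Qed.

Lemma mean_value f df (a b : R) : (forall s : R, is_derive s 1 f (df s)) -> a < b ->
  exists2 u, a < u < b & f b - f a = df u * (b - a).
Proof.
move=> h ab; have [u uab e] := MVT ab (fun x _ => h x)
  (continuous_subspaceT (derive_continuous h)).
by exists u => //; move: uab; rewrite in_itv.
Qed.

End RealDerivatives.

Lemma periodic_max (R : realType) (f : R -> R) (L : R) : 0 < L -> continuous f ->
  (forall s, f (s + L) = f s) -> exists s, forall u, f u <= f s.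
Proof.
move=> L0 cf per.
have [s _ smax] := EVT_max (ltW L0) (continuous_subspaceT cf).
have perN n u : f (u + n%:R * L) = f u.
  elim: n u => [|n IH] u; first by rewrite mul0r addr0.
  by rewrite -natr1 mulrDl mul1r addrA per IH.
have perZ (k : int) u : f (u + k%:~R * L) = f u.
  case: k => n; first exact: perN.
  by rewrite NegzE mulrNz mulNr -(perN n.+1 (u - n.+1%:R * L)) subrK.
exists s => u.
have -> : f u = f (u - (Num.floor (u / L))%:~R * L).
  by rewrite -(perZ (Num.floor (u / L)) (u - _)) subrK.
apply: smax; rewrite in_itv /= subr_ge0 -ler_pdivlMr// ge_floor /=.
rewrite lerBlDr -[X in _ <= X + _]mul1r -mulrDl -ler_pdivrMr// addrC.
by apply/ltW; have := lt_succ_floor (u / L); rewrite intrD.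
Qed.

Section SmoothCurve.
Context (R : realType) (K : set (plane R)).
Hypothesis cK : convex_set K.
Variables x y x1 y1 x2 y2 : R -> R.
Hypotheses (dx : forall s : R, is_derive s 1 x (x1 s)) (dy : forall s : R, is_derive s 1 y (y1 s))
  (dx1 : forall s : R, is_derive s 1 x1 (x2 s)) (dy1 : forall s : R, is_derive s 1 y1 (y2 s)).
Hypothesis Kc : forall s, K (x s, y s).
Hypothesis bdc : forall s, ~ interior K (x s, y s).
Hypothesis curved : forall s, 0 < x1 s * y2 s - y1 s * x2 s.

Lemma speed_gt0 s : 0 < x1 s ^+ 2 + y1 s ^+ 2.
Proof.
rewrite lt_neqAle addr_ge0 ?sqr_ge0// andbT eq_sym paddr_eq0 ?sqr_ge0// !sqrf_eq0.
by apply/negP => /andP[/eqP e1 /eqP e2]; have := curved s; rewrite e1 e2 !mul0r subr0 ltxx.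
Qed.

(** By curvature the curve points just before and just after [s] are strictly on the inner side of
    the tangent. A point [q] of [K] strictly on the outer side would form with them a triangle
    around the boundary point at [s]. *)
Lemma tangent_support q s : K q -> 0 <= x1 s * (q.2 - y s) - y1 s * (q.1 - x s).
Proof.
move=> Kq; rewrite leNgt; apply/negP; set Dq := _ - _ => Dq0.
pose Tq := x1 s * (q.1 - x s) + y1 s * (q.2 - y s).
pose D u := x1 s * (y u - y s) - y1 s * (x u - x s).
pose D1 u := x1 s * y1 u - y1 s * x1 u.
pose T u := x1 s * (x u - x s) + y1 s * (y u - y s).
have dD (u : R) : is_derive u 1 D (D1 u).
  have h := dx u; have h' := dy u; rewrite /D /D1.
  by apply: is_derive_eq; rewrite /GRing.scale /=; ring.
have dT (u : R) : is_derive u 1 T (x1 s * x1 u + y1 s * y1 u).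
  have h := dx u; have h' := dy u; rewrite /T.
  by apply: is_derive_eq; rewrite /GRing.scale /=; ring.
have dD1 : is_derive s 1 D1 (x1 s * y2 s - y1 s * x2 s).
  have h := dx1 s; have h' := dy1 s; rewrite /D1.
  by apply: is_derive_eq; rewrite /GRing.scale /=; ring.
(* Up to the factor of squared speed this is the cross product of [q] and the curve point at [u],
   both seen from the curve point at [s]. It increases through zero at [s], so the neighbours on the
   curve are separated by the line to [q]. *)
have dphi : is_derive s 1 (fun u => Tq * D u - Dq * T u) (- Dq * (x1 s ^+ 2 + y1 s ^+ 2)).
  have h := dD s; have h' := dT s.
  by apply: is_derive_eq; rewrite /GRing.scale /= /D1; ring.
have v0 := speed_gt0 s.
have [e1 e10 h1] := derive_pos_near dD1 (curved s).
have v0' : 0 < x1 s * x1 s + y1 s * y1 s by rewrite -!expr2.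
have [e2 e20 h2] := derive_pos_near (dT s) v0'.
have Dv : 0 < - Dq * (x1 s ^+ 2 + y1 s ^+ 2) by rewrite mulr_gt0// oppr_gt0.
have [e3 e30 h3] := derive_pos_near dphi Dv.
pose t := Num.min e1 (Num.min e2 e3) / 2.
have m0 : 0 < Num.min e1 (Num.min e2 e3) by rewrite !lt_min e10 e20.
have t0 : 0 < t by rewrite divr_gt0.
have : t < Num.min e1 (Num.min e2 e3) by rewrite /t ltr_pdivrMr// ltr_pMr// ltr1n.
rewrite !lt_min => /and3P[te1 te2 te3].
have D1s : D1 s = 0 by rewrite /D1 mulrC subrr.
have Ds : D s = 0 by rewrite /D !subrr !mulr0 subrr.
have Ts : T s = 0 by rewrite /T !subrr !mulr0 addr0.
have Dp : 0 < D (s + t).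
  have st : s < s + t by rewrite ltrDl.
  have [u /andP[u1 u2] e] := mean_value dD st.
  have := h1 (u - s); rewrite D1s subr_gt0 u1 /= => /(_ _)[].
    by apply: lt_trans te1; rewrite ltrBlDl.
  rewrite subrKC => hu _; move: e; rewrite Ds subr0 => ->.
  by rewrite mulr_gt0// addrC addKr.
have Dm : 0 < D (s - t).
  have st : s - t < s by rewrite ltrBlDr ltrDl.
  have [u /andP[u1 u2] e] := mean_value dD st.
  have := h1 (s - u); rewrite D1s subr_gt0 u2 /= => /(_ _)[].
    by apply: lt_trans te1; rewrite ltrBlDr addrC -ltrBlDr.
  rewrite subKr => _ hu; move: e; rewrite Ds sub0r subKr => e.
  by rewrite -oppr_lt0 e pmulr_llt0.
have [|Tp Tm] := h2 t; first by rewrite t0.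
have [|Pp Pm] := h3 t; first by rewrite t0.
rewrite Ts in Tp Tm; rewrite Ds Ts !mulr0 subrr in Pp Pm.
have cr (a b : plane R) : (x1 s ^+ 2 + y1 s ^+ 2) * crossp (a - (x s, y s)) (b - (x s, y s)) =
    (x1 s * (a.1 - x s) + y1 s * (a.2 - y s)) * (x1 s * (b.2 - y s) - y1 s * (b.1 - x s))
  - (x1 s * (a.2 - y s) - y1 s * (a.1 - x s)) * (x1 s * (b.1 - x s) + y1 s * (b.2 - y s)).
  by rewrite /crossp /=; ring.
apply: (@bdc s); apply: (@triangle_interior _ _ cK (x (s + t), y (s + t)) (x (s - t), y (s - t)) q) => //.
- rewrite -(pmulr_rgt0 _ v0) cr /= -/(T (s + t)) -/(D (s - t)) -/(D (s + t)) -/(T (s - t)).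
  by rewrite subr_gt0; apply: (@lt_trans _ _ 0); [rewrite pmulr_rlt0|rewrite mulr_gt0].
- rewrite -(pmulr_rgt0 _ v0) cr /= -/(T (s - t)) -/(D (s - t)) -/Dq -/Tq.
  by move: Pm; rewrite -oppr_gt0; congr (0 < _); ring.
- rewrite -(pmulr_rgt0 _ v0) cr /= -/(T (s + t)) -/(D (s + t)) -/Dq -/Tq.
  by [].
Qed.

Definition speed s : R := Num.sqrt (x1 s ^+ 2 + y1 s ^+ 2).

Lemma speed_pos s : 0 < speed s.
Proof. by rewrite sqrtr_gt0 speed_gt0. Qed.

Lemma speed_sqr s : speed s ^+ 2 = x1 s ^+ 2 + y1 s ^+ 2.
Proof. by rewrite sqr_sqrtr// ltW// speed_gt0. Qed.

Lemma is_derive_speed (s : R) : is_derive s 1 speed ((x1 s * x2 s + y1 s * y2 s) / speed s).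
Proof.
have h : is_derive s 1 (fun u => x1 u ^+ 2 + y1 u ^+ 2) (2 * (x1 s * x2 s + y1 s * y2 s)).
  have h := dx1 s; have h' := dy1 s.
  by apply: is_derive_eq; rewrite /GRing.scale /=; ring.
pose sq u := x1 u ^+ 2 + y1 u ^+ 2.
have := @is_derive1_comp _ Num.sqrt sq s _ _ (is_derive1_sqrt (speed_gt0 s)) h.
rewrite (_ : _ * _ = (x1 s * x2 s + y1 s * y2 s) / speed s)//.
rewrite -/(speed s); have := speed_pos s => v0; field.
by rewrite gt_eqF.
Qed.

Variables (L rho : R).
Hypotheses (L0 : 0 < L) (xL : forall s, x (s + L) = x s) (yL : forall s, y (s + L) = y s)
  (x1L : forall s, x1 (s + L) = x1 s) (y1L : forall s, y1 (s + L) = y1 s).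
Hypotheses (rho0 : 0 < rho)
  (curved_rho : forall s, speed s ^+ 3 < rho * (x1 s * y2 s - y1 s * x2 s)).

(* [F] is the defect [|q - c|^2 - 2 rho <q - c, n>]. Its derivative is a positive
   multiple of [E = <q - c, c'>], and where [E = 0 < F] the function [E] increases,
   so that [F] has no positive maximum. *)
Lemma rolled q s : K q ->
  ((q.1 - x s) ^+ 2 + (q.2 - y s) ^+ 2) * speed s <=
  2 * rho * (x1 s * (q.2 - y s) - y1 s * (q.1 - x s)).
Proof.
move=> Kq.
pose W u := x1 u * (q.2 - y u) - y1 u * (q.1 - x u).
pose E u := (q.1 - x u) * x1 u + (q.2 - y u) * y1 u.
pose F u := (q.1 - x u) ^+ 2 + (q.2 - y u) ^+ 2 - 2 * rho * (W u * (speed u)^-1).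
(* This is [rho] times the curvature, minus 1. *)
pose k u := rho * (x1 u * y2 u - y1 u * x2 u) / speed u ^+ 3 - 1.
have k0 u : 0 < k u by rewrite subr_gt0 ltr_pdivlMr ?exprn_gt0 ?speed_pos// mul1r.
have dE (u : R) : is_derive u 1 E (- (x1 u ^+ 2 + y1 u ^+ 2) + (q.1 - x u) * x2 u + (q.2 - y u) * y2 u).
  have h1 := dx u; have h2 := dy u; have h3 := dx1 u; have h4 := dy1 u; rewrite /E.
  by apply: is_derive_eq; rewrite /GRing.scale /=; ring.
have dW (u : R) : is_derive u 1 W (x2 u * (q.2 - y u) - y2 u * (q.1 - x u)).
  have h1 := dx u; have h2 := dy u; have h3 := dx1 u; have h4 := dy1 u; rewrite /W.
  by apply: is_derive_eq; rewrite /GRing.scale /=; ring.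
have dF (u : R) : is_derive u 1 F (2 * E u * k u).
  have h1 := dx u; have h2 := dy u; have h3 := dW u.
  have vN : speed u != 0 by rewrite gt_eqF ?speed_pos.
  have h4 := is_deriveV vN (is_derive_speed u); rewrite /F.
  apply: is_derive_eq; rewrite /GRing.scale /=.
  have -> : 2 * E u * k u = - 2 * E u + 2 * rho * (E u * (x1 u * y2 u - y1 u * x2 u)) / speed u ^+ 3.
    by rewrite /k; field.
  have -> : E u * (x1 u * y2 u - y1 u * x2 u) =
      W u * (x1 u * x2 u + y1 u * y2 u) - (x2 u * (q.2 - y u) - y2 u * (q.1 - x u)) * speed u ^+ 2.
    by rewrite speed_sqr /E /W; ring.
  by rewrite /E; field.
have FL u : F (u + L) = F u by rewrite /F /W /speed xL yL x1L y1L.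
have [m mmax] := periodic_max L0 (derive_continuous dF) FL.
suff Fm : F m <= 0.
  have := le_trans (mmax s) Fm; rewrite /F subr_le0 -/(W s) mulrA.
  by rewrite ler_pdivlMr ?speed_pos.
rewrite leNgt; apply/negP => Fm.
have EmN : ~ (0 < E m).
  move=> Em; have d0 : 0 < 2 * E m * k m by rewrite mulr_gt0// mulr_gt0.
  have [e e0 he] := derive_pos_near (dF m) d0.
  have [|h _] := he (e / 2); first by rewrite divr_gt0// ltr_pdivrMr// ltr_pMr// ltr1n.
  by have := mmax (m + e / 2); rewrite leNgt h.
have EmP : ~ (E m < 0).
  move=> Em; have dN : is_derive m 1 (- F) (- (2 * E m * k m)) by have h := dF m; exact: is_deriveN.
  have d0 : 0 < - (2 * E m * k m) by rewrite oppr_gt0 pmulr_llt0// pmulr_rlt0.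
  have [e e0 he] := derive_pos_near dN d0.
  have [|_ h] := he (e / 2); first by rewrite divr_gt0// ltr_pdivrMr// ltr_pMr// ltr1n.
  by have := mmax (m - e / 2); rewrite leNgt -ltrN2 h.
have Em : E m = 0 by apply/eqP; rewrite eq_le !leNgt; apply/andP; split; apply/negP.
have W0 : 0 <= W m by exact: tangent_support.
have v0 := speed_pos m; have v2 := speed_sqr m.
have vN : speed m != 0 by rewrite gt_eqF.
have gW : ((q.1 - x m) ^+ 2 + (q.2 - y m) ^+ 2) * speed m ^+ 2 = W m ^+ 2.
  rewrite v2; transitivity (W m ^+ 2 + E m ^+ 2); first by rewrite /W /E; ring.
  by rewrite Em expr0n addr0.
(* With [E m = 0] the vector to [q] is normal to the curve and [w] is its length, so that
   [F m = w * (w - 2 * rho)]. *)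
pose w := W m / speed m.
have wp : 2 * rho < w.
  have FE : F m = w * (w - 2 * rho).
    rewrite /F /w; apply: (mulfI (expf_neq0 2 vN)).
    rewrite mulrBr [X in X - _]mulrC gW; field.
    by rewrite vN.
  have w0 : 0 <= w by rewrite divr_ge0// ltW.
  move: Fm; rewrite FE; case: (ltgtP 0 w) w0 => // [w_gt0 _|<- _]; last by rewrite mul0r ltxx.
  by rewrite pmulr_rgt0// subr_gt0.
have dEm : 0 < - (x1 m ^+ 2 + y1 m ^+ 2) + (q.1 - x m) * x2 m + (q.2 - y m) * y2 m.
  have -> : - (x1 m ^+ 2 + y1 m ^+ 2) + (q.1 - x m) * x2 m + (q.2 - y m) * y2 m =
      speed m ^+ 2 * (w * ((x1 m * y2 m - y1 m * x2 m) / speed m ^+ 3) - 1).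
    have a1 : (q.1 - x m) * speed m ^+ 2 = - W m * y1 m.
      by rewrite v2; transitivity (E m * x1 m - W m * y1 m); [rewrite /E /W; ring|rewrite Em; ring].
    have b1 : (q.2 - y m) * speed m ^+ 2 = W m * x1 m.
      by rewrite v2; transitivity (E m * y1 m + W m * x1 m); [rewrite /E /W; ring|rewrite Em; ring].
    rewrite -v2; apply: (mulfI (expf_neq0 2 vN)).
    transitivity (- speed m ^+ 4 + (q.1 - x m) * speed m ^+ 2 * x2 m + (q.2 - y m) * speed m ^+ 2 * y2 m).
      by ring.
    by rewrite a1 b1 /w; field.
  rewrite mulr_gt0 ?exprn_gt0// subr_gt0.
  have kk : 1 < rho * ((x1 m * y2 m - y1 m * x2 m) / speed m ^+ 3).
    by have := k0 m; rewrite /k subr_gt0 mulrA.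
  have cv : 0 < (x1 m * y2 m - y1 m * x2 m) / speed m ^+ 3 by rewrite divr_gt0 ?exprn_gt0.
  apply: (lt_trans kk); rewrite (ltr_pM2r cv).
  by apply: le_lt_trans wp; rewrite mulr_natl mulr2n lerDl ltW.
have [e e0 he] := derive_pos_near (dE m) dEm.
have mm : m < m + e / 2 by rewrite ltrDl divr_gt0.
have [u /andP[u1 u2] hu] := mean_value dF mm.
have [|Eu _] := he (u - m).
  rewrite subr_gt0 u1 /=; apply: (@lt_trans _ _ (e / 2)); first by rewrite ltrBlDl.
  by rewrite ltr_pdivrMr// ltr_pMr// ltr1n.
rewrite Em subrKC in Eu.
have := mmax (m + e / 2); rewrite -subr_le0 hu leNgt => /negP; apply.
by rewrite mulr_gt0 ?subr_gt0// mulr_gt0// mulr_gt0.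
Qed.

End SmoothCurve.

Section LocalFrames.
Context (R : realType) (K : set (plane R)).

(* A piece of boundary seen as a graph over the first axis: [pt] runs along it,
   [nn] is the inner normal, and [rho] the radius of a disc in which [K] rolls. *)
Definition frames (rho sigma M nu delta : R) (pt nn : R -> plane R) : Prop :=
  [/\ forall t : R, `|t| <= delta ->
      [/\ (nn t).1 ^+ 2 + (nn t).2 ^+ 2 = 1, nu <= (nn t).2, K (pt t) &
        forall q, K q -> dist2 q (pt t) <=
          2 * rho * ((q.1 - (pt t).1) * (nn t).1 + (q.2 - (pt t).2) * (nn t).2)],
      forall t t' : R, `|t| <= delta -> `|t'| <= delta -> t <= t' ->
        sigma * (t' - t) <= (pt t').1 - (pt t).1 &
      forall t t' : R, `|t| <= delta -> `|t'| <= delta ->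
        ((pt t').1 - (pt t).1) * (nn t).1 + ((pt t').2 - (pt t).2) * (nn t).2
          <= M * (t' - t) ^+ 2].

Lemma near_radius (s : R) (Q : R -> Prop) : (\forall u \near s, Q u) ->
  exists2 e : R, 0 < e & forall u, `|u - s| < e -> Q u.
Proof. by move=> [e /= e0 he]; exists e => // u us; apply: he; rewrite /= distrC. Qed.

Lemma second_order_bound (g g1 g2 : R -> R) (s s' B : R) :
  (forall u : R, is_derive u 1 g (g1 u)) -> (forall u : R, is_derive u 1 g1 (g2 u)) ->
  g s = 0 -> g1 s = 0 -> (forall u, `|u - s| <= `|s' - s| -> `|g2 u| <= B) ->
  g s' <= B * (s' - s) ^+ 2.
Proof.
move=> dg dg1 gs g1s hB.
have B0 : 0 <= B by apply: le_trans (hB s _) => //; rewrite subrr normr0.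
have fin (a b c : R) : `|a| <= B -> 0 <= b -> b <= c -> a * b * c <= B * c ^+ 2.
  move=> ha b0 bc; have c0 := le_trans b0 bc.
  rewrite expr2 mulrA ler_wpM2r//; apply: le_trans (ler_norm _) _.
  by rewrite normrM (ger0_norm b0) ler_pM.
case: (ltgtP s s') => [ss|ss|<-]; last by rewrite gs subrr expr0n mulr0.
- have [u /andP[u1 u2] hu] := mean_value dg ss.
  have [w /andP[w1 w2] hw] := mean_value dg1 u1.
  move: hu hw; rewrite gs g1s !subr0 => -> ->.
  apply: fin; [|by rewrite subr_ge0 ltW|by rewrite lerD2r ltW].
  by apply: hB; rewrite !gtr0_norm ?subr_gt0// lerD2r ltW// (lt_trans w2).
- have [u /andP[u1 u2] hu] := mean_value dg ss.
  have [w /andP[w1 w2] hw] := mean_value dg1 u2.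
  move: hu hw; rewrite gs g1s !sub0r => hu hw.
  have -> : g s' = g2 w * (s - u) * (s - s') by rewrite -hw mulNr -hu opprK.
  rewrite -(sqrrN (s' - s)) opprB.
  apply: fin; [|by rewrite subr_ge0 ltW|by rewrite lerD2l lerN2 ltW].
  by apply: hB; rewrite !ltr0_norm ?subr_lt0// lerN2 lerD2r ltW// (lt_trans u1).
Qed.

Hypothesis cK : convex_set K.
Variables x y x1 y1 x2 y2 : R -> R.
Hypotheses (dx : forall s : R, is_derive s 1 x (x1 s)) (dy : forall s : R, is_derive s 1 y (y1 s))
  (dx1 : forall s : R, is_derive s 1 x1 (x2 s)) (dy1 : forall s : R, is_derive s 1 y1 (y2 s))
  (cx2 : continuous x2) (cy2 : continuous y2).
Hypothesis Kc : forall s, K (x s, y s).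
Hypothesis bdc : forall s, ~ interior K (x s, y s).
Variables (L rho : R).
Hypotheses (L0 : 0 < L) (xL : forall s, x (s + L) = x s) (yL : forall s, y (s + L) = y s)
  (x1L : forall s, x1 (s + L) = x1 s) (y1L : forall s, y1 (s + L) = y1 s).
Hypothesis rho0 : 0 < rho.
Hypothesis curved : forall s, 0 < x1 s * y2 s - y1 s * x2 s.
Hypothesis curved_rho : forall s, speed x1 y1 s ^+ 3 < rho * (x1 s * y2 s - y1 s * x2 s).

(** Rolle's theorem over one period gives a zero of [x1]. There the curvature forces [x2] to be
    nonzero, so [x1] changes sign and is positive on one side. *)
Lemma base_point : exists s, 0 < x1 s.
Proof.
have e : x 0 = x L by rewrite -(xL 0) add0r.
have [u _ hu] := Rolle L0 (fun s _ => @ex_derive _ _ _ _ _ _ _ (dx s))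
  (continuous_subspaceT (derive_continuous dx)) e.
have x1u : x1 u = 0 by case: hu (dx u) => _ h1 [_ h2]; rewrite -h2 h1.
have x2u : x2 u != 0.
  by apply: contraTneq (curved u) => ->; rewrite x1u mul0r mulr0 subrr ltxx.
case: (ltgtP (x2 u) 0) x2u => // x2u _.
  have dN : is_derive u 1 (- x1) (- x2 u) by have h := dx1 u; exact: is_deriveN.
  have d0 : 0 < - x2 u by rewrite oppr_gt0.
  have [e1 e10 he] := derive_pos_near dN d0.
  exists (u - e1 / 2); have [|_] := he (e1 / 2).
    by rewrite divr_gt0// ltr_pdivrMr// ltr_pMr// ltr1n.
  by rewrite /= ltrN2 x1u.
have [e1 e10 he] := derive_pos_near (dx1 u) x2u.
exists (u + e1 / 2); have [|] := he (e1 / 2).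
  by rewrite divr_gt0// ltr_pdivrMr// ltr_pMr// ltr1n.
by rewrite x1u.
Qed.

Lemma frames_exist : exists sigma M nu delta pt nn,
  [/\ 0 < sigma, 0 < M, 0 < nu, 0 < delta & frames rho sigma M nu delta pt nn].
Proof.
have [s0 x1s0] := base_point.
have v0 s : 0 < speed x1 y1 s by exact: speed_pos curved s.
have v2 s : speed x1 y1 s ^+ 2 = x1 s ^+ 2 + y1 s ^+ 2 by exact: speed_sqr curved s.
pose nu2 s := x1 s / speed x1 y1 s.
have nu2s0 : 0 < nu2 s0 by rewrite divr_gt0.
have cx1 := derive_continuous dx1.
have cnu2 : nu2 @ s0 --> nu2 s0.
  apply: cvgM; first exact: cx1.
  apply: cvgV; first by rewrite gt_eqF.
  exact: (derive_continuous (is_derive_speed dx1 dy1 curved)).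
have half (a : R) : 0 < a -> a / 2 < a by move=> a0; rewrite ltr_pdivrMr// ltr_pMr// ltr1n.
have [d1 d10 h1] := near_radius (@cvgr_gt _ _ _ _ _ _ (cx1 s0) _ (half _ x1s0)).
have [d2 d20 h2] := near_radius (@cvgr_gt _ _ _ _ _ _ cnu2 _ (half _ nu2s0)).
have bnd (f : R -> R) : continuous f -> exists2 e : R, 0 < e & forall u : R, `|u - s0| < e -> `|f u| < `|f s0| + 1.
  move=> cf; apply: near_radius.
  have cnf : (fun u => `|f u|) @ s0 --> `|f s0| by apply: cvg_norm; exact: cf.
  have lt1 : `|f s0| < `|f s0| + 1 by rewrite ltrDl.
  exact: (@cvgr_lt _ _ _ _ _ _ cnf _ lt1).
have [d3 d30 h3] := bnd _ cx2; have [d4 d40 h4] := bnd _ cy2.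
pose B := `|x2 s0| + 1 + (`|y2 s0| + 1).
have B0 : 0 < B by apply: addr_gt0; apply: ltr_wpDl.
pose d := Num.min (Num.min d1 d2) (Num.min d3 d4).
have d0 : 0 < d by rewrite !lt_min d10 d20 d30.
(* Arguments between two parameters of size at most [delta] are reached within distance [3 * delta]
   of [s0], still below [d]. *)
pose delta := d / 4.
have delta0 : 0 < delta by rewrite divr_gt0.
pose pt t : plane R := (x (s0 + t), y (s0 + t)).
pose nn t : plane R := (- y1 (s0 + t) / speed x1 y1 (s0 + t), x1 (s0 + t) / speed x1 y1 (s0 + t)).
have close (t : R) : `|t| < d -> [/\ `|s0 + t - s0| < d1, `|s0 + t - s0| < d2, `|s0 + t - s0| < d3 & `|s0 + t - s0| < d4].
  by rewrite addrC addKr !lt_min => /andP[/andP[? ?] /andP[? ?]].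
have dlt (t : R) : `|t| <= delta -> `|t| < d.
  by move=> h; apply: (le_lt_trans h); rewrite ltr_pdivrMr// ltr_pMr// ltr1n.
exists (x1 s0 / 2), B, (nu2 s0 / 2), delta, pt, nn; split => //; try by rewrite divr_gt0.
split.
- move=> t ht; set s := s0 + t; have [c1 c2 _ _] := close t (dlt t ht); split.
  + rewrite /nn /= -/s !expr_div_n sqrrN -mulrDl v2 addrC divff//.
    by rewrite -v2 expf_neq0// gt_eqF.
  + by apply: ltW; exact: (h2 _ c2).
  + exact: Kc.
  + move=> q Kq; have := rolled cK dx dy dx1 dy1 Kc bdc curved L0 xL yL x1L y1L rho0 curved_rho s Kq.
    rewrite -ler_pdivlMr//; congr (_ <= _); rewrite /nn /pt /= -/s; field.
    by rewrite gt_eqF.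
- move=> t t' ht ht'; rewrite le_eqVlt => /predU1P[->|tt']; first by rewrite !subrr mulr0.
  have st : s0 + t < s0 + t' by rewrite ltrD2l.
  have [u /andP[u1 u2] hu] := mean_value dx st; rewrite /pt /= hu.
  have -> : s0 + t' - (s0 + t) = t' - t by ring.
  have hud : `|u - s0| < d1.
    have : `|u - s0| < d.
      move: (dlt t ht) (dlt t' ht'); rewrite !ltr_norml => /andP[? ?] /andP[? ?].
      by apply/andP; split; lra.
    by rewrite !lt_min => /andP[/andP[]].
  by apply: ler_wpM2r; [rewrite subr_ge0 ltW|apply/ltW/h1].
- move=> t t' ht ht'; set s := s0 + t; set s' := s0 + t'.
  pose g u := x1 s * (y u - y s) - y1 s * (x u - x s).
  pose g1 u := x1 s * y1 u - y1 s * x1 u.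
  pose g2 u := x1 s * y2 u - y1 s * x2 u.
  have dg (u : R) : is_derive u 1 g (g1 u).
    have h := dx u; have h' := dy u; rewrite /g /g1.
    by apply: is_derive_eq; rewrite /GRing.scale /=; ring.
  have dg1 (u : R) : is_derive u 1 g1 (g2 u).
    have h := dx1 u; have h' := dy1 u; rewrite /g1 /g2.
    by apply: is_derive_eq; rewrite /GRing.scale /=; ring.
  have le_speed (a b : R) : a ^+ 2 + b ^+ 2 = speed x1 y1 s ^+ 2 -> `|a| <= speed x1 y1 s.
    by move=> e; rewrite -(@ler_pXn2r _ 2)// ?nnegrE ?(ltW (v0 s))// real_normK ?num_real// -e lerDl sqr_ge0.
  have hx1 : `|x1 s| <= speed x1 y1 s by apply: (@le_speed _ (y1 s)).
  have hy1 : `|y1 s| <= speed x1 y1 s by apply: (@le_speed _ (x1 s)); rewrite addrC.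
  have hB u : `|u - s| <= `|s' - s| -> `|g2 u| <= speed x1 y1 s * B.
    move=> hu; have : `|u - s0| < d.
      have h5 : `|u - s0| <= `|u - s| + `|s - s0| by rewrite (le_trans _ (ler_normD _ _))// addrA subrK.
      have h6 : `|s' - s| <= `|t'| + `|t|.
        by rewrite (_ : s' - s = t' - t) ?ler_normB//; rewrite /s /s'; ring.
      have h7 : `|s - s0| = `|t| by rewrite /s addrC addKr.
      have h8 : delta = d / 4 by [].
      by lra.
    rewrite !lt_min => /andP[/andP[_ _] /andP[e3 e4]].
    rewrite /B mulrDr addrC; apply: (le_trans (ler_normB _ _)); rewrite !normrM.
    by apply: lerD; apply: ler_pM => //; apply: ltW; [exact: h4|exact: h3].
  have gs : g s = 0 by rewrite /g !subrr !mulr0 subrr.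
  have g1s : g1 s = 0 by rewrite /g1 mulrC subrr.
  have := second_order_bound dg dg1 gs g1s hB.
  rewrite (_ : s' - s = t' - t); last by rewrite /s /s'; ring.
  rewrite -mulrA [leRHS]mulrC -ler_pdivrMr//; congr (_ <= _).
  by rewrite /g /pt /nn /= -/s -/s'; field; rewrite gt_eqF.
Qed.

End LocalFrames.

Section ConvexDiscFrames.
Context (R : realType).

Lemma constant_sign (f : R -> R) : continuous f -> (forall s, f s != 0) ->
  (forall s, 0 < f s) \/ (forall s, f s < 0).
Proof.
move=> cf fN0.
have pos a b : 0 < f a -> 0 < f b.
  move=> fa; rewrite ltNge; apply/negP; rewrite le_eqVlt (negPf (fN0 b)) /= => fb.
  have zero u v : u <= v -> Num.min (f u) (f v) <= 0 -> 0 <= Num.max (f u) (f v) -> False.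
    move=> uv h1 h2; have [|c _ fc] := IVT uv (continuous_subspaceT cf) (v := 0).
      by rewrite h1.
    by have := fN0 c; rewrite fc eqxx.
  have [ab|ba] := leP a b.
    by apply: (zero a b ab); rewrite ?ge_min ?le_max ?(ltW fa) ?(ltW fb) ?orbT.
  by apply: (zero b a (ltW ba)); rewrite ?ge_min ?le_max ?(ltW fa) ?(ltW fb) ?orbT.
have [f0|f0] := ltP 0 (f 0); [left|right] => s; first exact: pos f0.
rewrite ltNge le_eqVlt eq_sym (negPf (fN0 s)) /=; apply/negP => fs.
by have := pos s 0 fs; rewrite ltNge f0.
Qed.

Lemma derive1_periodic (c : R -> plane R) L s : (forall u, c (u + L) = c u) ->
  c^`() (s + L) = c^`() s.
Proof.
move=> cL; rewrite /derive1 (_ : (fun h : R => h^-1 *: (c (h + (s + L)) - c (s + L))) =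
  (fun h : R => h^-1 *: (c (h + s) - c s)))//.
by apply/funext => h; rewrite addrA !cL.
Qed.

Lemma is_derive_reverse (f : R -> R) (s a : R) : is_derive (- s) 1 f a ->
  is_derive s 1 (fun u => f (- u)) (- a).
Proof.
move=> df; have dN : is_derive s 1 (fun u : R => - u) (-1) by apply: is_derive_eq.
by have := @is_derive1_comp _ f (fun u : R => - u) s _ _ df dN; rewrite mulrN1.
Qed.

Theorem convex_disc_frames (K : set (plane R)) (kappa r : R) : convex_disc K ->
  class_C2plus K -> is_min_curvature K kappa -> kappa^-1 < r ->
  exists rho sigma M nu delta pt nn, [/\ 0 < rho, rho < r &
   [/\ 0 < sigma, 0 < M, 0 < nu, 0 < delta & frames K rho sigma M nu delta pt nn]].
Proof.
move=> [compK cK _] [[L [c cpar]] curvpos] [[p0 bp0 cp0] kmin] kr.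
have k0 : 0 < kappa by exact: curvpos cp0.
have [[L0 cL] [_ rc] dc cc2 cN] := cpar.
pose x s := (c s).1. pose y s := (c s).2.
pose x1 s := (c^`() s).1. pose y1 s := (c^`() s).2.
pose x2 s := (c^`(2) s).1. pose y2 s := (c^`(2) s).2.
have dx (s : R) : is_derive s 1 x (x1 s) by exact: (derivable_pair (proj1 (dc s))).1.
have dy (s : R) : is_derive s 1 y (y1 s) by exact: (derivable_pair (proj1 (dc s))).2.
have dx1 (s : R) : is_derive s 1 x1 (x2 s) by exact: (derivable_pair (proj2 (dc s))).1.
have dy1 (s : R) : is_derive s 1 y1 (y2 s) by exact: (derivable_pair (proj2 (dc s))).2.
have fstc : continuous (fun p : plane R => p.1) by move=> p; exact: cvg_fst.
have sndc : continuous (fun p : plane R => p.2) by move=> p; exact: cvg_snd.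
have cx2 : continuous x2 by move=> s; exact: (@cvg_comp _ _ _ _ _ _ _ _ (cc2 s) (fstc _)).
have cy2 : continuous y2 by move=> s; exact: (@cvg_comp _ _ _ _ _ _ _ _ (cc2 s) (sndc _)).
have bdc s : bd K (c s) by rewrite -rc; exists s.
have cE s : c s = (x s, y s) by exact: surjective_pairing.
have Kc s : K (x s, y s).
  have [h _] := bdc s; rewrite -cE.
  have clK : closed K by apply: compact_closed => //; exact: norm_hausdorff.
  exact: clK.
have bdc' s : ~ interior K (x s, y s) by have [_] := bdc s; rewrite -cE.
have xL s : x (s + L) = x s by rewrite /x cL.
have yL s : y (s + L) = y s by rewrite /y cL.
have x1L s : x1 (s + L) = x1 s by rewrite /x1 derive1_periodic.
have y1L s : y1 (s + L) = y1 s by rewrite /y1 derive1_periodic.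
pose om s := x1 s * y2 s - y1 s * x2 s.
have v0 s : 0 < speed x1 y1 s.
  rewrite sqrtr_gt0 lt_neqAle addr_ge0 ?sqr_ge0// andbT eq_sym.
  apply: contraNneq (cN s) => /eqP; rewrite paddr_eq0 ?sqr_ge0// !sqrf_eq0.
  by move=> /andP[/eqP e1 /eqP e2]; apply/eqP; rewrite [LHS]surjective_pairing -/(x1 s) -/(y1 s) e1 e2.
have kom s : kappa * speed x1 y1 s ^+ 3 <= `|om s|.
  rewrite -ler_pdivlMr ?exprn_gt0//; apply: kmin; exists (c s) => //.
  by exists L, c, s.
have omN s : om s != 0.
  rewrite -normr_gt0; apply: lt_le_trans (kom s).
  by rewrite mulr_gt0// exprn_gt0.
have com : continuous om.
  move=> s; apply: cvgB; apply: cvgM.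
  - exact: (derive_continuous dx1).
  - exact: cy2.
  - exact: (derive_continuous dy1).
  - exact: cx2.
have kV0 : 0 < kappa^-1 by rewrite invr_gt0.
(* Both inequalities must be strict: [rho] above the largest radius of curvature for [rolled], and
   below [r] for [cover_far]. *)
pose rho := (kappa^-1 + r) / 2.
have rho0 : 0 < rho by rewrite divr_gt0// addr_gt0// (lt_trans kV0).
have rhor : rho < r by rewrite /rho; lra.
have rhok : kappa^-1 < rho by rewrite /rho; lra.
have komr s : speed x1 y1 s ^+ 3 < rho * `|om s|.
  apply: lt_le_trans (_ : rho * (kappa * speed x1 y1 s ^+ 3) <= _); last by rewrite ler_pM2l.
  rewrite mulrA ltr_pMl ?exprn_gt0// -(mulVf (lt0r_neq0 k0)).
  by rewrite ltr_pM2r.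
exists rho; have [om_pos|om_neg] := constant_sign com omN.
  have cr s : speed x1 y1 s ^+ 3 < rho * (x1 s * y2 s - y1 s * x2 s).
    by have := komr s; rewrite gtr0_norm.
  have [sigma [M [nu [delta [pt [nn h]]]]]] :=
    frames_exist cK dx dy dx1 dy1 cx2 cy2 Kc bdc' L0 xL yL x1L y1L rho0 om_pos cr.
  by exists sigma, M, nu, delta, pt, nn.
(* A clockwise curve is traversed backwards: velocities are negated, accelerations kept, and the
   sign of [om] is reversed. *)
pose x1r s := - x1 (- s). pose y1r s := - y1 (- s).
have omr s : x1r s * y2 (- s) - y1r s * x2 (- s) = - om (- s) by rewrite /x1r /y1r /om !mulNr opprK opprB addrC.
have sr s : speed x1r y1r s = speed x1 y1 (- s) by rewrite /speed /x1r /y1r !sqrrN.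
have pr s : 0 < x1r s * y2 (- s) - y1r s * x2 (- s) by rewrite omr oppr_gt0.
have cr s : speed x1r y1r s ^+ 3 < rho * (x1r s * y2 (- s) - y1r s * x2 (- s)).
  by rewrite sr omr; have := komr (- s); rewrite ltr0_norm.
have dxr (s : R) : is_derive s 1 (fun u => x (- u)) (x1r s) by exact: is_derive_reverse.
have dyr (s : R) : is_derive s 1 (fun u => y (- u)) (y1r s) by exact: is_derive_reverse.
have d2r (f g : R -> R) : (forall s : R, is_derive s 1 f (g s)) -> forall s : R,
    is_derive s 1 (fun u => - f (- u)) (g (- s)).
  move=> df s; rewrite -[g _]opprK; apply: is_deriveN.
  exact: is_derive_reverse.
have per (f : R -> R) : (forall s, f (s + L) = f s) -> forall s, f (- (s + L)) = f (- s).
  by move=> fL s; rewrite -fL opprD subrK.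
have cN' (f : R -> R) : continuous f -> continuous (fun u => f (- u)).
  by move=> cf s; apply: (@cvg_comp _ _ _ (fun u : R => - u) f _ (nbhs (- s))); [exact: cvgN|exact: cf].
have [sigma [M [nu [delta [pt [nn h]]]]]] :=
  frames_exist cK dxr dyr (d2r _ _ dx1) (d2r _ _ dy1) (cN' _ cx2) (cN' _ cy2) (fun s => Kc (- s))
    (fun s => @bdc' (- s)) L0 (per _ xL) (per _ yL)
    (fun s => congr1 -%R (per _ x1L s)) (fun s => congr1 -%R (per _ y1L s)) rho0 pr cr.
by exists sigma, M, nu, delta, pt, nn.
Qed.

End ConvexDiscFrames.

(** * Caps and their areas *)

Section ShearedBoxes.
Context (R : realType).

Lemma open_measurable_plane (U : set (plane R)) : open U -> measurable (U : set (mplane R)).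
Proof.
move=> oU.
pose box (k : (rat * rat) * (rat * rat)) : set (plane R) :=
  `]ratr k.1.1, ratr k.1.2[ `*` `]ratr k.2.1, ratr k.2.2[.
pose D := [set k | box k `<=` U].
have -> : U = \bigcup_(k in D) box k.
  apply/seteqP; split => [v Uv|v [k kD kv]]; last exact: kD.
  have := open_nbhs_nbhs (conj oU Uv) => -[[A B] /= [nA nB] AB].
  have itv (C : set R) (a : R) : nbhs a C -> exists p q : rat,
      ratr p < a < ratr q /\ `]ratr p, ratr q[ `<=` C.
    move=> -[e /= e0 he].
    have ae : a - e < a by rewrite ltrBlDr ltrDl.
    have ea : a < a + e by rewrite ltrDl.
    have [p] := rat_in_itvoo ae; rewrite in_itv /= => /andP[p1 p2].
    have [q] := rat_in_itvoo ea; rewrite in_itv /= => /andP[q1 q2].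
    exists p, q; rewrite p2 q1; split => // z; rewrite /= in_itv /= => /andP[z1 z2].
    apply: he; rewrite /= ltr_norml; apply/andP; split.
      by rewrite ltrBrDl; have := lt_trans z2 q2; lra.
    by have := lt_trans p1 z1; lra.
  have [p [q [/andP[p1 q1] pq]]] := itv _ _ nA; have [p' [q' [/andP[p1' q1'] pq']]] := itv _ _ nB.
  exists ((p, q), (p', q')).
    by move=> z [z1 z2]; apply: AB; split; [exact: pq|exact: pq'].
  by split; rewrite /= in_itv /=; apply/andP.
rewrite (_ : \bigcup_(k in D) box k = \bigcup_k (if pselect (D k) then box k else set0)).
  apply: countable_bigcupT_measurable => [|k]; first exact: countableP.
  have mbox : measurable (box k : set (mplane R)) by apply: measurableX; exact: measurable_itv.
  by case: (pselect (D k)) => Dk; [exact: mbox|exact: measurable0].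
apply/seteqP; split => [v [k Dk bk]|v [k _]]; first by exists k => //; case: (pselect (D k)).
by case: (pselect (D k)) => // Dk bk; exists k.
Qed.

Lemma compact_measurable_plane (K : set (plane R)) : compact K -> measurable (K : set (mplane R)).
Proof.
move=> cK; have clK : closed K by apply: compact_closed => //; exact: norm_hausdorff.
rewrite -(setCK K); apply: measurableC; apply: open_measurable_plane.
by rewrite openC.
Qed.

(* A parallelogram with two vertical sides. *)
Definition sbox (p n : plane R) (c d a b : R) : set (mplane R) :=
  [set q | c <= q.1 - p.1 <= d /\ a <= (q.1 - p.1) * n.1 + (q.2 - p.2) * n.2 <= b].

Lemma measurable_sbox p n c d a b : measurable (sbox p n c d a b).
Proof.
have m1 : measurable_fun setT (fun q : mplane R => q.1 - p.1).
  by apply: measurable_funB => //; exact: measurable_fst.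
have m2 : measurable_fun setT (fun q : mplane R => (q.1 - p.1) * n.1 + (q.2 - p.2) * n.2).
  apply: measurable_funD; apply: measurable_funM => //.
  by apply: measurable_funB => //; exact: measurable_snd.
have -> : sbox p n c d a b = ((fun q : mplane R => q.1 - p.1) @^-1` `[c, d]) `&`
   ((fun q : mplane R => (q.1 - p.1) * n.1 + (q.2 - p.2) * n.2) @^-1` `[a, b]).
  apply/seteqP; split => q /=; rewrite !in_itv /=; first by move=> [].
  by move=> [].
apply: measurableI; rewrite -[X in measurable X]setTI.
  exact: m1.
exact: m2.
Qed.

Lemma lebesgue2_sbox (p n : plane R) (c d a b : R) : 0 < n.2 -> c <= d -> a <= b ->
  lebesgue2 (sbox p n c d a b) = ((d - c) * ((b - a) / n.2))%:E.
Proof.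
move=> n0 cd ab.
have sec x : lebesgue_measure (xsection (sbox p n c d a b) x) =
    ((\1_(`[(p.1 + c)%R, (p.1 + d)%R]) x)%:E * ((b - a) / n.2)%:E)%E.
  have [xI|xI] := boolP (x \in `[p.1 + c, p.1 + d]%classic).
    rewrite indicE xI mul1e.
    have -> : xsection (sbox p n c d a b) x =
        `[p.2 + (a - (x - p.1) * n.1) / n.2, p.2 + (b - (x - p.1) * n.1) / n.2].
      have e1 y : (p.2 + (a - (x - p.1) * n.1) / n.2 <= y) = (a <= (x - p.1) * n.1 + (y - p.2) * n.2).
        by rewrite -lerBrDl ler_pdivrMr// lerBlDl.
      have e2 y : (y <= p.2 + (b - (x - p.1) * n.1) / n.2) = ((x - p.1) * n.1 + (y - p.2) * n.2 <= b).
        by rewrite -lerBlDl ler_pdivlMr// lerBrDl.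
      apply/seteqP; split => y; rewrite /xsection /= inE /sbox /= in_itv /= e1 e2; first by case.
      move=> h; split => //; move: xI; rewrite inE /= in_itv /= => /andP[h3 h4].
      by apply/andP; split; lra.
    rewrite lebesgue_measure_itv/= lte_fin ltrD2l ltr_pM2r ?invr_gt0// ltrD2r.
    case: ltP => [_|ba]; first by rewrite -EFinD; congr (_%:E); field; rewrite gt_eqF.
    have -> : b = a by apply/eqP; rewrite eq_le ba.
    by rewrite subrr mul0r.
  rewrite indicE (negPf xI) mul0e.
  rewrite (_ : xsection _ _ = set0) ?measure0//; apply/seteqP; split => // y.
  rewrite /xsection /= inE /sbox /= => -[/andP[h1 h2] _]; move/negP: xI; apply.
  by rewrite inE /= in_itv /=; apply/andP; split; lra.
rewrite /lebesgue2 /product_measure1 /=.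
under eq_integral do rewrite sec.
rewrite ge0_integralZr//; last 2 first.
- exact/measurable_EFinP/measurable_indic.
- by rewrite lee_fin divr_ge0 ?subr_ge0// ltW.
rewrite integral_indic//= setIT lebesgue_measure_itv/= lte_fin ltrD2l.
case: ltP => [_|dc]; first by rewrite -EFinD -EFinM; congr (_%:E); ring.
have -> : d = c by apply/eqP; rewrite eq_le dc.
by rewrite mul0e subrr mul0r.
Qed.

Lemma area_sbox (p n : plane R) (c d a b : R) : 0 < n.2 -> c <= d -> a <= b ->
  area (sbox p n c d a b) = (d - c) * ((b - a) / n.2).
Proof. by move=> n0 cd ab; rewrite /area lebesgue2_sbox. Qed.

End ShearedBoxes.

Section OneCap.
Context (R : realType).

Lemma tcoord_shear (p n q : plane R) (h : R) : n.1 ^+ 2 + n.2 ^+ 2 = 1 -> 0 < h ->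
  h * (tcoord p n h q * n.2) = (q.1 - p.1) - h ^+ 2 * ncoord p n h q * n.1.
Proof.
move=> n1 h0; have {2}<- := locK p n1 h0 q.
by rewrite /loc /=; ring.
Qed.

Lemma sbox_ncoord (p n q : plane R) (h c d a b : R) : 0 < h ->
  sbox p n c d (a * h ^+ 2) (b * h ^+ 2) q -> a <= ncoord p n h q <= b.
Proof.
move=> h0 [_ /andP[h1 h2]]; have e0 : 0 < h ^+ 2 by rewrite exprn_gt0.
by rewrite /ncoord ler_pdivlMr// ler_pdivrMr// h1.
Qed.

Lemma unit_normal_le1 (n : plane R) : n.1 ^+ 2 + n.2 ^+ 2 = 1 -> `|n.1| <= 1 /\ n.2 <= 1.
Proof.
move=> n1; have le (a b : R) : a ^+ 2 + b ^+ 2 = 1 -> `|a| <= 1.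
  move=> e; rewrite -(@ler_pXn2r _ 2)// ?nnegrE// real_normK ?num_real// expr1n -e.
  by rewrite lerDl sqr_ge0.
split; first exact: le n1.
by apply: le_trans (ler_norm _) _; apply: (le _ n.1); rewrite addrC.
Qed.

(** The sides are vertical rather than normal to the boundary, so that caps can be separated on the
    first axis; the resulting shear is of lower order in [h] and is absorbed by [eta]. *)
Lemma sbox_tcoord (p n q : plane R) (h c d a b eta : R) : n.1 ^+ 2 + n.2 ^+ 2 = 1 ->
  0 < h -> 0 <= a -> h * b <= eta ->
  sbox p n (c * h) (d * h) (a * h ^+ 2) (b * h ^+ 2) q ->
  c - eta <= tcoord p n h q * n.2 <= d + eta.
Proof.
move=> n1 h0 a0 hb hq; have /andP[z1 z2] := sbox_ncoord h0 hq.
case: hq => /andP[u1 u2] _; have := tcoord_shear p q n1 h0.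
set X := tcoord p n h q * n.2; set z := ncoord p n h q in z1 z2 *.
have [n1le _] := unit_normal_le1 n1 => hX.
have zn : `|h * z * n.1| <= eta.
  have hz0 : 0 <= h * z by rewrite mulr_ge0 ?(le_trans a0 z1)// ltW.
  rewrite normrM (ger0_norm hz0); apply: le_trans hb; rewrite -[leRHS]mulr1.
  by apply: ler_pM => //; rewrite ler_pM2l.
have XE : h * X = (q.1 - p.1) - h * (h * z * n.1) by rewrite hX; ring.
move: zn; rewrite ler_norml => /andP[e1 e2].
have h1 : h * (h * z * n.1) <= h * eta by rewrite ler_pM2l.
have h2 : h * (- eta) <= h * (h * z * n.1) by rewrite ler_pM2l.
apply/andP; split; rewrite -(ler_pM2l h0) XE.
  by rewrite mulrBr [h * c]mulrC; apply: lerB.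
by rewrite mulrDr [h * d]mulrC; apply: lerD => //; move: h2; rewrite mulrN lerNl.
Qed.

(** A cone with apex [p] and slope [C1], cut off at height [C2], fits into the triangle of [p], [Pp]
    and [Pm]. The barycentric weights are cross products in the coordinates [xi] and [et]. *)
Lemma frame_triangle (K : set (plane R)) (p n Pp Pm q : plane R) (C1 C2 : R) : convex_set K ->
  n.2 != 0 -> K p -> K Pp -> K Pm ->
  let xi (w : plane R) := w.1 - p.1 in
  let et (w : plane R) := (w.1 - p.1) * n.1 + (w.2 - p.2) * n.2 in
  0 < xi Pp -> xi Pm < 0 -> 0 < C2 -> C2 <= et Pp -> C2 <= et Pm ->
  et Pp <= C1 * xi Pp -> et Pm <= - C1 * xi Pm ->
  C1 * `|xi q| <= et q -> et q <= C2 -> K q.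
Proof.
move=> cK n2 Kp Kpp Kpm xi et xp xm C20 ep em sp sm hq1 hq2.
have C10 : 0 < C1.
  by rewrite -(pmulr_lgt0 _ xp); apply: lt_le_trans sp; apply: lt_le_trans ep.
have q1 : C1 * xi q <= et q by apply: le_trans hq1; rewrite ler_pM2l// ler_norm.
have q2 : C1 * - xi q <= et q by apply: le_trans hq1; rewrite ler_pM2l// -normrN ler_norm.
have w1 : 0 <= xi q * et Pm - et q * xi Pm.
  rewrite -(pmulr_rge0 _ C10).
  have [x0|x0] := leP 0 (xi q).
    have : 0 <= xi q * et Pm by rewrite mulr_ge0// (le_trans _ em)// ltW.
    have : 0 <= et q * - xi Pm.
      by rewrite mulr_ge0 ?oppr_ge0 ?(ltW xm)// (le_trans _ q1)// mulr_ge0// ltW.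
    by move=> h1 h2; rewrite mulr_ge0 ?(ltW C10)//; move: h1; rewrite mulrN; lra.
  have h1 : (- xi q) * et Pm <= (- xi q) * (- C1 * xi Pm) by rewrite ler_wpM2l// oppr_ge0 ltW.
  have h2 : (C1 * - xi q) * (- xi Pm) <= et q * (- xi Pm) by rewrite ler_wpM2r// oppr_ge0 ltW.
  by rewrite mulr_ge0 ?(ltW C10)//; lra.
have w2 : 0 <= et q * xi Pp - xi q * et Pp.
  have [x0|x0] := leP (xi q) 0.
    have : 0 <= (- xi q) * et Pp by rewrite mulr_ge0 ?oppr_ge0// (le_trans _ ep)// ltW.
    have : 0 <= et q * xi Pp.
      by rewrite mulr_ge0 ?(ltW xp)// (le_trans _ q2)// mulr_ge0 ?oppr_ge0// ltW.
    lra.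
  have h1 : xi q * et Pp <= xi q * (C1 * xi Pp) by rewrite ler_wpM2l// ltW.
  have h2 : (C1 * xi q) * xi Pp <= et q * xi Pp by rewrite ler_wpM2r// ltW.
  lra.
have eq0 : 0 <= et q by apply: le_trans hq1; rewrite mulr_ge0// ltW.
have xq1 : xi q <= xi Pp.
  rewrite -(ler_pM2l C10); apply: le_trans q1 _; apply: le_trans hq2 _.
  exact: le_trans ep sp.
have xq2 : xi Pm <= xi q.
  rewrite -lerN2 -(ler_pM2l C10); apply: le_trans q2 _; apply: le_trans hq2 _.
  by apply: le_trans em _; move: sm; rewrite mulNr mulrN.
have w0 : 0 <= (xi Pp * et Pm - et Pp * xi Pm) - (xi q * et Pm - et q * xi Pm) - (et q * xi Pp - xi q * et Pp).
  have -> : (xi Pp * et Pm - et Pp * xi Pm) - (xi q * et Pm - et q * xi Pm) - (et q * xi Pp - xi q * et Pp)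
    = (xi Pp - xi q) * (et Pm - et q) + (xi q - xi Pm) * (et Pp - et q) by ring.
  apply: addr_ge0; apply: mulr_ge0; rewrite subr_ge0//.
    exact: le_trans em.
  exact: le_trans ep.
set wp := xi q * _ - _ in w1 w0; set wm := et q * _ - _ in w2 w0.
set Dn := xi Pp * _ - _ in w0.
have Dn0 : 0 < Dn.
  rewrite /Dn subr_gt0; apply: (@lt_trans _ _ 0).
    by rewrite pmulr_rlt0// (lt_le_trans C20).
  by rewrite mulr_gt0// (lt_le_trans C20).
apply: (convex_comb3 cK Kp Kpp Kpm w0 w1 w2).
- by rewrite [X in 0 < X](_ : _ = Dn)//; ring.
- have -> : Dn - wp - wm + wp + wm = Dn by ring.
  by rewrite /Dn /wp /wm /xi /et; ring.
- have -> : Dn - wp - wm + wp + wm = Dn by ring.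
  by apply: (mulIf n2); rewrite /Dn /wp /wm /xi /et; ring.
Qed.

End OneCap.

Section CapBoxes.
Context (R : realType).
Implicit Types (p n : plane R) (a s zt B Z h t c d al be U rho sigma M nu delta : R).

Definition capC B Z h p n := sbox p n (- B * h) (B * h) (0 * h ^+ 2) (Z * h ^+ 2).
(** The same shape gives the high box, at heights [zt - s] to [zt], and the region gained by the
    hull, at heights [3 * s] to [4 * s]. *)
Definition low_box (e0 s s' : R) h p n := sbox p n (- e0 * h) (e0 * h) (s * h ^+ 2) (s' * h ^+ 2).
Definition left_box a s zt h p n :=
  sbox p n (- (2 * a) * h) (- a * h) ((zt - s) * h ^+ 2) (zt * h ^+ 2).
Definition right_box a s zt h p n :=
  sbox p n (a * h) (2 * a * h) ((zt - s) * h ^+ 2) (zt * h ^+ 2).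

Lemma div_bounds (y m nu al be : R) : 0 < al -> 0 < nu -> nu <= m -> m <= 1 ->
  al <= y * m <= be -> al <= y <= be / nu.
Proof.
move=> al0 nu0 num m1 /andP[h1 h2].
have m0 : 0 < m by exact: lt_le_trans num.
have y0 : 0 < y by rewrite -(pmulr_lgt0 _ m0); exact: lt_le_trans h1.
apply/andP; split; first by apply: (le_trans h1); rewrite ler_piMr// ltW.
by rewrite ler_pdivlMr//; apply: le_trans h2; rewrite ler_pM2l.
Qed.

Lemma abs_div_bounds (y m nu be : R) : 0 < nu -> nu <= m -> - (be * nu) <= y * m <= be * nu ->
  - be <= y <= be.
Proof.
move=> nu0 num hy; have m0 : 0 < m by exact: lt_le_trans num.
have : `|y * m| <= be * nu by rewrite ler_norml.
rewrite normrM (gtr0_norm m0) => h; rewrite -ler_norml -(ler_pM2r nu0).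
by apply: le_trans h; rewrite ler_wpM2l.
Qed.

(** The boundary points at [t] and [t ± h] span a triangle in [K]. Rolling places the outer two at
    height at least [sigma^2 / (2 * rho) * h^2], and the second-order bound keeps the slopes below
    [M / sigma * h]. *)
Lemma sbox_sub_K (K : set (plane R)) rho sigma M nu delta pt nn t h c d al be U :
  convex_set K -> 0 < rho -> 0 < sigma -> 0 < M -> 0 < nu -> frames K rho sigma M nu delta pt nn ->
  0 < h -> `|t| + h <= delta -> - U <= c -> d <= U -> M / sigma * U <= al -> be <= sigma ^+ 2 / (2 * rho) ->
  forall q, sbox (pt t) (nn t) (c * h) (d * h) (al * h ^+ 2) (be * h ^+ 2) q -> K q.
Proof.
move=> cK rho0 sg0 M0 nu0 [fr1 fr2 fr3] h0 th hc hd hU hbe q [/andP[q1 q2] /andP[q3 q4]].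
have h2 : 0 < h ^+ 2 by rewrite exprn_gt0.
have t0 : `|t| <= delta by apply: le_trans th; rewrite lerDl ltW.
have tp : `|t + h| <= delta.
  by apply: le_trans th; apply: le_trans (ler_normD _ _) _; rewrite (gtr0_norm h0).
have tm : `|t - h| <= delta.
  by apply: le_trans th; apply: le_trans (ler_normB _ _) _; rewrite (gtr0_norm h0).
have [n1 nun Kp roll] := fr1 t t0.
have [_ _ Kpp _] := fr1 _ tp; have [_ _ Kpm _] := fr1 _ tm.
have xp : sigma * h <= (pt (t + h)).1 - (pt t).1.
  by have := fr2 t (t + h) t0 tp; rewrite addrC addrK; apply; rewrite lerDr ltW.
have xm : sigma * h <= (pt t).1 - (pt (t - h)).1.
  by have := fr2 (t - h) t tm t0; rewrite subKr; apply; rewrite lerBlDr lerDl ltW.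
have ep := fr3 t (t + h) t0 tp; have em := fr3 t (t - h) t0 tm.
rewrite [t + h]addrC addrK [h + t]addrC in ep; rewrite addrAC subrr sub0r sqrrN in em.
have sh0 : 0 < sigma * h by rewrite mulr_gt0.
have depth w : K w -> (sigma * h) ^+ 2 <= (w.1 - (pt t).1) ^+ 2 ->
    sigma ^+ 2 / (2 * rho) * h ^+ 2 <= (w.1 - (pt t).1) * (nn t).1 + (w.2 - (pt t).2) * (nn t).2.
  move=> Kw hw; have := roll w Kw; rewrite /dist2 => hr.
  rewrite mulrAC ler_pdivrMr ?mulr_gt0// -exprMn [leRHS]mulrC; apply: le_trans hr.
  by apply: le_trans hw _; rewrite lerDl sqr_ge0.
apply: (@frame_triangle _ K (pt t) (nn t) (pt (t + h)) (pt (t - h)) q (M / sigma * h)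
  (sigma ^+ 2 / (2 * rho) * h ^+ 2)) => //.
- by rewrite gt_eqF// (lt_le_trans nu0).
- exact: lt_le_trans xp.
- by rewrite -oppr_gt0 opprB; exact: lt_le_trans xm.
- by rewrite mulr_gt0// divr_gt0 ?exprn_gt0// mulr_gt0.
- apply: depth => //; rewrite lerXn2r// ?nnegrE ?(ltW sh0)//.
  by rewrite (le_trans _ xp)// ltW.
- apply: depth => //; rewrite -(sqrrN (_ - _)) opprB lerXn2r// ?nnegrE ?(ltW sh0)//.
  by rewrite (le_trans _ xm)// ltW.
- apply: (le_trans ep); have -> : M * h ^+ 2 = M / sigma * h * (sigma * h).
    by field; rewrite gt_eqF.
  by rewrite ler_pM2l// mulr_gt0// divr_gt0.
- apply: (le_trans em); have -> : M * h ^+ 2 = M / sigma * h * (sigma * h).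
    by field; rewrite gt_eqF.
  by rewrite mulNr -mulrN opprB ler_pM2l// mulr_gt0// divr_gt0.
- have uq : `|q.1 - (pt t).1| <= U * h.
    rewrite ler_norml; apply/andP; split.
      by apply: le_trans q1; rewrite -mulNr ler_pM2r.
    by apply: (le_trans q2); rewrite ler_pM2r.
  apply: le_trans q3; apply: le_trans (_ : M / sigma * h * (U * h) <= _).
    by rewrite ler_pM2l// mulr_gt0// divr_gt0.
  have -> : M / sigma * h * (U * h) = M / sigma * U * h ^+ 2 by ring.
  by rewrite ler_pM2r.
- by apply: (le_trans q4); rewrite ler_pM2r.
Qed.

(** Below height [Z] the rolled disc has [x^2 <= 2 * rho * Z], hence [|x| <= 2 * rho * Z + 1]. The
    last [Z] in the bound for [B] pays for the shear. Points of [K] outside the cap are therefore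
    high, as [cover_far] requires. *)
Lemma capC_compl (K : set (plane R)) p n rho B Z h q : n.1 ^+ 2 + n.2 ^+ 2 = 1 -> 0 < rho ->
  (forall q, K q -> dist2 q p <= 2 * rho * ((q.1 - p.1) * n.1 + (q.2 - p.2) * n.2)) ->
  0 < h -> h <= 1 -> 0 <= Z -> 2 * rho * Z + 1 + Z <= B -> K q -> ~ capC B Z h p n q ->
  Z < ncoord p n h q.
Proof.
move=> n1 rho0 roll h0 h1 Z0 hB Kq Cq; rewrite ltNge; apply/negP => zZ; apply: Cq.
have := rolled_loc n1 h0 (roll q Kq).
set x := tcoord p n h q; set z := ncoord p n h q in zZ *.
have h2 : 0 < h ^+ 2 by rewrite exprn_gt0.
move=> hr; have hz2 : 0 <= h ^+ 2 * z ^+ 2 by rewrite mulr_ge0 ?sqr_ge0.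
have z0 : 0 <= z.
  have : 0 <= 2 * rho * z by have := sqr_ge0 x; lra.
  by rewrite pmulr_rge0// mulr_gt0.
have x2 : x ^+ 2 <= 2 * rho * Z.
  have : 2 * rho * z <= 2 * rho * Z by rewrite ler_pM2l// mulr_gt0.
  lra.
have [n1le n2le] := unit_normal_le1 n1.
have [n2le' _] := unit_normal_le1 (n := (n.2, n.1)) (etrans (addrC _ _) n1).
have hx : `|x| <= 2 * rho * Z + 1.
  have := sqr_ge0 (x - 1 / 2); have := sqr_ge0 (x + 1 / 2).
  by rewrite ler_norml => a1 a2; apply/andP; split; lra.
have hxn : `|x * n.2| <= 2 * rho * Z + 1.
  by rewrite normrM -[leRHS]mulr1; apply: ler_pM.
have hzn : `|h * (z * n.1)| <= Z.
  rewrite normrM (gtr0_norm h0) normrM (ger0_norm z0) -[leRHS]mul1r.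
  apply: ler_pM => //; first exact: ltW.
    by rewrite mulr_ge0.
  by rewrite -[leRHS]mulr1; apply: ler_pM.
have qE : q = loc p n h x z by rewrite locK.
have xiE : q.1 - p.1 = h * (x * n.2 + h * (z * n.1)) by rewrite qE /loc /=; ring.
have etE : (q.1 - p.1) * n.1 + (q.2 - p.2) * n.2 = z * h ^+ 2.
  by rewrite /z /ncoord mulfVK// gt_eqF.
split; last by rewrite etE !ler_pM2r ?z0.
rewrite mulNr -ler_norml xiE normrM (gtr0_norm h0) mulrC ler_pM2r//.
apply: (le_trans (ler_normD _ _)); apply: le_trans hB; exact: lerD.
Qed.

End CapBoxes.

Section OneCapTheorem.
Context (R : realType).

Definition cap_toggles (K C Pb Mb Ab Bb Q : set (plane R)) (r : R) : Prop :=
  forall (o : set (plane R)) a b, finite_set o -> Ab a -> Bb b -> o a -> o b ->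
    (forall q, o q -> [\/ q = a, q = b | K q /\ ~ C q]) ->
  (forall y, Mb y -> f0 r (y |` o) = f0 r o /\ r_hull r (y |` o) = r_hull r o) /\
  (forall y, Pb y -> f0 r (y |` o) = (f0 r o).+1 /\
    area (r_hull r o) + area Q <= area (r_hull r (y |` o))).

(** The constants are chosen in the order [a], [s], [ep], each small with respect to the earlier
    ones; [a <= 1] reduces the quadratic condition on [a] to a linear one. *)
Lemma cap_constants (C1 zt r nu : R) : 0 < C1 -> 0 < zt -> 0 < r -> 0 < nu -> nu <= 1 ->
  exists a s ep, [/\ [/\ 0 < a, 0 < s & 0 < ep], C1 * (4 * a) <= zt,
    64 * (3 * a / nu) ^+ 2 <= r * zt,
    16 * s <= zt /\ 16 * (r + 2) * s <= (a / 2) ^+ 2 &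
    [/\ 2 * ep <= a / 2, 8 * ep * zt <= a / 2 * s & ep * (nu * C1) <= 2 * s]].
Proof.
move=> C10 zt0 r0 nu0 nu1.
have pick (b c d : R) : 0 < b -> 0 < c -> 0 < d -> exists x : R, [/\ 0 < x, x <= b, x <= c & x <= d].
  by move=> b0 c0 d0; exists (Num.min b (Num.min c d)); rewrite !lt_min !ge_min b0 c0 d0 !lexx !orbT.
have k1 : 0 < zt / (4 * C1) by rewrite divr_gt0// mulr_gt0.
have k2 : 0 < r * zt * nu ^+ 2 / 9 / 64.
  by apply: divr_gt0 => //; apply: divr_gt0 => //; apply: mulr_gt0; [exact: mulr_gt0|exact: exprn_gt0].
have [a [a0 a1 a2 a3]] := pick _ _ _ ltr01 k1 k2.
have r2 : 0 < 64 * (r + 2) by rewrite mulr_gt0// addr_gt0.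
have k3 : 0 < zt / 16 by rewrite divr_gt0.
have k4 : 0 < a ^+ 2 / (64 * (r + 2)) by rewrite divr_gt0// exprn_gt0.
have [s [s0 s1 s2 _]] := pick _ _ _ k3 k4 ltr01.
have l0 : 0 < a / 2 by rewrite divr_gt0.
have k5 : 0 < a / 2 / 2 by rewrite divr_gt0.
have k6 : 0 < a / 2 * s / (8 * zt) by rewrite divr_gt0 ?mulr_gt0.
have k7 : 0 < 2 * s / (nu * C1) by rewrite divr_gt0 ?mulr_gt0.
have [ep [e0 e1 e2 e3]] := pick _ _ _ k5 k6 k7.
exists a, s, ep; split => //.
- by move: a2; rewrite ler_pdivlMr ?mulr_gt0//; lra.
- rewrite expr_div_n mulrA ler_pdivrMr ?exprn_gt0//.
  have h : a * a <= 1 * a by rewrite ler_pM2r.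
  move: a3; rewrite !ler_pdivlMr// => a3.
  have -> : 64 * (3 * a) ^+ 2 = 64 * 9 * (a * a) by ring.
  apply: le_trans a3; rewrite mul1r in h.
  by rewrite -mulrA [9 * _]mulrC mulrA ler_pM2r// mulrC ler_pM2r.
- split; first by lra.
  by move: s2; rewrite ler_pdivlMr// expr_div_n; lra.
- split; first by lra.
    by move: e2; rewrite ler_pdivlMr ?mulr_gt0//; lra.
  by rewrite -ler_pdivlMr// mulr_gt0.
Qed.

Theorem one_cap (K : set (plane R)) (rho r sigma M nu delta : R) (pt nn : R -> plane R) :
  convex_set K -> 0 < rho -> rho < r -> 0 < sigma -> 0 < M -> 0 < nu -> 0 < delta ->
  frames K rho sigma M nu delta pt nn ->
  exists a s u zt B Z h1 : R,
  [/\ [/\ 0 < a, 0 < s, 0 < u & u < a], [/\ 16 * s <= zt, zt <= Z, 2 * a <= B & 0 < h1] &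
  forall h t, 0 < h -> h < h1 -> `|t| + h <= delta ->
  let p := pt t in let n := nn t in
  [/\ forall q, low_box u s (2 * s) h p n q -> K q,
    forall q, low_box u (zt - s) zt h p n q -> K q,
    forall q, left_box a s zt h p n q -> K q,
    forall q, right_box a s zt h p n q -> K q &
    cap_toggles K (capC B Z h p n) (low_box u s (2 * s) h p n) (low_box u (zt - s) zt h p n)
      (left_box a s zt h p n) (right_box a s zt h p n)
      (low_box u (3 * s) (4 * s) h p n) r]].
Proof.
move=> cK rho0 rr sg0 M0 nu0 dl0 fr; have [fr1 _ _] := fr.
have r0 : 0 < r by exact: lt_trans rr.
have nu1 : nu <= 1.
  have [n1 h _ _] := fr1 0 (eq_ind_r (fun z => z <= delta) (ltW dl0) (normr0 R)).
  by apply: (le_trans h); exact: (unit_normal_le1 n1).2.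
pose C1 := M / sigma; pose zt := sigma ^+ 2 / (2 * rho).
have C10 : 0 < C1 by rewrite divr_gt0.
have zt0 : 0 < zt by rewrite divr_gt0 ?exprn_gt0// mulr_gt0.
have ztE : zt = sigma ^+ 2 / (2 * rho) by [].
have C1E : C1 = M / sigma by [].
clearbody C1 zt.
have [a [s [ep [[a0 s0 ep0] a2 rL [s1 rs] [ep1 ep2 ep3]]]]] := cap_constants C10 zt0 r0 nu0 nu1.
(* The side boxes have first coordinates between [a] and [2 * a] in absolute value; this leaves a
   margin for the shear and for the division by [n.2], which is between [nu] and 1. *)
pose l := a / 2; pose L := 3 * a / nu.
have l0 : 0 < l by rewrite divr_gt0.
have aL : 3 * a <= L by rewrite ler_pdivlMr// ler_piMr// mulr_ge0// ltW.
have lL : l <= L by apply: le_trans aL; rewrite /l; lra.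
have lE : l = a / 2 by [].
have LE : L = 3 * a / nu by [].
rewrite -/l -/L in rL rs ep1 ep2.
clearbody l L.
(* One half of [ep * nu] is the half-width of the low box, the other half is reserved for the shear;
   the bound [u / zt] on [h] below makes the shear that small. *)
pose u := ep * nu / 2.
have u0 : 0 < u by rewrite divr_gt0// mulr_gt0.
have uE : u + u = ep * nu by rewrite /u; field.
have uep : u + u <= ep by rewrite uE ler_piMr// ltW.
have ua : 4 * u < a by move: uep ep1 a0 lE; lra.
have uC : C1 * u <= s by move: ep3; rewrite /u; lra.
have [Z [e1 [hZ e10 toggle]]] := cap_toggle rho0 rr l0 lL rL s0 s1 rs ep0 ep1 ep2.
pose B := 2 * rho * Z + 1 + Z + 2 * a.
have Z0 : 0 <= Z by apply: le_trans hZ; exact: ltW.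
have rZ : 0 <= 2 * rho * Z by rewrite mulr_ge0// mulr_ge0// ltW.
exists a, s, u, zt, B, Z, (Num.min (Num.min 1 e1) (u / zt)); split.
- by split => //; move: ua u0; lra.
- split => //; first by rewrite /B; lra.
  by rewrite !lt_min ltr01 e10 divr_gt0.
move=> h t h0; rewrite !lt_min => /andP[/andP[hh1 hh2] hh3] th p n.
have hzt : h * zt <= u by rewrite -ler_pdivlMr// ltW.
have td : `|t| <= delta by apply: le_trans th; rewrite lerDl ltW.
have [n1 nun Kp roll] := fr1 t td.
have [_ n2le] := unit_normal_le1 n1.
have hle (b : R) : b <= zt -> h * b <= u by move=> hb; apply: le_trans hzt; rewrite ler_pM2l.
have inK := sbox_sub_K cK rho0 sg0 M0 nu0 fr h0 th.
split.
- move=> q; apply: (inK (- u) u s (2 * s) u) => //; rewrite -?ztE -?C1E//.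
  by clear - s1 s0; lra.
- move=> q; apply: (inK (- u) u (zt - s) zt u) => //; rewrite -?ztE -?C1E//.
  by move: uC s1 s0; lra.
- move=> q; apply: (inK (- (2 * a)) (- a) (zt - s) zt (2 * a)) => //; rewrite -?ztE -?C1E//.
    by clear - a0; lra.
  by clear - a2 s1 s0; lra.
- move=> q; apply: (inK a (2 * a) (zt - s) zt (2 * a)) => //; rewrite -?ztE -?C1E//.
    by clear - a0; lra.
  by clear - a2 s1 s0; lra.
move=> o pa pb fo Apa Bpb oa ob oK.
have small b b' q : 0 <= b -> b' <= zt -> low_box u b b' h p n q -> - ep <= tcoord p n h q <= ep.
  move=> b0 bz hq; apply: (abs_div_bounds nu0 nun).
  have := sbox_tcoord n1 h0 b0 (hle _ bz) hq.
  by rewrite -uE opprD.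
have e1h : h ^+ 2 < e1.
  by apply: le_lt_trans hh2; rewrite expr2 ler_piMl// ltW.
have zs0 : 0 <= zt - s by clear - s1 s0; lra.
have sa : shoulder l L zt s (- tcoord p n h pa) (ncoord p n h pa).
  split; last exact: sbox_ncoord h0 Apa.
  have := sbox_tcoord n1 h0 zs0 (hle _ (lexx zt)) Apa => /andP[x1 x2].
  have ha : a / 2 <= - tcoord p n h pa * n.2 <= 3 * a.
    by rewrite mulNr; clear - x1 x2 ua u0 a0; apply/andP; split; lra.
  by rewrite lE LE; apply: (div_bounds _ nu0 nun n2le ha); rewrite divr_gt0.
have sb : shoulder l L zt s (tcoord p n h pb) (ncoord p n h pb).
  split; last exact: sbox_ncoord h0 Bpb.
  have := sbox_tcoord n1 h0 zs0 (hle _ (lexx zt)) Bpb => /andP[x1 x2].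
  have ha : a / 2 <= tcoord p n h pb * n.2 <= 3 * a.
    by clear - x1 x2 ua u0 a0; apply/andP; split; lra.
  by rewrite lE LE; apply: (div_bounds _ nu0 nun n2le ha); rewrite divr_gt0.
have oK' q : o q -> [\/ q = pa, q = pb | K q /\ Z < ncoord p n h q].
  move=> oq; have [->|->|[Kq Cq]] := oK q oq; [by constructor 1|by constructor 2|].
  constructor 3; split => //; apply: (capC_compl n1 rho0 roll h0 (ltW hh1) Z0 _ Kq Cq).
  by rewrite /B lerDl mulr_ge0// ltW.
have [tm tp] := toggle h h0 e1h p n n1 K roll o pa pb oa ob fo oK' sa sb.
split => y hy.
  apply: tm; last exact: sbox_ncoord h0 hy.
  have /andP[y1 y2] := small _ _ _ zs0 (lexx zt) hy.
  by clear - y1 y2 ep1; apply/andP; split; lra.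
have s4 : 4 * s <= zt by clear - s1 s0; lra.
have s22 : 2 * s <= zt by clear - s1 s0; lra.
have [f0E areaE] := tp y (small _ _ _ (ltW s0) s22 hy) (sbox_ncoord h0 hy).
split => //; apply: areaE; first exact: measurable_sbox.
move=> q hq; split; last exact: sbox_ncoord h0 hq.
by apply: (small _ _ _ _ s4 hq); rewrite mulr_ge0// ltW.
Qed.

End OneCapTheorem.

(** * Variance bound from disjoint caps *)

Section CapVariance.
Context (R : realType).

Lemma power_lb (c : R) n : 0 <= c -> 2 * c <= n%:R -> (0 < n)%N -> expR (- (2 * c)) <= (1 - c / n%:R) ^+ n.
Proof.
move=> c0 cn n0; have nR : 0 < n%:R :> R by rewrite ltr0n.
pose x := c / n%:R.
have x0 : 0 <= x by rewrite divr_ge0// ltW.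
have x1 : 2 * x <= 1 by rewrite /x mulrA ler_pdivrMr// mul1r.
have h : expR (- (2 * x)) <= 1 - x.
  rewrite expRN -[leRHS]invrK lef_pV2 ?posrE ?expR_gt0 ?invr_gt0//; last by lra.
  apply: le_trans (expR_ge1Dx _); rewrite -[leLHS]mul1r ler_pdivrMr; last by lra.
  by have := mulr_ge0 x0 (_ : 0 <= 1 - 2 * x); rewrite subr_ge0 => /(_ x1); lra.
have -> : - (2 * c) = n%:R * - (2 * x) by rewrite /x; field; rewrite gt_eqF.
rewrite expRM_natl lerXn2r// nnegrE ?expR_ge0//.
by rewrite -/x; lra.
Qed.

Lemma area_le (A B : set (mplane R)) (b : R) : measurable A -> measurable B -> A `<=` B ->
  lebesgue2 B = b%:E -> area A <= b.
Proof.
move=> mA mB AB Bb; have h : (lebesgue2 A <= b%:E)%E.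
  by rewrite -Bb; apply: (@le_measure _ _ _ (@mlebesgue2 R)); rewrite ?inE.
have fA : lebesgue2 A \is a fin_num by rewrite ge0_fin_numE ?measure_ge0// (le_lt_trans h)// ltry.
by rewrite /area -lee_fin fineK.
Qed.

Lemma area_setD (K C : set (mplane R)) (c : R) : measurable K -> measurable C -> 0 < area K ->
  lebesgue2 C = c%:E -> 1 - c / area K <= area (K `\` C) / area K.
Proof.
move=> mK mC K0 Cc; have fK : lebesgue2 K \is a fin_num.
  by move: K0; rewrite /area; case: (lebesgue2 K) => //=; rewrite ltxx.
have mKC : measurable (K `&` C) by exact: measurableI.
have KC : area (K `&` C) <= c by apply: (@area_le _ C) => // q [].
have fKC : lebesgue2 (K `&` C) \is a fin_num.
  have h : (lebesgue2 (K `&` C) <= lebesgue2 K)%E.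
    by apply: (@le_measure _ _ _ (@mlebesgue2 R)); rewrite ?inE// => q [].
  rewrite ge0_fin_numE; last exact: (@measure_ge0 _ _ _ (@mlebesgue2 R)).
  by rewrite (le_lt_trans h)// -ge0_fin_numE//; exact: (@measure_ge0 _ _ _ (@mlebesgue2 R)).
have -> : area (K `\` C) = area K - area (K `&` C).
  rewrite /area -fineB//; congr fine.
  apply: (@measureD _ _ _ (@mlebesgue2 R)) => //.
  rewrite -ge0_fin_numE//; exact: (@measure_ge0 _ _ _ (@mlebesgue2 R)).
by rewrite -{1}(divff (lt0r_neq0 K0)) -mulrBl ler_pM2r ?invr_gt0// lerB.
Qed.

(** The powers of [h] in [toggles_variance]: [-1] from the caps, [-9] from the triples, [18] from
    the squared probabilities, [-9] from the denominator. *)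
Lemma toggle_total (N n3 n h g q E L H mu : R) : 0 < h -> h ^+ 3 * n = 1 -> 0 <= L -> 0 < H ->
  0 < mu -> mu / h <= N -> n ^+ 3 / 4 <= n3 -> 0 <= E -> E <= q ->
  mu / 4 * L ^+ 6 * E ^+ 2 / (2 * H ^+ 3) * h^-1 * g ^+ 2 <=
  N * n3 * (g * ((L * h ^+ 3) ^+ 3 * q)) ^+ 2 / (2 * (H * h ^+ 3) ^+ 3).
Proof.
move=> h0 hn L0 H0 mu0 hN hn3 E0 Eq.
move: hn3; rewrite (_ : n = (h ^+ 3)^-1); last first.
  by apply: (mulfI (lt0r_neq0 (exprn_gt0 3 h0))); rewrite hn divff// gt_eqF// exprn_gt0.
move=> hn3.
have n3h : 1 / 4 <= n3 * h ^+ 9.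
  rewrite -ler_pdivrMr ?exprn_gt0//; apply: le_trans hn3.
  by rewrite le_eqVlt; apply/orP; left; apply/eqP; field; rewrite gt_eqF.
have Nn3 : mu / h * (1 / 4) <= N * (n3 * h ^+ 9).
  by rewrite ler_pM// ?divr_ge0 ?(ltW mu0) ?(ltW h0)//.
have Eq2 : E ^+ 2 <= q ^+ 2 by rewrite lerXn2r// nnegrE ?(le_trans E0 Eq).
have -> : N * n3 * (g * ((L * h ^+ 3) ^+ 3 * q)) ^+ 2 / (2 * (H * h ^+ 3) ^+ 3) =
   N * (n3 * h ^+ 9) * q ^+ 2 * (L ^+ 6 * g ^+ 2 / (2 * H ^+ 3)).
  by field; rewrite ?(gt_eqF H0) ?(gt_eqF h0).
have -> : mu / 4 * L ^+ 6 * E ^+ 2 / (2 * H ^+ 3) * h^-1 * g ^+ 2 =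
   mu / h * (1 / 4) * E ^+ 2 * (L ^+ 6 * g ^+ 2 / (2 * H ^+ 3)).
  by field; rewrite ?(gt_eqF H0) ?(gt_eqF h0).
apply: ler_wpM2r.
  apply: divr_ge0; first by apply: mulr_ge0; [exact: exprn_ge0|exact: sqr_ge0].
  by apply: mulr_ge0 => //; apply: exprn_ge0; exact: ltW.
by rewrite ler_pM// ?sqr_ge0// mulr_ge0// divr_ge0 ?(ltW h0) ?(ltW mu0).
Qed.

Lemma cubic_count (n : nat) : (4 <= n)%N ->
  n%:R ^+ 3 / 4 <= n%:R * (n.-1%:R * n.-2%:R) :> R.
Proof.
case: n => [|[|[|[|n]]]]//= _.
have n0 : 0 <= n%:R :> R by exact: ler0n.
have e k : (k + n)%N%:R = n%:R + k%:R :> R by rewrite natrD addrC.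
rewrite -[n.+4]/(4 + n)%N -[n.+3]/(3 + n)%N -[n.+2]/(2 + n)%N !e.
have n02 := mulr_ge0 n0 n0; have n03 := mulr_ge0 n02 n0.
rewrite -subr_ge0 (_ : _ - _ = 3 / 4 * (n%:R * n%:R * n%:R) + 6 * (n%:R * n%:R) + 14 * n%:R + 8); last by field.
by lra.
Qed.

End CapVariance.

Section CapFamily.
Context (R : realType) (K : set (plane R)) (rho sigma M nu delta : R) (pt nn : R -> plane R).
Hypotheses (sigma0 : 0 < sigma) (nu0 : 0 < nu) (delta0 : 0 < delta).
Hypothesis fr : frames K rho sigma M nu delta pt nn.
Variables a s u zt B Z : R.
Hypotheses (a0 : 0 < a) (s0 : 0 < s) (u0 : 0 < u) (ua : u < a).
Hypotheses (szt : 16 * s <= zt) (ztZ : zt <= Z) (aB : 2 * a <= B).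
Hypotheses (mK : measurable (K : set (mplane R))) (K0 : 0 < area K).

Lemma sbox_meet (p n q : plane R) (c d e f c' d' e' f' : R) :
  sbox p n c d e f q -> sbox p n c' d' e' f' q -> [/\ c <= d', c' <= d, e <= f' & e' <= f].
Proof.
move=> [/andP[h1 h2] /andP[h3 h4]] [/andP[h5 h6] /andP[h7 h8]].
by split; [exact: le_trans h1 h6|exact: le_trans h5 h2|exact: le_trans h3 h8|exact: le_trans h7 h4].
Qed.

Lemma sbox_sub (p n : plane R) (h c d e f c' d' e' f' : R) : 0 < h ->
  c' <= c -> d <= d' -> e' <= e -> f <= f' ->
  sbox p n (c * h) (d * h) (e * h ^+ 2) (f * h ^+ 2) `<=`
  sbox p n (c' * h) (d' * h) (e' * h ^+ 2) (f' * h ^+ 2).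
Proof.
move=> h0 cc dd ee ff q [/andP[h1 h2] /andP[h3 h4]]; split; apply/andP; split.
- by apply: le_trans h1; rewrite ler_pM2r.
- by apply: (le_trans h2); rewrite ler_pM2r.
- by apply: le_trans h3; rewrite ler_pM2r// exprn_gt0.
- by apply: (le_trans h4); rewrite ler_pM2r// exprn_gt0.
Qed.

Definition toggled_by (C Pb Mb Ab Bb : set (plane R)) (Phi : set (mplane R) -> R) (g : R) :=
  forall o p q, finite_set o -> Ab p -> Bb q -> o p -> o q ->
    (forall x, o x -> [\/ x = p, x = q | K x /\ ~ C x]) ->
    (forall y, Mb y -> Phi (y |` o) = Phi o) /\ (forall y, Pb y -> Phi o + g <= Phi (y |` o)).

Section Bound.
Context (h : R) (n : nat) (h0 : 0 < h) (hn : h ^+ 3 * n%:R = 1) (n4 : (4 <= n)%N).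

(* Consecutive caps, [pitch * h] apart in the parameter, have disjoint projections
   on the first axis, and a cap has probability at most [cap_mass * h ^+ 3]. *)
Definition pitch : R := (2 * B + 1) / sigma.
Definition cap_mass : R := 2 * B * Z / (nu * area K).

Hypotheses (h_delta : h <= delta / 2) (h_pitch : h <= delta / (4 * pitch)).
Hypothesis n_mass : 2 * cap_mass <= n%:R.
Hypothesis boxes : forall t : R, `|t| + h <= delta ->
  [/\ low_box u s (2 * s) h (pt t) (nn t) `<=` K, low_box u (zt - s) zt h (pt t) (nn t) `<=` K,
      left_box a s zt h (pt t) (nn t) `<=` K & right_box a s zt h (pt t) (nn t) `<=` K].

Context d (T : measurableType d) (P : probability T R) (X : 'I_n -> {RV P >-> mplane R}).
Hypotheses (indX : independent X) (unifX : forall i, uniform_on K (X i)).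
Variables (Phi : set (mplane R) -> R) (g : R).
Hypotheses (g0 : 0 <= g) (rPhi : regular (fun x => Phi [set x m | m in [set: 'I_n]])).
Hypothesis toggled : forall t : R, `|t| + h <= delta ->
  toggled_by (capC B Z h (pt t) (nn t)) (low_box u s (2 * s) h (pt t) (nn t))
    (low_box u (zt - s) zt h (pt t) (nn t)) (left_box a s zt h (pt t) (nn t))
    (right_box a s zt h (pt t) (nn t)) Phi g.

(** The parameters [tt i] fill only [[0, delta / 2]], which leaves room for the neighbours at
    distance [h] used in [sbox_sub_K]. *)
Let N := Num.trunc (delta / (2 * pitch * h)).
Let tt (i : 'I_N) : R := i%:R * pitch * h.

Let B0 : 0 < B. Proof. by have := a0; have := aB; lra. Qed.

Let pitch0 : 0 < pitch. Proof. by rewrite divr_gt0//; have := B0; lra. Qed.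

Let tt_delta i : `|tt i| + h <= delta.
Proof.
have tt0 : 0 <= tt i by rewrite mulr_ge0 ?(ltW h0)// mulr_ge0 ?(ltW pitch0).
have q0 : 0 < 2 * pitch * h by rewrite mulr_gt0// mulr_gt0.
have iN : i%:R <= delta / (2 * pitch * h).
  apply: (@le_trans _ _ N%:R); first by rewrite ler_nat ltnW.
  by have /andP[] := @truncn_itv _ (delta / (2 * pitch * h)) (divr_ge0 (ltW delta0) (ltW q0)).
have h2 := h_delta; rewrite ger0_norm//.
suff : tt i <= delta / 2 by lra.
by move: iN; rewrite ler_pdivlMr// /tt; lra.
Qed.

Let cap_count : delta / (4 * pitch) / h <= N%:R.
Proof.
have q0 : 0 < 2 * pitch * h by rewrite mulr_gt0// mulr_gt0.
have /andP[_] := @truncn_itv _ (delta / (2 * pitch * h)) (divr_ge0 (ltW delta0) (ltW q0)).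
rewrite -/N -natr1.
have -> : delta / (2 * pitch * h) = 2 * (delta / (4 * pitch) / h).
  by field; rewrite !gt_eqF.
have : 1 <= delta / (4 * pitch) / h by rewrite ler_pdivlMr// mul1r.
by lra.
Qed.

Let caps_disjoint i i' q : capC B Z h (pt (tt i)) (nn (tt i)) q ->
  capC B Z h (pt (tt i')) (nn (tt i')) q -> i = i'.
Proof.
wlog ii' : i i' / (i <= i')%N.
  by move=> W; case: (leqP i i') => [/W//|/ltnW/W W' /W' h1 /h1 ->].
move: ii'; rewrite leq_eqVlt => /orP[/eqP/val_inj->//|ii'].
move=> [/andP[_ h1] _] [/andP[h2 _] _]; exfalso.
have [_ mono _] := fr.
have ph : 0 < pitch * h by rewrite mulr_gt0.
have dt : pitch * h <= tt i' - tt i.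
  rewrite /tt -mulrA -mulrA -mulrBl -[leLHS]mul1r ler_pM2r//.
  by rewrite lerBrDl natr1 ler_nat.
have di := tt_delta i; have di' := tt_delta i'; have h0' := h0.
have m1 : sigma * (tt i' - tt i) <= (pt (tt i')).1 - (pt (tt i)).1.
  apply: mono; last by rewrite -subr_ge0; apply: le_trans dt; exact: ltW.
    by apply: le_trans di; rewrite lerDl ltW.
  by apply: le_trans di'; rewrite lerDl ltW.
have m2 : (2 * B + 1) * h <= sigma * (tt i' - tt i).
  apply: le_trans (_ : sigma * (pitch * h) <= _); last by rewrite ler_pM2l.
  by rewrite /pitch mulrA mulrC [sigma * _]mulrC divfK ?gt_eqF// mulrC.
by lra.
Qed.

Let law (D : set (mplane R)) : R := area (K `&` D) / area K.

Let law_sub D : D `<=` K -> law D = area D / area K.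
Proof. by move=> DK; rewrite /law setIC (setIidl DK). Qed.

Let normal i : nu <= (nn (tt i)).2 /\ (nn (tt i)).2 <= 1.
Proof.
have [fr1 _ _] := fr; have h0' := h0; have di := tt_delta i.
have tid : `|tt i| <= delta by apply: le_trans di; rewrite lerDl ltW.
have [nn1 nn2 _ _] := fr1 (tt i) tid.
by split => //; have [_] := unit_normal_le1 nn1.
Qed.

Let hc3 (x m : R) : x * h * (s * h ^+ 2 / m) = x * s / m * h ^+ 3.
Proof. by rewrite !exprS expr0; ring. Qed.

Let law_box i c d' e f : d' - c = a \/ d' - c = 2 * u -> f - e = s ->
  sbox (pt (tt i)) (nn (tt i)) (c * h) (d' * h) (e * h ^+ 2) (f * h ^+ 2) `<=` K ->
  u * s / area K * h ^+ 3 <=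
  law (sbox (pt (tt i)) (nn (tt i)) (c * h) (d' * h) (e * h ^+ 2) (f * h ^+ 2)) <=
  2 * a * s / (nu * area K) * h ^+ 3.
Proof.
move=> w fe /law_sub ->; have [n1 n2] := normal i.
have n0 := lt_le_trans nu0 n1.
have [a0' u0' ua'] := And3 a0 u0 ua.
have [w1 w2] : u <= d' - c /\ d' - c <= 2 * a by case: w => ->; split; lra.
have s0' := s0; have h20 := exprn_gt0 2 h0.
rewrite area_sbox//; last 2 first.
- by rewrite ler_pM2r//; lra.
- by rewrite ler_pM2r//; lra.
rewrite -!mulrBl fe hc3.
have -> : u * s / area K * h ^+ 3 = u * (s / area K * h ^+ 3) by ring.
have -> : 2 * a * s / (nu * area K) * h ^+ 3 = (2 * a / nu) * (s / area K * h ^+ 3).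
  by field; rewrite !gt_eqF.
have -> : (d' - c) * s / (nn (tt i)).2 * h ^+ 3 / area K =
    ((d' - c) / (nn (tt i)).2) * (s / area K * h ^+ 3) by field; rewrite !gt_eqF.
have sK : 0 <= s / area K * h ^+ 3 by rewrite mulr_ge0 ?exprn_ge0 ?(ltW h0)// divr_ge0 ?ltW.
rewrite !ler_wpM2r//; last 2 first.
- by rewrite ler_pM// ?lef_pV2//; [lra|rewrite invr_ge0 ltW].
- rewrite ler_pdivlMr//; apply: le_trans w1; rewrite ler_piMr// ltW//.
Qed.

Let law_cap i : 1 - cap_mass / n%:R <= law (K `\` capC B Z h (pt (tt i)) (nn (tt i))).
Proof.
have [n1 n2] := normal i; have n0 := lt_le_trans nu0 n1; have B0' := B0.
have Z0 : 0 <= Z by have := s0; have := szt; have := ztZ; lra.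
have -> : law (K `\` capC B Z h (pt (tt i)) (nn (tt i))) =
    area (K `\` capC B Z h (pt (tt i)) (nn (tt i))) / area K.
  by apply: law_sub => q [].
apply: le_trans (area_setD mK (measurable_sbox _ _ _ _ _ _) K0 (lebesgue2_sbox _ n0 _ _)); last 2 first.
- by rewrite ler_pM2r//; lra.
- by rewrite ler_wpM2r// exprn_ge0// ltW.
rewrite lerD2l lerN2 (_ : n%:R^-1 = h ^+ 3); last first.
  by apply: (mulIf (x := n%:R)); rewrite ?hn ?mulVf// pnatr_eq0 -lt0n (leq_trans _ n4).
have -> : (B * h - - B * h) * ((Z * h ^+ 2 - 0 * h ^+ 2) / (nn (tt i)).2) / area K =
    2 * B * Z * h ^+ 3 / area K * (nn (tt i)).2^-1.
  by rewrite !exprS expr0; ring.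
have -> : cap_mass * h ^+ 3 = 2 * B * Z * h ^+ 3 / area K * nu^-1.
  by rewrite /cap_mass; field; rewrite !gt_eqF.
apply: ler_wpM2l; last by rewrite lef_pV2.
by rewrite divr_ge0 ?(ltW K0)// mulr_ge0 ?exprn_ge0 ?(ltW h0)// mulr_ge0// mulr_ge0 ?(ltW B0').
Qed.

Let lawX m (D : set (mplane R)) : measurable D -> P (X m @^-1` D) = (law D)%:E.
Proof. by move=> mD; have := unifX m mD; rewrite /distribution. Qed.

(** The constant of [toggle_total]: the sixth power and the cube come from the lower and upper
    bounds on the box probabilities, and the exponential bounds the probability that all other
    points avoid a cap. *)
Definition variance_const : R := delta / (4 * pitch) / 4 * (u * s / area K) ^+ 6 *
  expR (- (2 * cap_mass)) ^+ 2 / (2 * (2 * a * s / (nu * area K)) ^+ 3).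

Lemma caps_variance : ((variance_const * h^-1 * g ^+ 2)%:E <= 'V_P[fun w => Phi (sample X w)])%E.
Proof.
pose C (i : 'I_N) := capC B Z h (pt (tt i)) (nn (tt i)).
pose Rp (i : 'I_N) := low_box u s (2 * s) h (pt (tt i)) (nn (tt i)).
pose Rm (i : 'I_N) := low_box u (zt - s) zt h (pt (tt i)) (nn (tt i)).
pose Ra (i : 'I_N) := left_box a s zt h (pt (tt i)) (nn (tt i)).
pose Rb (i : 'I_N) := right_box a s zt h (pt (tt i)) (nn (tt i)).
have [a0' u0' ua' s0'] := And4 a0 u0 ua s0.
have [szt' ztZ' aB'] := And3 szt ztZ aB.
have bx i := boxes (tt_delta i).
have pC i q : Rp i q -> C i q by apply: sbox_sub => //; lra.
have mC i q : Rm i q -> C i q by apply: sbox_sub => //; lra.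
have aC i q : Ra i q -> C i q by apply: sbox_sub => //; lra.
have bC i q : Rb i q -> C i q by apply: sbox_sub => //; lra.
have sep1 (x y : R) : x < y -> y * h <= x * h -> False.
  by move=> xy; rewrite ler_pM2r// leNgt xy.
have sep2 (x y : R) : x < y -> y * h ^+ 2 <= x * h ^+ 2 -> False.
  by move=> xy; rewrite ler_pM2r ?exprn_gt0// leNgt xy.
have dab i q : Ra i q -> Rb i q -> False.
  by move=> A1 A2; have [_ e _ _] := sbox_meet A1 A2; apply: sep1 e; lra.
have dpa i q : Rp i q -> Ra i q -> False.
  by move=> A1 A2; have [e _ _ _] := sbox_meet A1 A2; apply: sep1 e; lra.
have dpb i q : Rp i q -> Rb i q -> False.
  by move=> A1 A2; have [_ e _ _] := sbox_meet A1 A2; apply: sep1 e; lra.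
have dma i q : Rm i q -> Ra i q -> False.
  by move=> A1 A2; have [e _ _ _] := sbox_meet A1 A2; apply: sep1 e; lra.
have dmb i q : Rm i q -> Rb i q -> False.
  by move=> A1 A2; have [_ e _ _] := sbox_meet A1 A2; apply: sep1 e; lra.
have dpm i q : Rp i q -> Rm i q -> False.
  by move=> A1 A2; have [_ _ _ e] := sbox_meet A1 A2; apply: sep2 e; lra.
have n0 : (0 < n)%N by exact: leq_trans n4.
have lpm i : law (Rp i) = law (Rm i).
  have [b1 b2 _ _] := bx i; have [n1 _] := normal i; have n20 := lt_le_trans nu0 n1.
  rewrite !law_sub// !area_sbox//; last 4 first.
  - by rewrite ler_pM2r//; lra.
  - by rewrite ler_pM2r ?exprn_gt0//; lra.
  - by rewrite ler_pM2r//; lra.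
  - by rewrite ler_pM2r ?exprn_gt0//; lra.
  by congr (_ * (_ / _) / _); ring.
have cfg i o y : cap_config K C Ra Rb i o ->
    (Rm i y -> Phi (y |` o) = Phi o) /\ (Rp i y -> Phi o + g <= Phi (y |` o)).
  move=> [fo [p [q [Ap Bq op oq oC]]]].
  by have [h1 h2] := toggled (tt_delta i) fo Ap Bq op oq oC; split; [exact: h1|exact: h2].
have cap_mass0 : 0 <= cap_mass.
  by rewrite /cap_mass divr_ge0 ?mulr_ge0 ?(ltW nu0) ?(ltW K0) ?(ltW B0)//; lra.
have q0 : 0 <= 1 - cap_mass / n%:R.
  rewrite subr_ge0 ler_pdivrMr ?ltr0n// mul1r; apply: le_trans n_mass.
  by have := cap_mass0; lra.
have L0 : 0 <= u * s / area K by rewrite divr_ge0 ?mulr_ge0 ?ltW.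
have H0 : 0 < 2 * a * s / (nu * area K) by rewrite divr_gt0 ?mulr_gt0.
have h30 : 0 < h ^+ 3 by exact: exprn_gt0.
apply: le_trans (@toggles_variance _ _ _ _ _ _ indX law lawX _ _ C Rp Rm Ra Rb mK
  (fun i => measurable_sbox _ _ _ _ _ _) (fun i => measurable_sbox _ _ _ _ _ _)
  (fun i => measurable_sbox _ _ _ _ _ _) (fun i => measurable_sbox _ _ _ _ _ _)
  (fun i => measurable_sbox _ _ _ _ _ _) caps_disjoint _ _ aC bC dab dpa dpb dma dmb dpm lpm
  Phi g rPhi g0 _ _ (u * s / area K * h ^+ 3) (2 * a * s / (nu * area K) * h ^+ 3)
  (1 - cap_mass / n%:R) _ _ q0 _ _ _ law_cap).
- rewrite lee_fin card_ord card_valid; last exact: leq_trans n4.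
  apply: (toggle_total (n := n%:R)) => //.
  + apply: divr_gt0 => //; apply: mulr_gt0 => //; exact: pitch0.
  + exact: cubic_count.
  + exact: power_lb.
- by move=> i q Rq; split; [have [bi _ _ _] := bx i; exact: bi|exact: pC].
- by move=> i q Rq; split; [have [_ bi _ _] := bx i; exact: bi|exact: mC].
- by move=> i o y co; have [c1 _] := cfg i o y co.
- by move=> i o y co; have [_ c1] := cfg i o y co.
- by rewrite mulr_ge0// ltW.
- by rewrite mulr_gt0.
- move=> i; have [bi _ _ _] := bx i; apply: law_box bi; first by right; ring.
  by ring.
- move=> i; have [_ _ bi _] := bx i; apply: law_box bi; first by left; ring.
  by ring.
- move=> i; have [_ _ _ bi] := bx i; apply: law_box bi; first by left; ring.
  by ring.
Qed.

End Bound.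
End CapFamily.

Section Scale.
Context (R : realType).

Lemma area_ge0 (A : set (plane R)) : 0 <= area A.
Proof. by apply: fine_ge0; exact: (@measure_ge0 _ _ _ (@mlebesgue2 R)). Qed.

Lemma uniform_area_gt0 (K : set (plane R)) d (T : measurableType d) (P : probability T R)
  (Y : {RV P >-> mplane R}) : uniform_on K Y -> 0 < area K.
Proof.
move=> /(_ setT measurableT); rewrite probability_setT => -[h].
rewrite lt_neqAle area_ge0 andbT; apply/eqP => K0.
by move: h => /eqP; rewrite -K0 invr0 mulr0 oner_eq0.
Qed.

Lemma scale_cube (n : nat) : (0 < n)%N -> (n%:R `^ (- (1 / 3))) ^+ 3 * n%:R = 1 :> R.
Proof.
move=> n0; have nR : 0 < n%:R :> R by rewrite ltr0n.
rewrite -powR_mulrn ?powR_ge0// -powRrM.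
have -> : - (1 / 3) * 3%:R = - 1 :> R by field.
by rewrite powRN powRr1 ?ltW// mulVf// gt_eqF.
Qed.

Lemma scale_inv (n : nat) : n%:R `^ (1 / 3) = (n%:R `^ (- (1 / 3)))^-1 :> R.
Proof. by rewrite powRN invrK. Qed.

Lemma scale_pow5 (n : nat) : n%:R `^ (- (5 / 3)) = (n%:R `^ (- (1 / 3))) ^+ 5 :> R.
Proof. by rewrite -powR_mulrn ?powR_ge0// -powRrM; congr (_ `^ _); field. Qed.

Lemma scale_small (h2 : R) (n : nat) : 0 < h2 -> (0 < n)%N -> (Num.bound (h2 ^+ 3)^-1 <= n)%N ->
  n%:R `^ (- (1 / 3)) <= h2.
Proof.
move=> h20 n0 hn; rewrite leNgt; apply/negP => lth.
have nR : 0 < n%:R :> R by rewrite ltr0n.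
have h3 : 0 < h2 ^+ 3 by exact: exprn_gt0.
have b : (h2 ^+ 3)^-1 < n%:R.
  apply: (@lt_le_trans _ _ (Num.bound (h2 ^+ 3)^-1)%:R); last by rewrite ler_nat.
  by apply: archi_boundP; rewrite invr_ge0 ltW.
have : h2 ^+ 3 * n%:R < 1.
  by rewrite -[ltRHS](scale_cube n0) ltr_pM2r// ltrXn2r// ?nnegrE ?powR_ge0// ltW.
by rewrite ltNge => /negP; apply; apply: ltW; rewrite -ltr_pdivrMl// mulr1.
Qed.

End Scale.

Theorem theorem1 (R : realType) (K : set (plane R)) (kappa_m r : R)
    (hK : convex_disc K) (hbd : class_C2plus K)
    (hkappa : is_min_curvature K kappa_m) (hr : kappa_m^-1 < r) :
  exists (gamma : R) (n0 : nat), 0 < gamma /\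
    forall n : nat, (n0 <= n)%N ->
    forall (d : measure_display) (T : measurableType d) (P : probability T R)
      (X : 'I_n -> {RV P >-> mplane R}),
      independent X -> (forall i, uniform_on K (X i)) ->
      ((gamma * n%:R `^ (1 / 3))%:E <=
         'V_P[(fun w => (f0 r (sample X w))%:R : R)])%E /\
      ((gamma * n%:R `^ (- (5 / 3)))%:E <=
         'V_P[(fun w => area (r_hull r (sample X w)))])%E.
Proof.
have [cK vK _] := hK; have mK := compact_measurable_plane cK.
have [K0|K0] := ltP 0 (area K); last first.
  (* With area zero there is no uniformly distributed point, so the claim is vacuous as soon as [n]
     is at least 1. *)
  exists 1, 1%N; split => // n n0 d T P X _ unifX; exfalso.
  by have := uniform_area_gt0 (unifX (Ordinal n0)); rewrite ltNge K0.
have [rho [sigma [M [nu [delta [pt [nn [rho0 rhor [sigma0 M0 nu0 delta0 fr]]]]]]]]] :=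
  convex_disc_frames hK hbd hkappa hr.
have r0 : 0 < r := lt_trans rho0 rhor.
have [a [s [u [zt [B [Z [h1 [[a0 s0 u0 ua] [szt ztZ aB h10] cap]]]]]]]] :=
  one_cap vK rho0 rhor sigma0 M0 nu0 delta0 fr.
have B0 : 0 < B by lra.
have Z0 : 0 < Z by lra.
have p0 : 0 < pitch sigma B by rewrite divr_gt0//; lra.
pose h2 := Num.min (h1 / 2) (Num.min (delta / 2) (delta / (4 * pitch sigma B))).
have h20 : 0 < h2.
  rewrite !lt_min; apply/and3P; split; first by rewrite divr_gt0.
    by rewrite divr_gt0.
  by apply: divr_gt0 => //; apply: mulr_gt0.
pose V := variance_const K sigma nu delta a s u B Z.
have V0 : 0 < V.
  apply: divr_gt0; last by rewrite mulr_gt0// exprn_gt0// divr_gt0 ?mulr_gt0.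
  rewrite mulr_gt0 ?exprn_gt0 ?expR_gt0// mulr_gt0//; last by rewrite exprn_gt0// divr_gt0// mulr_gt0.
  by apply: divr_gt0 => //; apply: divr_gt0 => //; apply: mulr_gt0.
(* The gained region has area [2 * u * s * h^3 / n.2], and [n.2] is at most 1. *)
pose c := 2 * u * s.
have c0 : 0 < c by rewrite mulr_gt0// mulr_gt0.
exists (Num.min V (V * c ^+ 2)),
  (maxn 4 (maxn (Num.bound (2 * cap_mass K nu B Z)) (Num.bound (h2 ^+ 3)^-1))).
split; first by rewrite lt_min V0 mulr_gt0// exprn_gt0.
move=> n; rewrite !geq_max => /and3P[n4 n5 n6] d T P X indX unifX.
have n0 : (0 < n)%N by exact: leq_trans n4.
have := scale_small h20 n0 n6; rewrite scale_inv scale_pow5; have := scale_cube R n0.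
have : 0 < n%:R `^ (- (1 / 3)) :> R by rewrite powR_gt0// ltr0n.
(* From here on [h] is known only through [h^3 * n = 1] and its upper bounds. *)
move: (n%:R `^ (- (1 / 3))) => h h0 hn; rewrite !le_min => /and3P[hh1 hh2 hh3].
have hlt : h < h1 by apply: le_lt_trans hh1 _; rewrite ltr_pdivrMr// ltr_pMr// ltr1n.
have cap_mass0 : 0 <= 2 * cap_mass K nu B Z.
  apply: mulr_ge0 => //; apply: divr_ge0; last by rewrite mulr_ge0 ?ltW.
  by rewrite !mulr_ge0 ?(ltW B0) ?(ltW Z0).
have n_mass : 2 * cap_mass K nu B Z <= n%:R.
  by apply: le_trans (ltW (archi_boundP cap_mass0)) _; rewrite ler_nat.
have boxes (t : R) : `|t| + h <= delta ->
    [/\ low_box u s (2 * s) h (pt t) (nn t) `<=` K, low_box u (zt - s) zt h (pt t) (nn t) `<=` K,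
      left_box a s zt h (pt t) (nn t) `<=` K & right_box a s zt h (pt t) (nn t) `<=` K].
  by move=> th; have [b1 b2 b3 b4 _] := cap h t h0 hlt th.
have caps Phi g := @caps_variance _ _ _ _ _ _ _ _ _ sigma0 nu0 delta0 fr _ _ _ _ _ _ a0 s0 u0 ua
  szt ztZ aB mK K0 _ _ h0 hn n4 hh2 hh3 n_mass boxes _ _ _ _ indX unifX Phi g.
have iv0 : 0 <= h^-1 by rewrite invr_ge0 ltW.
split.
- have := caps (fun o => (f0 r o)%:R) 1 ler01 (regular_f0 n r0).
  rewrite expr1n mulr1 => W; apply: le_trans (W _).
    by rewrite lee_fin ler_wpM2r// ge_min lexx.
  move=> t th o p q fo Ap Bq op oq oC.
  have [_ _ _ _ cp] := cap h t h0 hlt th.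
  have [c1 c2] := cp o p q fo Ap Bq op oq oC; split => y My.
    by have [-> _] := c1 y My.
  by have [-> _] := c2 y My; rewrite natr1.
(* A gain of [c * h^3] turns [V * h^-1 * g^2] into [V * c^2 * h^5]. *)
- have g0 : 0 <= c * h ^+ 3 by rewrite mulr_ge0 ?exprn_ge0 ?ltW.
  apply: le_trans (caps (fun o => area (r_hull r o)) _ g0 (regular_area r0 n0) _).
    rewrite lee_fin (_ : V * _ * _ = V * c ^+ 2 * h ^+ 5); last by field; rewrite gt_eqF.
    by rewrite ler_wpM2r ?exprn_ge0 ?(ltW h0)// ge_min lexx orbT.
  move=> t th o p q fo Ap Bq op oq oC.
  have [_ _ _ _ cp] := cap h t h0 hlt th.
  have [c1 c2] := cp o p q fo Ap Bq op oq oC; split => y My.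
    by have [_ ->] := c1 y My.
  have [_] := c2 y My; apply: le_trans; rewrite lerD2l.
  have [fr1 _ _] := fr.
  have tid : `|t| <= delta by apply: le_trans th; rewrite lerDl ltW.
  have [nn1 nn2 _ _] := fr1 t tid; have [_ nn3] := unit_normal_le1 nn1.
  have n20 := lt_le_trans nu0 nn2.
  rewrite area_sbox//; last 2 first.
  + by rewrite ler_pM2r//; lra.
  + by rewrite ler_pM2r ?exprn_gt0//; lra.
  have -> : (u * h - - u * h) * ((4 * s * h ^+ 2 - 3 * s * h ^+ 2) / (nn t).2) =
    c * h ^+ 3 / (nn t).2 by rewrite /c !exprS expr0; ring.
  by rewrite ler_pdivlMr// ler_piMr.
Qed.
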